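(* Let $F$ be a $C^\infty$-lifted strongly billiard-like map defined near an interval $J=(a,b)\times\{0\}\subset\mathbb R^2_{s,y}$. Let $\tilde h$ be a $C^\infty$-smooth $F$-invariant function on $U_0\cup J$, where $U_0\subset\{y>0\}$ is a domain adjacent to $J$, with $\tilde h|_J\equiv0$ and $\frac{\partial\tilde h}{\partial y}>0$. Then, replacing $\tilde h$ by its post-composition with a $C^\infty$-smooth function of one variable (which does not change the foliation $\tilde h=const$), one can achieve that there exist a $C^\infty$-smooth function $\tau=\tau(s,y)$ and a domain $U\subset\{y>0\}$ adjacent to $J$ such that $(\tau,\tilde h)$ are symplectic coordinates on $U\cup J$ (for the form $ds\wedge dy$) and in these coordinates $$F(\tau,\tilde h)=(\tau+\sqrt{\tilde h},\ \tilde h).$$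
   Context: Here $\mathbb R_+=\{y>0\}$. A domain $U\subset\mathbb R\times\mathbb R_+$ is adjacent to $J=(a,b)\times\{0\}$ if $J\subset\partial U$ and $U\cup J$ contains a neighborhood in $\mathbb R\times\mathbb R_{\ge0}$ of each point of $J$. Billiard-like maps. Let $(a,b)$ be a (possibly (semi-)infinite) interval with coordinate $s$, and let $V\subset\mathbb R\times\mathbb R_+$ be a domain adjacent to $J=(a,b)\times\{0\}$. A mapping $F:V\cup J\to\mathbb R\times\mathbb R_{\geq0}\subset\mathbb R^2_{s,y}$ is billiard-like if: (i) $F:V\cup J\to F(V\cup J)$ is a homeomorphism fixing the points of $J$; (ii) $F|_V$ is a diffeomorphism preserving the standard area form $ds\wedge dy$; (iii) $F(s,y)=(s+w(s)\sqrt y+O(y),\,y+O(y^{3/2}))$ as $y\to0$, with $w(s)>0$, uniformly on compact subsets of the $s$-interval $(a,b)$; (iv) the variable change $(s,y)\mapsto(s,z)$, $z=\sqrt y>0$, conjugates $F$ to a smooth map $\widetilde F(s,z)$ (the lifting of $F$) that is also smooth at points of the boundary interval $J$; thus $w$ is continuous. If, in addition, $\widetilde F$ is a product of two involutions $I$ and $\beta$ (defined near $J$) fixing the points of the line $z=0$: $\widetilde F=I\circ\beta$, $I(s,z)=(s,-z)$, $\beta(s,z)=(s+w(s)z+O(z^2),-z+O(z^2))$, $\beta^2=Id$, then $F$ is called strongly billiard-like. If $F$ is strongly billiard-like and $\beta$ (equivalently, $\widetilde F$) is $C^\infty$-smooth, also at the points of $J$, then $F$ is called $C^\infty$-lifted.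 $F$-invariance of $\tilde h$ means $\tilde h(z)=\tilde h(F(z))$ whenever both $z$ and $F(z)$ lie in the domain of $\tilde h$. ''$\tilde h=const$'' denotes the foliation by connected components of level curves of $\tilde h$. *)

(* Defs.v *)
From Stdlib Require Import Reals.
From Coquelicot Require Import Coquelicot.
Open Scope R_scope.

(** * Differentiability classes on sets with boundary

    All derivatives are taken relative to the set [A] on which the function is
    considered: they are two-sided at interior points of [A] and one-sided at
    boundary points belonging to [A].  The values of a function outside [A]
    are irrelevant. *)

Definition is_derive_on (A : R -> Prop) (f : R -> R) (x l : R) : Prop :=
  filterdiff (K := R_AbsRing) (U := R_NormedModule) (V := R_NormedModule)
    f (within A (locally x)) (fun t => scal t l).

Definition is_partial1_on (A : R * R -> Prop) (f : R * R -> R)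
    (p : R * R) (l : R) : Prop :=
  is_derive_on (fun t => A (t, snd p)) (fun t => f (t, snd p)) (fst p) l.

Definition is_partial2_on (A : R * R -> Prop) (f : R * R -> R)
    (p : R * R) (l : R) : Prop :=
  is_derive_on (fun t => A (fst p, t)) (fun t => f (fst p, t)) (snd p) l.

Fixpoint Ck1_on (k : nat) (A : R -> Prop) (f : R -> R) : Prop :=
  continuous_on A f /\
  match k with
  | O => True
  | S k' => exists f' : R -> R,
      (forall x, A x -> is_derive_on A f x (f' x)) /\ Ck1_on k' A f'
  end.

Definition Cinf1_on (A : R -> Prop) (f : R -> R) : Prop :=
  forall k, Ck1_on k A f.

Fixpoint Ck_on (k : nat) (A : R * R -> Prop) (f : R * R -> R) : Prop :=
  continuous_on A f /\
  match k with
  | O => True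
  | S k' => exists f1 f2 : R * R -> R,
      (forall p, A p -> is_partial1_on A f p (f1 p)) /\
      (forall p, A p -> is_partial2_on A f p (f2 p)) /\
      Ck_on k' A f1 /\ Ck_on k' A f2
  end.

(** [Some k] stands for the class C^k and [None] for C^infinity. *)
Definition smoothness : Type := option nat.

Definition smooth_on (r : smoothness) (A : R * R -> Prop) (f : R * R -> R)
    : Prop :=
  match r with
  | Some k => Ck_on k A f
  | None => forall k, Ck_on k A f
  end.

Definition smooth_map_on (r : smoothness) (A : R * R -> Prop)
    (F : R * R -> R * R) : Prop :=
  smooth_on r A (fun p => fst (F p)) /\ smooth_on r A (fun p => snd (F p)).

Definition image (F : R * R -> R * R) (A : R * R -> Prop) (q : R * R) : Prop :=
  exists p, A p /\ F p = q.

(** Homeomorphisms and diffeomorphisms from [A] onto the image [F(A)]. *)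
Definition homeomorphism_on (A : R * R -> Prop) (F : R * R -> R * R) : Prop :=
  continuous_on A F /\
  exists G : R * R -> R * R,
    continuous_on (image F A) G /\ (forall p, A p -> G (F p) = p).

Definition diffeomorphism_on (r : smoothness) (A : R * R -> Prop)
    (F : R * R -> R * R) : Prop :=
  smooth_map_on r A F /\
  exists G : R * R -> R * R,
    smooth_map_on r (image F A) G /\ (forall p, A p -> G (F p) = p).

(** The pullback under [F] of the standard area form is the standard area
    form, i.e. the Jacobian determinant of [F] equals 1 (with sign). *)
Definition preserves_area_on (A : R * R -> Prop) (F : R * R -> R * R) : Prop :=
  forall p, A p -> exists a b c d : R,
    is_partial1_on A (fun q => fst (F q)) p a /\
    is_partial2_on A (fun q => fst (F q)) p b /\
    is_partial1_on A (fun q => snd (F q)) p c /\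
    is_partial2_on A (fun q => snd (F q)) p d /\
    a * d - b * c = 1.

(** * Domains adjacent to a boundary interval *)

Definition connected_set (A : R * R -> Prop) : Prop :=
  forall P Q : R * R -> Prop, open P -> open Q ->
    (forall p, A p -> P p \/ Q p) ->
    (exists p, A p /\ P p) -> (exists p, A p /\ Q p) ->
    exists p, A p /\ P p /\ Q p.

Definition domain (U : R * R -> Prop) : Prop :=
  (exists p, U p) /\ open U /\ connected_set U.

Definition boundary (U : R * R -> Prop) (p : R * R) : Prop :=
  forall P : R * R -> Prop, locally p P ->
    (exists q, P q /\ U q) /\ (exists q, P q /\ ~ U q).

(** The interval [J = (a,b) x {0}]; its ends may be infinite. *)
Definition bd_interval (a b : Rbar) (p : R * R) : Prop :=
  Rbar_lt a (fst p) /\ Rbar_lt (fst p) b /\ snd p = 0.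

Definition set_union (A B : R * R -> Prop) (p : R * R) : Prop := A p \/ B p.

Definition adjacent (U J : R * R -> Prop) : Prop :=
  (forall p, J p -> boundary U p) /\
  (forall p, J p -> within (fun q => 0 <= snd q) (locally p) (set_union U J)).

Definition adjacent_domain (a b : Rbar) (U : R * R -> Prop) : Prop :=
  domain U /\ (forall p, U p -> 0 < snd p) /\ adjacent U (bd_interval a b).

(** * Billiard-like maps *)

(** The variable change [(s,y) |-> (s,z)], [z = sqrt y]: the transformed domain
    and the lifting [(s,z) |-> (F_1(s,z^2), sqrt(F_2(s,z^2)))] of [F]. *)
Definition lift_set (V : R * R -> Prop) (p : R * R) : Prop :=
  0 < snd p /\ V (fst p, snd p ^ 2).

Definition lifting (F : R * R -> R * R) (p : R * R) : R * R :=
  (fst (F (fst p, snd p ^ 2)), sqrt (snd (F (fst p, snd p ^ 2)))).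

(** Uniformity on compact subsets of [(a,b)] is expressed on the segments
    [[c,d]] contained in [(a,b)].  The smoothness class in [bl_diffeo] and
    [bl_lift] is C^1, which is what makes [w] continuous. *)
Record billiard_like (a b : Rbar) (V : R * R -> Prop) (F : R * R -> R * R)
    (w : R -> R) : Prop := {
  bl_domain : adjacent_domain a b V;
  bl_range : forall p, set_union V (bd_interval a b) p -> 0 <= snd (F p);
  bl_homeo : homeomorphism_on (set_union V (bd_interval a b)) F;
  bl_fix : forall p, bd_interval a b p -> F p = p;
  bl_diffeo : diffeomorphism_on (Some 1%nat) V F;
  bl_area : preserves_area_on V F;
  bl_w_pos : forall s : R, Rbar_lt a s -> Rbar_lt s b -> 0 < w s;
  bl_asymptotics : forall c d : R, Rbar_lt a c -> c <= d -> Rbar_lt d b ->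
    exists C delta : R, 0 < delta /\
      forall s y : R, c <= s <= d -> 0 < y < delta -> V (s, y) ->
        Rabs (fst (F (s, y)) - (s + w s * sqrt y)) <= C * y /\
        Rabs (snd (F (s, y)) - y) <= C * (y * sqrt y);
  bl_lift : smooth_map_on (Some 1%nat)
    (set_union (lift_set V) (bd_interval a b)) (lifting F)
}.

Definition involI (p : R * R) : R * R := (fst p, - snd p).

(** [beta] is an involution of a (two-sided) neighborhood [W] of [J] in the
    [(s,z)]-plane, of smoothness class [r]. *)
Record lifting_involution (r : smoothness) (a b : Rbar) (V : R * R -> Prop)
    (F : R * R -> R * R) (w : R -> R)
    (W : R * R -> Prop) (beta : R * R -> R * R) : Prop := {
  li_open : open W;
  li_nbhd : forall p, bd_interval a b p -> W p;
  li_stable : forall p, W p -> W (beta p);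
  li_invol : forall p, W p -> beta (beta p) = p;
  li_smooth : smooth_map_on r W beta;
  li_fix : forall p, bd_interval a b p -> beta p = p;
  li_asymptotics : forall c d : R, Rbar_lt a c -> c <= d -> Rbar_lt d b ->
    exists C delta : R, 0 < delta /\
      forall s z : R, c <= s <= d -> Rabs z < delta -> W (s, z) ->
        Rabs (fst (beta (s, z)) - (s + w s * z)) <= C * z ^ 2 /\
        Rabs (snd (beta (s, z)) - (- z)) <= C * z ^ 2;
  li_factor : forall p, W p ->
    set_union (lift_set V) (bd_interval a b) p ->
    lifting F p = involI (beta p)
}.

(** Strongly billiard-like maps whose involution [beta] has class [r]. *)
Definition strongly_billiard_like (r : smoothness) (a b : Rbar)
    (V : R * R -> Prop) (F : R * R -> R * R) : Prop :=
  exists w : R -> R, billiard_like a b V F w /\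
    exists (W : R * R -> Prop) (beta : R * R -> R * R),
      lifting_involution r a b V F w W beta.

Definition Cinf_lifted (a b : Rbar) (V : R * R -> Prop) (F : R * R -> R * R)
    : Prop := strongly_billiard_like None a b V F.

(** [h] is considered on [D], and [F] on its domain of definition [E]. *)
Definition invariant_under (E : R * R -> Prop) (F : R * R -> R * R)
    (D : R * R -> Prop) (h : R * R -> R) : Prop :=
  forall p, E p -> D p -> D (F p) -> h (F p) = h p.

(** [(tau,h)] are C^infinity coordinates on [A] with
    [d tau /\ d h = d s /\ d y]. *)
Definition symplectic_coordinates (A : R * R -> Prop) (tau h : R * R -> R)
    : Prop :=
  diffeomorphism_on None A (fun p => (tau p, h p)) /\
  preserves_area_on A (fun p => (tau p, h p)).

(* Main.v *)
Require Import Defs.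
From Stdlib Require Import Reals Lra ClassicalEpsilon.
From Coquelicot Require Import Coquelicot.
Open Scope R_scope.

(** The function [h] replaces [y] as the second coordinate.  With
    [density = 1 / h_y], taken as a function of [(s, h)], one has
    [ds dy = density ds dh = dT dh], where [T] is the primitive of [density]
    in [s] that vanishes on a line [s = s0]: [T] is the time along the level
    curves of [h] for the Hamiltonian flow of [h], and [(T, h)] are symplectic
    coordinates ([height_smooth], [time_smooth]).  Since [F] preserves [h] and
    the area, it is a translation of [T] on each level.  The amount of this
    translation, the displacement, is a function of the level alone
    ([displacement_const]).

    The displacement is smooth in [sqrt h] but not in [h], and the involution
    [beta] tells how.  On the line [s = s0] and in the variable [z = sqrt y],
    it extends to [z < 0] when [F] is replaced by [beta].  There [beta]
    exchanges a point with its image, which reverses the displacement: the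
    extension is an odd smooth function of [z].  An odd smooth function is [z]
    times a smooth function of [z^2] ([hadamard_division], [even_sqrt_smooth]),
    so that the displacement is [sqrt y K(y)] with [K] smooth, and positive
    because [w] is ([displacement_profile]).

    Replacing [h] by [chi h] and [T] by [T / chi'] keeps the coordinates
    symplectic and divides the displacement by [chi'].  The normal form thus
    asks for [sqrt chi * chi' = displacement].  The primitive of [sqrt y M(y)]
    is [y^(3/2)] times a positive smooth function; its power [2/3] is smooth and
    solves the equation ([sqrt_primitive], [level_change]).

    Everything has to be smooth up to the boundary [y = 0], with derivatives
    relative to sets.  The calculus for this rests on two facts about relatively
    open subsets of a half-plane: continuous partial derivatives give a total
    derivative ([diffat_of_partials]), and a continuous inverse of a smooth map
    with nonzero Jacobian is smooth ([inverse_smooth]).  As the neighbourhoods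
    of the boundary may shrink towards the ends of the interval, all domains
    are cut down to unions of rectangles with one side on [s = s0] ([hull]): on
    them every horizontal slice is connected and meets that line. *)

(** * Differentiation relative to a set *)

Definition near (d : R) (p q : R * R) : Prop :=
  Rabs (fst q - fst p) < d /\ Rabs (snd q - snd p) < d.

(** [cont], [der], [pd1] and [pd2] spell out [continuous_on], [is_derive_on],
    [is_partial1_on] and [is_partial2_on] with epsilon and delta. *)
Definition cont (A : R * R -> Prop) (f : R * R -> R) : Prop :=
  forall p, A p -> forall e, 0 < e ->
  exists d, 0 < d /\ forall q, A q -> near d p q -> Rabs (f q - f p) < e.

Definition der (A : R -> Prop) (f : R -> R) (x l : R) : Prop :=
  forall e, 0 < e ->
  exists d, 0 < d /\ forall t, A t -> Rabs (t - x) < d ->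
    Rabs (f t - f x - l * (t - x)) <= e * Rabs (t - x).

Definition pd1 (A : R * R -> Prop) (f : R * R -> R) (p : R * R) (l : R) : Prop :=
  der (fun t => A (t, snd p)) (fun t => f (t, snd p)) (fst p) l.

Definition pd2 (A : R * R -> Prop) (f : R * R -> R) (p : R * R) (l : R) : Prop :=
  der (fun t => A (fst p, t)) (fun t => f (fst p, t)) (snd p) l.

(** Partial derivatives do not obey a chain rule; this total derivative does. *)
Definition diffat (A : R * R -> Prop) (f : R * R -> R) (p : R * R) (l1 l2 : R)
    : Prop :=
  forall e, 0 < e ->
  exists d, 0 < d /\ forall q, A q -> near d p q ->
    Rabs (f q - f p - l1 * (fst q - fst p) - l2 * (snd q - snd p))
      <= e * (Rabs (fst q - fst p) + Rabs (snd q - snd p)).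

Definition has_partials (A : R * R -> Prop) (f f1 f2 : R * R -> R) : Prop :=
  forall p, A p -> pd1 A f p (f1 p) /\ pd2 A f p (f2 p).

Lemma near_le d d' p q : d <= d' -> near d p q -> near d' p q.
Proof. intros H [H1 H2]; split; lra. Qed.

Lemma near_refl d p : 0 < d -> near d p p.
Proof. intros H; split; rewrite Rminus_diag, Rabs_R0; exact H. Qed.

Lemma Rmin_pos a b : 0 < a -> 0 < b -> 0 < Rmin a b.
Proof. intros; apply Rmin_glb_lt; assumption. Qed.

Lemma continuous_on_cont A (f : R * R -> R) : continuous_on A f <-> cont A f.
Proof.
  split.
  - intros H p Ap e He. specialize (H p Ap).
    apply (proj1 (filterlim_locally f (f p))) with (eps := mkposreal e He) in H.
    destruct H as [d Hd]. exists d; split; [apply cond_pos|].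
    intros q Aq [N1 N2]. apply (Hd q); [split; [exact N1|exact N2]|exact Aq].
  - intros H p Ap. apply filterlim_locally. intros e.
    destruct (H p Ap e (cond_pos e)) as [d [Hd Hq]].
    exists (mkposreal d Hd). intros q [N1 N2] Aq. apply (Hq q Aq). split; [exact N1|exact N2].
Qed.

Lemma continuous_on_cont2 A (F : R * R -> R * R) :
  continuous_on A F <-> cont A (fun p => fst (F p)) /\ cont A (fun p => snd (F p)).
Proof.
  split.
  - intros H; split; intros p Ap e He; specialize (H p Ap);
      apply (proj1 (filterlim_locally F (F p))) with (eps := mkposreal e He) in H;
      destruct H as [d Hd]; exists d; (split; [apply cond_pos|]);
      intros q Aq [N1 N2]; apply (Hd q); [split; [exact N1|exact N2]|exact Aq
        |split; [exact N1|exact N2]|exact Aq].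
  - intros [H1 H2] p Ap. apply filterlim_locally. intros e.
    destruct (H1 p Ap e (cond_pos e)) as [d1 [Hd1 Hq1]].
    destruct (H2 p Ap e (cond_pos e)) as [d2 [Hd2 Hq2]].
    exists (mkposreal _ (Rmin_pos _ _ Hd1 Hd2)). intros q [N1 N2] Aq.
    assert (N : near (Rmin d1 d2) p q) by (split; [exact N1|exact N2]).
    split.
    + apply (Hq1 q Aq). eapply near_le; [apply Rmin_l|exact N].
    + apply (Hq2 q Aq). eapply near_le; [apply Rmin_r|exact N].
Qed.

Lemma is_derive_on_der A f x l : A x -> (is_derive_on A f x l <-> der A f x l).
Proof.
  intros Ax; split.
  - intros [_ H] e He.
    assert (Hx : is_filter_lim (within A (locally x)) x).
    { intros P [d Hd]. exists d. intros y Hy _. apply Hd, Hy. }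
    destruct (H x Hx (mkposreal e He)) as [d Hd].
    exists d; split; [apply cond_pos|]. intros t At Ht.
    specialize (Hd t Ht At). simpl in Hd.
    unfold norm, minus, plus, opp, scal in Hd; simpl in Hd.
    unfold abs, mult in Hd; simpl in Hd.
    replace (f t - f x - l * (t - x)) with (f t + - f x + - ((t + - x) * l)) by ring.
    exact Hd.
  - intros H; split.
    + exact (@is_linear_scal_l R_AbsRing R_NormedModule l).
    + intros y Hy.
      assert (E : y = x).
      { destruct (Req_dec y x) as [E|E]; [exact E|exfalso].
        assert (P : locally y (fun z => z <> x)).
        { assert (Hp : 0 < Rabs (y - x)) by (apply Rabs_pos_lt; lra).
          exists (mkposreal _ Hp). intros z Hz Ez. subst z.
          apply (Rlt_irrefl (Rabs (y - x))).
          rewrite (Rabs_minus_sym y x) at 1. exact Hz. }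
        destruct (Hy _ P) as [d Hd].
        apply (Hd x); [apply ball_center|exact Ax|reflexivity]. }
      subst y. intros e. destruct (H e (cond_pos e)) as [d [Hd Ht]].
      exists (mkposreal d Hd). intros t Nt At. specialize (Ht t At Nt).
      unfold norm, minus, plus, opp, scal; simpl. unfold abs, mult; simpl.
      replace (f t + - f x + - ((t + - x) * l)) with (f t - f x - l * (t - x)) by ring.
      exact Ht.
Qed.

Lemma is_partial1_on_pd1 A f p l : A p -> (is_partial1_on A f p l <-> pd1 A f p l).
Proof. destruct p as [s y]; intros Ap; apply is_derive_on_der; exact Ap. Qed.

Lemma is_partial2_on_pd2 A f p l : A p -> (is_partial2_on A f p l <-> pd2 A f p l).
Proof. destruct p as [s y]; intros Ap; apply is_derive_on_der; exact Ap. Qed.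

Lemma Ck_on_cont k A f : Ck_on k A f -> cont A f.
Proof. intros H; apply continuous_on_cont; destruct k; apply H. Qed.

Lemma Ck_on_O A f : cont A f -> Ck_on 0 A f.
Proof. intros H; split; [apply continuous_on_cont, H|exact I]. Qed.

Lemma Ck_on_S k A f : Ck_on (S k) A f <->
  cont A f /\ exists f1 f2, has_partials A f f1 f2 /\ Ck_on k A f1 /\ Ck_on k A f2.
Proof.
  simpl; rewrite continuous_on_cont; split.
  - intros [H [f1 [f2 [P1 [P2 [C1 C2]]]]]]. split; [exact H|].
    exists f1, f2; split; [|split; assumption].
    intros p Ap; split;
      [apply is_partial1_on_pd1; auto|apply is_partial2_on_pd2; auto].
  - intros [H [f1 [f2 [P [C1 C2]]]]]. split; [exact H|].
    exists f1, f2. split; [|split; [|split; assumption]]; intros p Ap.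
    + apply is_partial1_on_pd1; [exact Ap|apply (P p Ap)].
    + apply is_partial2_on_pd2; [exact Ap|apply (P p Ap)].
Qed.

Lemma der_ext A f g x l : A x -> (forall t, A t -> f t = g t) -> der A f x l -> der A g x l.
Proof.
  intros Ax E H e He. destruct (H e He) as [d [Hd Ht]]. exists d; split; [exact Hd|].
  intros t At Nt. rewrite <- (E t At), <- (E x Ax). auto.
Qed.

Lemma der_sub (A B : R -> Prop) f x l :
  (forall t, B t -> A t) -> der A f x l -> der B f x l.
Proof.
  intros S H e He. destruct (H e He) as [d [Hd Ht]]. exists d; split; [exact Hd|].
  intros t Bt; apply Ht, S, Bt.
Qed.

Lemma der_local (A B : R -> Prop) f x l r : 0 < r ->
  (forall t, B t -> Rabs (t - x) < r -> A t) -> der A f x l -> der B f x l.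
Proof.
  intros Hr S H e He. destruct (H e He) as [d [Hd Ht]].
  exists (Rmin d r); split; [apply Rmin_pos; assumption|].
  intros t Bt Nt. pose proof (Rmin_l d r). pose proof (Rmin_r d r).
  apply Ht; [apply S; [exact Bt|lra]|lra].
Qed.

Lemma der_const A c x : der A (fun _ => c) x 0.
Proof.
  intros e He; exists 1; split; [lra|]; intros t _ _.
  replace (c - c - 0 * (t - x)) with 0 by ring. rewrite Rabs_R0.
  apply Rmult_le_pos; [lra|apply Rabs_pos].
Qed.

Lemma der_id A x : der A (fun t => t) x 1.
Proof.
  intros e He; exists 1; split; [lra|]; intros t _ _.
  replace (t - x - 1 * (t - x)) with 0 by ring. rewrite Rabs_R0.
  apply Rmult_le_pos; [lra|apply Rabs_pos].
Qed.

Lemma is_derive_der (A : R -> Prop) f x l : is_derive f x l -> der A f x l.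
Proof.
  intros H. apply (der_sub (fun _ => True)); [trivial|].
  apply is_derive_on_der; [trivial|]. destruct H as [L H]. split; [exact L|].
  intros y Hy. intros e.
  assert (Hy' : is_filter_lim (locally x) y).
  { intros P HP. destruct (Hy P HP) as [d Hd]. exists d; intros z Hz; apply Hd; auto. }
  destruct (H y Hy' e) as [d Hd]. exists d. intros z Hz _. apply Hd, Hz.
Qed.

Lemma der_is_derive (A : R -> Prop) f x l r : 0 < r ->
  (forall t, Rabs (t - x) < r -> A t) -> der A f x l -> is_derive f x l.
Proof.
  intros Hr S H.
  assert (H' : is_derive_on (fun _ => True) f x l).
  { apply is_derive_on_der; [trivial|]. apply (der_local A _ f x l r Hr); auto. }
  destruct H' as [L H']. split; [exact L|]. intros y Hy e.
  assert (Hy' : is_filter_lim (within (fun _ => True) (locally x)) y).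
  { intros P HP. destruct (Hy P HP) as [d Hd]. exists d; intros z Hz _; apply Hd; auto. }
  destruct (H' y Hy' e) as [d Hd]. exists d. intros z Hz. apply (Hd z Hz); trivial.
Qed.

Lemma der_unique (A : R -> Prop) f x l l' :
  (forall d, 0 < d -> exists t, A t /\ t <> x /\ Rabs (t - x) < d) ->
  der A f x l -> der A f x l' -> l = l'.
Proof.
  intros Acc H H'. apply Rminus_diag_uniq.
  destruct (Req_dec (l - l') 0) as [E|E]; [exact E|exfalso].
  assert (He : 0 < Rabs (l - l') / 4) by (pose proof (Rabs_pos_lt _ E); lra).
  destruct (H _ He) as [d [Hd Ht]]. destruct (H' _ He) as [d' [Hd' Ht']].
  destruct (Acc _ (Rmin_pos _ _ Hd Hd')) as [t [At [Nx Nt]]].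
  pose proof (Rmin_l d d'). pose proof (Rmin_r d d').
  specialize (Ht t At ltac:(lra)). specialize (Ht' t At ltac:(lra)).
  assert (Hx : 0 < Rabs (t - x)) by (apply Rabs_pos_lt; lra).
  assert (B : Rabs ((l - l') * (t - x)) <= Rabs (l - l') / 2 * Rabs (t - x)).
  { replace ((l - l') * (t - x))
      with ((f t - f x - l' * (t - x)) - (f t - f x - l * (t - x))) by ring.
    eapply Rle_trans; [apply Rabs_triang|]. rewrite Rabs_Ropp. lra. }
  rewrite Rabs_mult in B. pose proof (Rabs_pos_lt _ E). nra.
Qed.

Lemma der_lipschitz A f x l : der A f x l ->
  exists d, 0 < d /\ forall t, A t -> Rabs (t - x) < d ->
    Rabs (f t - f x) <= (Rabs l + 1) * Rabs (t - x).
Proof.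
  intros H. destruct (H 1 Rlt_0_1) as [d [Hd Ht]]. exists d; split; [exact Hd|].
  intros t At Nt. specialize (Ht t At Nt).
  replace (f t - f x) with ((f t - f x - l * (t - x)) + l * (t - x)) by ring.
  eapply Rle_trans; [apply Rabs_triang|]. rewrite Rabs_mult. lra.
Qed.

(** The outer function is differentiable relative to [A] only; as the inner map
    takes its values there, the chain rule extends up to the boundary. *)
Lemma der_chain (A : R * R -> Prop) f (B : R -> Prop) g k x l1 l2 g' k' :
  (forall t, B t -> A (g t, k t)) ->
  diffat A f (g x, k x) l1 l2 -> der B g x g' -> der B k x k' ->
  der B (fun t => f (g t, k t)) x (l1 * g' + l2 * k').
Proof.
  intros Im Hf Hg Hk e He.
  set (Lg := Rabs g' + 1). set (Lk := Rabs k' + 1).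
  assert (HLg : 0 < Lg) by (unfold Lg; pose proof (Rabs_pos g'); lra).
  assert (HLk : 0 < Lk) by (unfold Lk; pose proof (Rabs_pos k'); lra).
  assert (He1 : 0 < e / (2 * (Lg + Lk))) by (apply Rdiv_lt_0_compat; lra).
  set (m := Rabs l1 + Rabs l2 + 1).
  assert (Hm : 0 < m) by (unfold m; pose proof (Rabs_pos l1); pose proof (Rabs_pos l2); lra).
  assert (He2 : 0 < e / (2 * m)) by (apply Rdiv_lt_0_compat; lra).
  destruct (Hf _ He1) as [d [Hd Hq]].
  destruct (der_lipschitz _ _ _ _ Hg) as [dg [Hdg Bg]].
  destruct (der_lipschitz _ _ _ _ Hk) as [dk [Hdk Bk]].
  destruct (Hg _ He2) as [dg' [Hdg' Cg]]. destruct (Hk _ He2) as [dk' [Hdk' Ck]].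
  fold Lg in Bg. fold Lk in Bk.
  exists (Rmin (Rmin (d / Lg) (d / Lk)) (Rmin (Rmin dg dk) (Rmin dg' dk'))).
  assert (0 < d / Lg) by (apply Rdiv_lt_0_compat; lra).
  assert (0 < d / Lk) by (apply Rdiv_lt_0_compat; lra).
  split; [repeat apply Rmin_pos; assumption|].
  intros t Bt Nt.
  apply Rmin_Rgt_l in Nt. destruct Nt as [N1 N2].
  apply Rmin_Rgt_l in N1. destruct N1 as [N1 N1'].
  apply Rmin_Rgt_l in N2. destruct N2 as [N2 N3].
  apply Rmin_Rgt_l in N2. destruct N2 as [N2 N2'].
  apply Rmin_Rgt_l in N3. destruct N3 as [N3 N3'].
  specialize (Bg t Bt ltac:(lra)). specialize (Bk t Bt ltac:(lra)).
  specialize (Cg t Bt ltac:(lra)). specialize (Ck t Bt ltac:(lra)).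
  assert (M1 : Lg * Rabs (t - x) < d).
  { apply (Rmult_lt_compat_l Lg) in N1; [|lra].
    replace (Lg * (d / Lg)) with d in N1 by (field; lra). lra. }
  assert (M2 : Lk * Rabs (t - x) < d).
  { apply (Rmult_lt_compat_l Lk) in N1'; [|lra].
    replace (Lk * (d / Lk)) with d in N1' by (field; lra). lra. }
  assert (Nr : near d (g x, k x) (g t, k t)) by (split; simpl; lra).
  specialize (Hq _ (Im t Bt) Nr). simpl in Hq.
  set (D := Rabs (t - x)) in *.
  assert (HD : 0 <= D) by apply Rabs_pos.
  replace (f (g t, k t) - f (g x, k x) - (l1 * g' + l2 * k') * (t - x)) with
    ((f (g t, k t) - f (g x, k x) - l1 * (g t - g x) - l2 * (k t - k x))
     + (l1 * (g t - g x - g' * (t - x)) + l2 * (k t - k x - k' * (t - x)))) by ring.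
  eapply Rle_trans; [apply Rabs_triang|].
  eapply Rle_trans; [apply Rplus_le_compat_l, Rabs_triang|]. rewrite !Rabs_mult.
  assert (Q1 : e / (2 * (Lg + Lk)) * (Rabs (g t - g x) + Rabs (k t - k x)) <= e / 2 * D).
  { replace (e / 2 * D) with (e / (2 * (Lg + Lk)) * (Lg * D + Lk * D)) by (field; lra).
    apply Rmult_le_compat_l; lra. }
  assert (Q2 : Rabs l1 * Rabs (g t - g x - g' * (t - x))
               + Rabs l2 * Rabs (k t - k x - k' * (t - x)) <= e / 2 * D).
  { replace (e / 2 * D) with (m * (e / (2 * m) * D)) by (field; lra).
    pose proof (Rabs_pos l1). pose proof (Rabs_pos l2).
    assert (0 <= e / (2 * m) * D) by (apply Rmult_le_pos; lra).
    unfold m at 1.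
    apply Rle_trans with ((Rabs l1 + Rabs l2) * (e / (2 * m) * D)); [|nra].
    rewrite Rmult_plus_distr_r. apply Rplus_le_compat; apply Rmult_le_compat_l; lra. }
  lra.
Qed.

Lemma diffat_mult A p : diffat A (fun q => fst q * snd q) p (snd p) (fst p).
Proof.
  intros e He; exists e; split; [exact He|]. intros q _ [N1 N2].
  replace (fst q * snd q - fst p * snd p - snd p * (fst q - fst p) - fst p * (snd q - snd p))
    with ((fst q - fst p) * (snd q - snd p)) by ring.
  rewrite Rabs_mult.
  pose proof (Rabs_pos (fst q - fst p)); pose proof (Rabs_pos (snd q - snd p)). nra.
Qed.

Lemma diffat_plus A p : diffat A (fun q => fst q + snd q) p 1 1.
Proof.
  intros e He; exists e; split; [exact He|]. intros q _ _.
  replace (fst q + snd q - (fst p + snd p) - 1 * (fst q - fst p) - 1 * (snd q - snd p))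
    with 0 by ring. rewrite Rabs_R0.
  pose proof (Rabs_pos (fst q - fst p)); pose proof (Rabs_pos (snd q - snd p)). nra.
Qed.

Lemma diffat_fst A f p l : der A f (fst p) l ->
  diffat (fun q => A (fst q)) (fun q => f (fst q)) p l 0.
Proof.
  intros H e He. destruct (H e He) as [d [Hd Ht]]. exists d; split; [exact Hd|].
  intros q Aq [N1 _]. specialize (Ht _ Aq N1). rewrite Rmult_0_l, Rminus_0_r.
  pose proof (Rabs_pos (snd q - snd p)). nra.
Qed.

Lemma der_plus A f g x l m :
  der A f x l -> der A g x m -> der A (fun t => f t + g t) x (l + m).
Proof.
  intros Hf Hg. replace (l + m) with (1 * l + 1 * m) by ring.
  apply (der_chain (fun _ => True) (fun q => fst q + snd q)); auto using diffat_plus.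
Qed.

Lemma der_mult A f g x l m :
  der A f x l -> der A g x m -> der A (fun t => f t * g t) x (g x * l + f x * m).
Proof.
  intros Hf Hg.
  apply (der_chain (fun _ => True) (fun q => fst q * snd q)); auto.
  apply (diffat_mult _ (f x, g x)).
Qed.

Lemma der_comp A f B g x l m : (forall t, B t -> A (g t)) ->
  der A f (g x) l -> der B g x m -> der B (fun t => f (g t)) x (l * m).
Proof.
  intros Im Hf Hg. replace (l * m) with (l * m + 0 * 0) by ring.
  apply (der_chain (fun q => A (fst q)) (fun q => f (fst q)) B g (fun _ => 0)); auto.
  - apply (diffat_fst _ _ (g x, 0)), Hf.
  - apply der_const.
Qed.

Lemma der_eq A f x l l' : l = l' -> der A f x l -> der A f x l'.
Proof. intros ->; trivial. Qed.

Lemma der_scal A f x l c : der A f x l -> der A (fun t => c * f t) x (c * l).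
Proof.
  intros H. apply (der_eq _ _ _ (f x * 0 + c * l)); [ring|].
  apply der_mult; [apply der_const|exact H].
Qed.

Lemma der_opp A f x l : der A f x l -> der A (fun t => - f t) x (- l).
Proof.
  intros H e He. destruct (H e He) as [d [Hd Ht]]. exists d; split; [exact Hd|].
  intros t At Nt. replace (- f t - - f x - - l * (t - x)) with (- (f t - f x - l * (t - x))) by ring.
  rewrite Rabs_Ropp; auto.
Qed.

Lemma der_minus A f g x l m :
  der A f x l -> der A g x m -> der A (fun t => f t - g t) x (l - m).
Proof. intros Hf Hg. apply der_plus; [exact Hf|apply der_opp, Hg]. Qed.

Lemma diffat_pd1 A f p l1 l2 : diffat A f p l1 l2 -> pd1 A f p l1.
Proof.
  destruct p as [s y]. intros H e He. destruct (H e He) as [d [Hd Ht]]. exists d; split; [exact Hd|].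
  simpl. intros t At Nt. specialize (Ht (t, y) At). simpl in Ht.
  rewrite !Rminus_diag, Rabs_R0, Rplus_0_r, Rmult_0_r, Rminus_0_r in Ht.
  apply Ht. split; simpl; [exact Nt|rewrite Rminus_diag, Rabs_R0; exact Hd].
Qed.

Lemma diffat_pd2 A f p l1 l2 : diffat A f p l1 l2 -> pd2 A f p l2.
Proof.
  destruct p as [s y]. intros H e He. destruct (H e He) as [d [Hd Ht]]. exists d; split; [exact Hd|].
  simpl. intros t At Nt. specialize (Ht (s, t) At). simpl in Ht.
  rewrite !Rminus_diag, Rabs_R0, Rplus_0_l, Rmult_0_r, Rminus_0_r in Ht.
  apply Ht. split; simpl; [rewrite Rminus_diag, Rabs_R0; exact Hd|exact Nt].
Qed.

(** ** Continuity relative to a set *)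

Lemma cont_sub (A B : R * R -> Prop) f : (forall p, B p -> A p) -> cont A f -> cont B f.
Proof.
  intros S H p Bp e He. destruct (H p (S p Bp) e He) as [d [Hd Hq]].
  exists d; split; auto.
Qed.

Lemma cont_ext A f g : (forall p, A p -> f p = g p) -> cont A f -> cont A g.
Proof.
  intros E H p Ap e He. destruct (H p Ap e He) as [d [Hd Hq]].
  exists d; split; auto. intros q Aq Nq. rewrite <- !E; auto.
Qed.

Lemma cont_const A c : cont A (fun _ => c).
Proof.
  intros p _ e He; exists 1; split; [lra|]. intros. rewrite Rminus_diag, Rabs_R0; exact He.
Qed.

Lemma cont_fst A : cont A fst.
Proof. intros p _ e He; exists e; split; [exact He|]. intros q _ [N _]; exact N. Qed.

Lemma cont_snd A : cont A snd.
Proof. intros p _ e He; exists e; split; [exact He|]. intros q _ [_ N]; exact N. Qed.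

Lemma cont_comp A f B g k : (forall q, B q -> A (g q, k q)) ->
  cont A f -> cont B g -> cont B k -> cont B (fun q => f (g q, k q)).
Proof.
  intros Im Hf Hg Hk p Bp e He.
  destruct (Hf _ (Im p Bp) e He) as [d [Hd Hq]].
  destruct (Hg p Bp d Hd) as [dg [Hdg Qg]]. destruct (Hk p Bp d Hd) as [dk [Hdk Qk]].
  exists (Rmin dg dk); split; [apply Rmin_pos; assumption|]. intros q Bq Nq.
  apply Hq; [apply Im, Bq|]. split; simpl.
  - apply Qg; [exact Bq|]. eapply near_le; [apply Rmin_l|exact Nq].
  - apply Qk; [exact Bq|]. eapply near_le; [apply Rmin_r|exact Nq].
Qed.

Lemma diffat_cont_at A f p l1 l2 : diffat A f p l1 l2 -> forall e, 0 < e ->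
  exists d, 0 < d /\ forall q, A q -> near d p q -> Rabs (f q - f p) < e.
Proof.
  intros H e He. destruct (H 1 Rlt_0_1) as [d [Hd Hq]].
  set (m := 2 * (Rabs l1 + Rabs l2 + 2)).
  assert (Hm : 0 < m) by (unfold m; pose proof (Rabs_pos l1); pose proof (Rabs_pos l2); lra).
  assert (Hem : 0 < e / m) by (apply Rdiv_lt_0_compat; lra).
  exists (Rmin d (e / m)); split; [apply Rmin_pos; assumption|]. intros q Aq Nq.
  specialize (Hq q Aq (near_le _ _ _ _ (Rmin_l _ _) Nq)).
  destruct (near_le _ _ _ _ (Rmin_r _ _) Nq) as [N1 N2].
  set (u := fst q - fst p) in *. set (v := snd q - snd p) in *.
  replace (f q - f p) with ((f q - f p - l1 * u - l2 * v) + (l1 * u + l2 * v)) by ring.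
  eapply Rle_lt_trans; [apply Rabs_triang|].
  assert (Rabs (l1 * u + l2 * v) <= Rabs l1 * Rabs u + Rabs l2 * Rabs v).
  { eapply Rle_trans; [apply Rabs_triang|]. rewrite !Rabs_mult; lra. }
  assert (E : e = m * (e / m)) by (field; lra).
  pose proof (Rabs_pos l1); pose proof (Rabs_pos l2); pose proof (Rabs_pos u); pose proof (Rabs_pos v).
  apply Rle_lt_trans with ((Rabs l1 + Rabs l2 + 2) * (e / m)).
  - nra.
  - rewrite E at 2. apply Rmult_lt_compat_r; [exact Hem|unfold m; lra].
Qed.

Lemma diffat_cont A f g1 g2 : (forall p, A p -> diffat A f p (g1 p) (g2 p)) -> cont A f.
Proof. intros H p Ap. eapply diffat_cont_at, H, Ap. Qed.

Lemma cont_plus A f g : cont A f -> cont A g -> cont A (fun p => f p + g p).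
Proof.
  intros. apply (cont_comp (fun _ => True) (fun q => fst q + snd q)); auto.
  apply (diffat_cont _ _ (fun _ => 1) (fun _ => 1)). intros; apply diffat_plus.
Qed.

Lemma cont_mult A f g : cont A f -> cont A g -> cont A (fun p => f p * g p).
Proof.
  intros. apply (cont_comp (fun _ => True) (fun q => fst q * snd q)); auto.
  apply (diffat_cont _ _ snd fst). intros; apply diffat_mult.
Qed.

Lemma cont_comp_continuous A f phi : cont A f -> (forall p, A p -> continuous phi (f p)) ->
  cont A (fun p => phi (f p)).
Proof.
  intros Hf C p Ap e He. specialize (C p Ap).
  apply (proj1 (filterlim_locally phi _)) with (eps := mkposreal e He) in C.
  destruct C as [d Hd]. destruct (Hf p Ap d (cond_pos d)) as [d' [Hd' Q]].
  exists d'; split; [exact Hd'|]. intros q Aq Nq. apply (Hd (f q)), (Q q Aq Nq).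
Qed.

Lemma cont_comp1 A f phi phi' : cont A f -> (forall p, A p -> is_derive phi (f p) (phi' p)) ->
  cont A (fun p => phi (f p)).
Proof.
  intros Hf D. apply cont_comp_continuous; [exact Hf|]. intros p Ap.
  apply (@ex_derive_continuous R_AbsRing R_NormedModule). exists (phi' p); auto.
Qed.

(** ** Mean value theorem on a segment *)

Definition seg (x y t : R) : Prop := Rmin x y <= t <= Rmax x y.

Lemma seg_sym x y t : seg x y t -> seg y x t.
Proof. unfold seg; rewrite Rmin_comm, Rmax_comm; trivial. Qed.

Lemma seg_l x y : seg x y x.
Proof. split; [apply Rmin_l|apply Rmax_l]. Qed.

Lemma seg_r x y : seg x y y.
Proof. split; [apply Rmin_r|apply Rmax_r]. Qed.

Lemma seg_Rabs x y t : seg x y t -> Rabs (t - x) <= Rabs (y - x).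
Proof.
  unfold seg, Rmin, Rmax; destruct (Rle_dec x y); intros [H1 H2];
    unfold Rabs; destruct (Rcase_abs (t - x)), (Rcase_abs (y - x)); lra.
Qed.

Lemma seg_trans x y t u : seg x y t -> seg x t u -> seg x y u.
Proof.
  unfold seg, Rmin, Rmax; destruct (Rle_dec x y), (Rle_dec x t); intros [? ?] [? ?]; split; lra.
Qed.

Definition clamp (a b t : R) : R := Rmax a (Rmin b t).

Lemma clamp_in a b t : a <= b -> a <= clamp a b t <= b.
Proof.
  intros H; split; [apply Rmax_l|]. apply Rmax_lub; [exact H|apply Rmin_l].
Qed.

Lemma clamp_id a b t : a <= t <= b -> clamp a b t = t.
Proof.
  intros H; unfold clamp. rewrite Rmin_right by lra. apply Rmax_right; lra.
Qed.

Lemma clamp_lipschitz a b t u : Rabs (clamp a b t - clamp a b u) <= Rabs (t - u).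
Proof.
  pose proof (Rle_abs (t - u)).
  pose proof (Rle_abs (u - t)) as H'. rewrite (Rabs_minus_sym u t) in H'.
  apply Rabs_le. unfold clamp, Rmin. destruct (Rle_dec b t), (Rle_dec b u);
    unfold Rmax;
    repeat match goal with |- context [Rle_dec ?x ?y] => destruct (Rle_dec x y) end; split; lra.
Qed.

(** Clamping the argument turns continuity relative to [[a,b]] into continuity
    on the line, the form in which the classical theorems are available. *)
Lemma clamp_continuity a b f : a <= b ->
  (forall x, a <= x <= b -> forall e, 0 < e -> exists d, 0 < d /\
     forall t, a <= t <= b -> Rabs (t - x) < d -> Rabs (f t - f x) < e) ->
  forall x, continuity_pt (fun t => f (clamp a b t)) x.
Proof.
  intros Hab H x e He. destruct (H _ (clamp_in a b x Hab) e He) as [d [Hd Ht]].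
  exists d; split; [exact Hd|]. intros t [_ Nt]. simpl in *. unfold R_dist in *.
  apply Ht; [apply clamp_in, Hab|].
  eapply Rle_lt_trans; [apply clamp_lipschitz|exact Nt].
Qed.

Lemma der_mean_value A f f' x y : (forall t, seg x y t -> A t /\ der A f t (f' t)) ->
  exists c, seg x y c /\ f y - f x = f' c * (y - x).
Proof.
  intros H. set (a := Rmin x y). set (b := Rmax x y).
  assert (Hab : a <= b) by (apply Rle_trans with x; [apply Rmin_l|apply Rmax_l]).
  assert (Ext : forall t, seg x y t -> f (clamp a b t) = f t)
    by (intros t Ht; rewrite clamp_id; [reflexivity|exact Ht]).
  destruct (MVT_gen (fun t => f (clamp a b t)) x y f') as [c [Hc E]].
  - fold a b. intros t Ht.
    apply (is_derive_ext_loc f).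
    + assert (Hr : 0 < Rmin (t - a) (b - t)) by (apply Rmin_pos; lra).
      exists (mkposreal _ Hr). intros u Hu. rewrite clamp_id; [reflexivity|].
      apply Rabs_def2 in Hu. simpl in Hu.
      pose proof (Rmin_l (t - a) (b - t)); pose proof (Rmin_r (t - a) (b - t)).
      unfold minus, plus, opp in Hu; simpl in Hu. lra.
    + assert (Hr : 0 < Rmin (t - a) (b - t)) by (apply Rmin_pos; lra).
      apply (der_is_derive A _ _ _ _ Hr); [|apply H; unfold seg; fold a b; lra].
      intros u Hu. apply Rabs_def2 in Hu.
      pose proof (Rmin_l (t - a) (b - t)); pose proof (Rmin_r (t - a) (b - t)).
      apply H; unfold seg; fold a b; lra.
  - intros t _. apply (clamp_continuity a b f Hab). intros u Hu e He.
    destruct (H u Hu) as [Au Du].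
    destruct (der_lipschitz _ _ _ _ Du) as [d [Hd L]].
    set (m := Rabs (f' u) + 1) in *.
    assert (Hm : 0 < m) by (unfold m; pose proof (Rabs_pos (f' u)); lra).
    assert (0 < e / m) by (apply Rdiv_lt_0_compat; lra).
    exists (Rmin d (e / m)); split; [apply Rmin_pos; lra|]. intros v Hv Nv.
    apply Rmin_Rgt_l in Nv. destruct Nv as [N1 N2].
    eapply Rle_lt_trans; [apply L; [apply H, Hv|lra]|].
    apply Rgt_lt, (Rmult_lt_compat_l m) in N2; [|exact Hm].
    replace (m * (e / m)) with e in N2 by (field; lra). exact N2.
  - exists c; split; [exact Hc|]. rewrite !Ext in E; auto using seg_l, seg_r.
Qed.

(** * Smooth functions on relatively open subsets of a half-plane *)

(** For [l = m_infty] the half-plane [y >= l] is the whole plane.  Both cases are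
    needed: functions of [y] or of the level of [h] live on a half-plane, those
    of [z = +- sqrt y] on the plane. *)
Definition rel_open (l : Rbar) (A : R * R -> Prop) : Prop :=
  forall p, A p -> Rbar_le l (snd p) /\
  exists d, 0 < d /\ forall q, near d p q -> Rbar_le l (snd q) -> A q.

Lemma Rbar_le_seg (l : Rbar) (x y t : R) : Rbar_le l x -> Rbar_le l y -> seg x y t -> Rbar_le l t.
Proof.
  intros Hx Hy [H _]. apply Rbar_le_trans with (Rmin x y); [|exact H].
  apply Rmin_case; assumption.
Qed.

Lemma rel_open_and l A B : rel_open l A -> rel_open l B -> rel_open l (fun p => A p /\ B p).
Proof.
  intros HA HB p [Ap Bp]. destruct (HA p Ap) as [L [d [Hd QA]]].
  destruct (HB p Bp) as [_ [d' [Hd' QB]]]. split; [exact L|].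
  exists (Rmin d d'); split; [apply Rmin_pos; assumption|]. intros q Nq Lq.
  split; [apply QA|apply QB]; trivial; (eapply near_le; [|exact Nq]);
    [apply Rmin_l|apply Rmin_r].
Qed.

Lemma rel_open_preimage l l' A O g k : rel_open l A -> rel_open l' O ->
  cont A g -> cont A k -> (forall p, A p -> Rbar_le l' (k p)) ->
  rel_open l (fun p => A p /\ O (g p, k p)).
Proof.
  intros HA HO Cg Ck Hk p [Ap Op]. destruct (HA p Ap) as [L [d [Hd QA]]].
  destruct (HO _ Op) as [_ [e [He QO]]].
  destruct (Cg p Ap e He) as [dg [Hdg Qg]]. destruct (Ck p Ap e He) as [dk [Hdk Qk]].
  split; [exact L|]. exists (Rmin d (Rmin dg dk)).
  split; [repeat apply Rmin_pos; assumption|]. intros q Nq Lq.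
  assert (Nd : near d p q) by (eapply near_le; [apply Rmin_l|exact Nq]).
  assert (Ng : near dg p q).
  { eapply near_le; [|exact Nq]. eapply Rle_trans; [apply Rmin_r|apply Rmin_l]. }
  assert (Nk : near dk p q).
  { eapply near_le; [|exact Nq]. eapply Rle_trans; [apply Rmin_r|apply Rmin_r]. }
  assert (Aq : A q) by auto. split; [exact Aq|].
  apply QO; [split; simpl; auto|simpl; auto].
Qed.

Lemma rel_open_equiv l A B : (forall p, A p <-> B p) -> rel_open l A -> rel_open l B.
Proof.
  intros E H p Bp. destruct (H p (proj2 (E p) Bp)) as [L [d [Hd Q]]].
  split; [exact L|]. exists d; split; [exact Hd|]. intros q Nq Lq. apply E; auto.
Qed.

Lemma open_rel_open A : open A -> rel_open m_infty A.
Proof.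
  intros H p Ap. split; [exact I|]. destruct (H p Ap) as [d Hd].
  exists d; split; [apply cond_pos|]. intros q [N1 N2] _. apply Hd.
  split; [exact N1|exact N2].
Qed.

Lemma rel_open_total : rel_open m_infty (fun _ => True).
Proof.
  intros p _. split; [exact I|]. exists 1; split; [lra|trivial].
Qed.

Lemma rel_open_fst_interior l A p : rel_open l A -> A p ->
  exists d, 0 < d /\ forall t, Rabs (t - fst p) < d -> A (t, snd p).
Proof.
  intros H Ap. destruct (H p Ap) as [L [d [Hd Q]]]. exists d; split; [exact Hd|].
  intros t Ht. apply Q; [|exact L]. split; simpl; [exact Ht|].
  rewrite Rminus_diag, Rabs_R0; exact Hd.
Qed.

Lemma pd1_unique l A f p a b : rel_open l A -> A p -> pd1 A f p a -> pd1 A f p b -> a = b.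
Proof.
  intros H Ap. apply der_unique. intros d Hd.
  destruct (rel_open_fst_interior l A p H Ap) as [r [Hr Q]].
  pose proof (Rmin_pos _ _ Hd Hr). pose proof (Rmin_l d r). pose proof (Rmin_r d r).
  assert (E : Rabs (fst p + Rmin d r / 2 - fst p) = Rmin d r / 2).
  { replace (fst p + Rmin d r / 2 - fst p) with (Rmin d r / 2) by ring.
    apply Rabs_pos_eq; lra. }
  exists (fst p + Rmin d r / 2). rewrite E. split; [apply Q; rewrite E; lra|lra].
Qed.

Lemma pd2_unique l A f p a b : rel_open l A -> A p -> pd2 A f p a -> pd2 A f p b -> a = b.
Proof.
  intros H Ap. apply der_unique. intros d Hd.
  destruct (H p Ap) as [L [r [Hr Q]]].
  pose proof (Rmin_pos _ _ Hd Hr). pose proof (Rmin_l d r). pose proof (Rmin_r d r).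
  assert (E : Rabs (snd p + Rmin d r / 2 - snd p) = Rmin d r / 2).
  { replace (snd p + Rmin d r / 2 - snd p) with (Rmin d r / 2) by ring.
    apply Rabs_pos_eq; lra. }
  exists (snd p + Rmin d r / 2). rewrite E. split; [|lra].
  apply Q.
  - split; simpl; [rewrite Rminus_diag, Rabs_R0; lra|rewrite E; lra].
  - simpl. apply Rbar_le_trans with (snd p); [exact L|simpl; lra].
Qed.

(** A relatively open set contains, near each of its points, the
    horizontal-then-vertical path joining two of its points, and the mean value
    theorem applies on both legs. *)
Lemma diffat_of_partials l A f f1 f2 p : rel_open l A -> has_partials A f f1 f2 ->
  cont A f1 -> cont A f2 -> A p -> diffat A f p (f1 p) (f2 p).
Proof.
  intros HA P C1 C2 Ap e He. destruct (HA p Ap) as [L [d [Hd Q]]].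
  destruct (C1 p Ap e He) as [d1 [Hd1 Q1]]. destruct (C2 p Ap e He) as [d2 [Hd2 Q2]].
  exists (Rmin d (Rmin d1 d2)). split; [repeat apply Rmin_pos; assumption|].
  intros q Aq [N1 N2]. pose proof (proj1 (HA q Aq)) as Lq.
  pose proof (Rmin_l d (Rmin d1 d2)); pose proof (Rmin_r d (Rmin d1 d2)).
  pose proof (Rmin_l d1 d2); pose proof (Rmin_r d1 d2).
  destruct p as [s y], q as [s' y']; simpl in *.
  assert (Hor : forall t, seg s s' t -> A (t, y') /\ near (Rmin d1 d2) (s, y) (t, y')).
  { intros t Ht. apply seg_Rabs in Ht. split; [apply Q; simpl; trivial; split|split]; simpl; lra. }
  assert (Ver : forall t, seg y y' t -> A (s, t) /\ near (Rmin d1 d2) (s, y) (s, t)).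
  { intros t Ht. pose proof (seg_Rabs _ _ _ Ht). split.
    - apply Q; [split; simpl; [rewrite Rminus_diag, Rabs_R0; lra|lra]|].
      simpl; apply (Rbar_le_seg l y y'); assumption.
    - split; simpl; [rewrite Rminus_diag, Rabs_R0; apply Rmin_pos; lra|lra]. }
  destruct (der_mean_value (fun t => A (t, y')) (fun t => f (t, y')) (fun t => f1 (t, y')) s s')
    as [c1 [Hc1 E1]].
  { intros t Ht. destruct (Hor t Ht) as [At _]. split; [exact At|apply (P _ At)]. }
  destruct (der_mean_value (fun t => A (s, t)) (fun t => f (s, t)) (fun t => f2 (s, t)) y y')
    as [c2 [Hc2 E2]].
  { intros t Ht. destruct (Ver t Ht) as [At _]. split; [exact At|apply (P _ At)]. }
  destruct (Hor c1 Hc1) as [Ac1 Nc1]. destruct (Ver c2 Hc2) as [Ac2 Nc2].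
  replace (f (s', y') - f (s, y) - f1 (s, y) * (s' - s) - f2 (s, y) * (y' - y))
    with ((f1 (c1, y') - f1 (s, y)) * (s' - s) + (f2 (s, c2) - f2 (s, y)) * (y' - y)) by lra.
  specialize (Q1 _ Ac1 (near_le _ _ _ _ (Rmin_l _ _) Nc1)).
  specialize (Q2 _ Ac2 (near_le _ _ _ _ (Rmin_r _ _) Nc2)).
  eapply Rle_trans; [apply Rabs_triang|]. rewrite !Rabs_mult.
  pose proof (Rabs_pos (s' - s)); pose proof (Rabs_pos (y' - y)). nra.
Qed.

Lemma pd1_comp A f B g k q l1 l2 g1 k1 : (forall q, B q -> A (g q, k q)) ->
  diffat A f (g q, k q) l1 l2 -> pd1 B g q g1 -> pd1 B k q k1 ->
  pd1 B (fun q => f (g q, k q)) q (l1 * g1 + l2 * k1).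
Proof.
  destruct q as [s y]; intros Im Hf Hg Hk.
  apply (der_chain A f (fun t => B (t, y)) (fun t => g (t, y)) (fun t => k (t, y))); auto.
Qed.

Lemma pd2_comp A f B g k q l1 l2 g1 k1 : (forall q, B q -> A (g q, k q)) ->
  diffat A f (g q, k q) l1 l2 -> pd2 B g q g1 -> pd2 B k q k1 ->
  pd2 B (fun q => f (g q, k q)) q (l1 * g1 + l2 * k1).
Proof.
  destruct q as [s y]; intros Im Hf Hg Hk.
  apply (der_chain A f (fun t => B (s, t)) (fun t => g (s, t)) (fun t => k (s, t))); auto.
Qed.

Lemma has_partials_sub (A B : R * R -> Prop) f f1 f2 :
  (forall p, B p -> A p) -> has_partials A f f1 f2 -> has_partials B f f1 f2.
Proof.
  intros S H p Bp. destruct (H p (S p Bp)) as [H1 H2].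
  split; (eapply der_sub; [|eassumption]); intros t; apply S.
Qed.

Lemma has_partials_ext (A : R * R -> Prop) f g f1 f2 :
  (forall p, A p -> f p = g p) -> has_partials A f f1 f2 -> has_partials A g f1 f2.
Proof.
  intros E H [s y] Ap. destruct (H _ Ap) as [H1 H2].
  split; (eapply der_ext; [| |eassumption]); simpl; auto.
Qed.

Lemma has_partials_const A c : has_partials A (fun _ => c) (fun _ => 0) (fun _ => 0).
Proof. intros p _; split; exact (der_const _ c _). Qed.

Lemma has_partials_plus A f f1 f2 g g1 g2 : has_partials A f f1 f2 -> has_partials A g g1 g2 ->
  has_partials A (fun p => f p + g p) (fun p => f1 p + g1 p) (fun p => f2 p + g2 p).
Proof.
  intros Hf Hg p Ap. destruct (Hf p Ap), (Hg p Ap).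
  split; [apply (der_plus _ (fun t => f (t, snd p)) (fun t => g (t, snd p)))
    |apply (der_plus _ (fun t => f (fst p, t)) (fun t => g (fst p, t)))]; assumption.
Qed.

Lemma has_partials_mult A f f1 f2 g g1 g2 : has_partials A f f1 f2 -> has_partials A g g1 g2 ->
  has_partials A (fun p => f p * g p) (fun p => g p * f1 p + f p * g1 p)
    (fun p => g p * f2 p + f p * g2 p).
Proof.
  intros Hf Hg [s y] Ap. destruct (Hf _ Ap), (Hg _ Ap). split.
  - apply (der_mult _ (fun t => f (t, y)) (fun t => g (t, y))); assumption.
  - apply (der_mult _ (fun t => f (s, t)) (fun t => g (s, t))); assumption.
Qed.

Lemma has_partials_comp1 A f f1 f2 phi phi' : has_partials A f f1 f2 ->
  (forall p, A p -> is_derive phi (f p) (phi' p)) ->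
  has_partials A (fun p => phi (f p)) (fun p => phi' p * f1 p) (fun p => phi' p * f2 p).
Proof.
  intros Hf D [s y] Ap. destruct (Hf _ Ap). specialize (D _ Ap).
  split; (eapply (der_comp (fun _ => True)); [trivial| |eassumption]);
    apply is_derive_der; exact D.
Qed.

Lemma has_partials_comp_on A f f1 f2 (I : R -> Prop) phi phi' : has_partials A f f1 f2 ->
  (forall p, A p -> I (f p)) -> (forall y, I y -> der I phi y (phi' y)) ->
  has_partials A (fun p => phi (f p)) (fun p => phi' (f p) * f1 p) (fun p => phi' (f p) * f2 p).
Proof.
  intros Hf Im D [s y] Ap. destruct (Hf _ Ap). specialize (D _ (Im _ Ap)).
  split; (eapply (der_comp I); [|exact D|eassumption]); intros t; apply Im.
Qed.

Lemma Ck_on_intro k A f f1 f2 : cont A f -> has_partials A f f1 f2 ->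
  Ck_on k A f1 -> Ck_on k A f2 -> Ck_on (S k) A f.
Proof. intros. apply Ck_on_S. split; [assumption|]. exists f1, f2; auto. Qed.

Lemma Ck_on_sub k : forall (A B : R * R -> Prop) f, (forall p, B p -> A p) -> Ck_on k A f -> Ck_on k B f.
Proof.
  induction k as [|k IH]; intros A B f S H; pose proof (cont_sub A B f S (Ck_on_cont _ _ _ H)).
  - apply Ck_on_O; assumption.
  - apply Ck_on_S in H. destruct H as [_ [f1 [f2 [P [C1 C2]]]]].
    apply (Ck_on_intro _ _ _ f1 f2); eauto using has_partials_sub.
Qed.

Lemma Ck_on_ext k : forall A f g, (forall p, A p -> f p = g p) -> Ck_on k A f -> Ck_on k A g.
Proof.
  intros A f g E H. pose proof (cont_ext A f g E (Ck_on_cont _ _ _ H)). destruct k.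
  - apply Ck_on_O; assumption.
  - apply Ck_on_S in H. destruct H as [_ [f1 [f2 [P [C1 C2]]]]].
    apply (Ck_on_intro _ _ _ f1 f2); eauto using has_partials_ext.
Qed.

Lemma Ck_on_pred k : forall A f, Ck_on (S k) A f -> Ck_on k A f.
Proof.
  induction k as [|k IH]; intros A f H; pose proof (Ck_on_cont _ _ _ H).
  - apply Ck_on_O; assumption.
  - apply Ck_on_S in H. destruct H as [_ [f1 [f2 [P [C1 C2]]]]].
    apply (Ck_on_intro _ _ _ f1 f2); auto.
Qed.

Lemma Ck_on_const k : forall A c, Ck_on k A (fun _ => c).
Proof.
  induction k as [|k IH]; intros A c.
  - apply Ck_on_O, cont_const.
  - apply (Ck_on_intro _ _ _ (fun _ => 0) (fun _ => 0)); auto using cont_const, has_partials_const.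
Qed.

Lemma Ck_on_fst k A : Ck_on k A fst.
Proof.
  destruct k; [apply Ck_on_O, cont_fst|].
  apply (Ck_on_intro _ _ _ (fun _ => 1) (fun _ => 0)); auto using cont_fst, Ck_on_const.
  intros p _; split; [exact (der_id _ _)|exact (der_const _ (fst p) _)].
Qed.

Lemma Ck_on_snd k A : Ck_on k A snd.
Proof.
  destruct k; [apply Ck_on_O, cont_snd|].
  apply (Ck_on_intro _ _ _ (fun _ => 0) (fun _ => 1)); auto using cont_snd, Ck_on_const.
  intros p _; split; [exact (der_const _ (snd p) _)|exact (der_id _ _)].
Qed.

Lemma Ck_on_plus k : forall A f g, Ck_on k A f -> Ck_on k A g -> Ck_on k A (fun p => f p + g p).
Proof.
  induction k as [|k IH]; intros A f g Hf Hg;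
    pose proof (cont_plus A f g (Ck_on_cont _ _ _ Hf) (Ck_on_cont _ _ _ Hg)).
  - apply Ck_on_O; assumption.
  - apply Ck_on_S in Hf. destruct Hf as [_ [f1 [f2 [P [C1 C2]]]]].
    apply Ck_on_S in Hg. destruct Hg as [_ [g1 [g2 [P' [C1' C2']]]]].
    eapply Ck_on_intro; [assumption|apply has_partials_plus; eassumption|auto|auto].
Qed.

Lemma Ck_on_mult k : forall A f g, Ck_on k A f -> Ck_on k A g -> Ck_on k A (fun p => f p * g p).
Proof.
  induction k as [|k IH]; intros A f g Hf Hg;
    pose proof (cont_mult A f g (Ck_on_cont _ _ _ Hf) (Ck_on_cont _ _ _ Hg)).
  - apply Ck_on_O; assumption.
  - pose proof (Ck_on_pred _ _ _ Hf). pose proof (Ck_on_pred _ _ _ Hg).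
    apply Ck_on_S in Hf. destruct Hf as [_ [f1 [f2 [P [C1 C2]]]]].
    apply Ck_on_S in Hg. destruct Hg as [_ [g1 [g2 [P' [C1' C2']]]]].
    eapply Ck_on_intro; [assumption|apply has_partials_mult; eassumption| |];
      apply Ck_on_plus; apply IH; assumption.
Qed.

Lemma Ck_on_comp k l A : rel_open l A -> forall f B g h,
  (forall q, B q -> A (g q, h q)) ->
  Ck_on k A f -> Ck_on k B g -> Ck_on k B h -> Ck_on k B (fun q => f (g q, h q)).
Proof.
  intros HA. induction k as [|k IH]; intros f B g h Im Hf Hg Hh;
    pose proof (cont_comp A f B g h Im (Ck_on_cont _ _ _ Hf) (Ck_on_cont _ _ _ Hg)
      (Ck_on_cont _ _ _ Hh)).
  - apply Ck_on_O; assumption.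
  - pose proof (Ck_on_pred _ _ _ Hg). pose proof (Ck_on_pred _ _ _ Hh).
    apply Ck_on_S in Hf. destruct Hf as [_ [f1 [f2 [P [C1 C2]]]]].
    apply Ck_on_S in Hg. destruct Hg as [_ [g1 [g2 [Pg [Cg1 Cg2]]]]].
    apply Ck_on_S in Hh. destruct Hh as [_ [h1 [h2 [Ph [Ch1 Ch2]]]]].
    apply (Ck_on_intro _ _ _
      (fun q => f1 (g q, h q) * g1 q + f2 (g q, h q) * h1 q)
      (fun q => f1 (g q, h q) * g2 q + f2 (g q, h q) * h2 q)); [assumption| | |].
    + intros q Bq.
      assert (D : diffat A f (g q, h q) (f1 (g q, h q)) (f2 (g q, h q)))
        by (apply (diffat_of_partials l); eauto using Ck_on_cont).
      destruct (Pg q Bq), (Ph q Bq).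
      split; [apply (pd1_comp A)|apply (pd2_comp A)]; assumption.
    + apply Ck_on_plus; apply Ck_on_mult; auto.
    + apply Ck_on_plus; apply Ck_on_mult; auto.
Qed.

Lemma Ck_on_inv k : forall A f, (forall p, A p -> f p <> 0) -> Ck_on k A f ->
  Ck_on k A (fun p => / f p).
Proof.
  induction k as [|k IH]; intros A f N Hf.
  all: assert (D : forall p, A p -> is_derive Rinv (f p) (- (/ f p * / f p)))
    by (intros p Ap; specialize (N p Ap); change (is_derive (fun t => / t) (f p) (- (/ f p * / f p)));
      auto_derive; [exact N|field; exact N]).
  all: pose proof (cont_comp1 A f Rinv _ (Ck_on_cont _ _ _ Hf) D).
  - apply Ck_on_O; assumption.
  - pose proof (Ck_on_pred _ _ _ Hf).
    apply Ck_on_S in Hf. destruct Hf as [_ [f1 [f2 [P [C1 C2]]]]].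
    eapply Ck_on_intro; [assumption|exact (has_partials_comp1 A f f1 f2 Rinv _ P D)| |];
      (apply Ck_on_mult; [|assumption]);
      (apply (Ck_on_ext _ _ (fun p => -1 * (/ f p * / f p))); [intros; ring|]);
      (apply Ck_on_mult; [apply Ck_on_const|apply Ck_on_mult; apply IH; assumption]).
Qed.

Lemma Ck_on_exp k : forall A f, Ck_on k A f -> Ck_on k A (fun p => exp (f p)).
Proof.
  induction k as [|k IH]; intros A f Hf.
  all: assert (D : forall p, A p -> is_derive exp (f p) (exp (f p)))
    by (intros p _; apply is_derive_Reals, derivable_pt_lim_exp).
  all: pose proof (cont_comp1 A f exp _ (Ck_on_cont _ _ _ Hf) D).
  - apply Ck_on_O; assumption.
  - pose proof (Ck_on_pred _ _ _ Hf).
    apply Ck_on_S in Hf. destruct Hf as [_ [f1 [f2 [P [C1 C2]]]]].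
    eapply Ck_on_intro; [assumption|exact (has_partials_comp1 A f f1 f2 exp _ P D)| |];
      apply Ck_on_mult; auto.
Qed.

Lemma Ck_on_ln k A f : (forall p, A p -> 0 < f p) -> Ck_on k A f -> Ck_on k A (fun p => ln (f p)).
Proof.
  intros N Hf.
  assert (D : forall p, A p -> is_derive ln (f p) (/ f p))
    by (intros p Ap; apply is_derive_Reals, derivable_pt_lim_ln, N, Ap).
  pose proof (cont_comp1 A f ln _ (Ck_on_cont _ _ _ Hf) D). destruct k.
  - apply Ck_on_O; assumption.
  - pose proof (Ck_on_pred _ _ _ Hf).
    apply Ck_on_S in Hf. destruct Hf as [_ [f1 [f2 [P [C1 C2]]]]].
    assert (forall p, A p -> f p <> 0) by (intros p Ap; specialize (N p Ap); lra).
    eapply Ck_on_intro; [assumption|exact (has_partials_comp1 A f f1 f2 ln _ P D)| |];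
      (apply Ck_on_mult; [apply Ck_on_inv; assumption|assumption]).
Qed.

(** ** The class C^infinity *)

Definition smooth (A : R * R -> Prop) (f : R * R -> R) : Prop := forall k, Ck_on k A f.

Lemma smooth_cont A f : smooth A f -> cont A f.
Proof. intros H; apply (Ck_on_cont 0), H. Qed.

Lemma smooth_sub (A B : R * R -> Prop) f : (forall p, B p -> A p) -> smooth A f -> smooth B f.
Proof. intros S H k; apply (Ck_on_sub k A); auto. Qed.

Lemma smooth_ext A f g : (forall p, A p -> f p = g p) -> smooth A f -> smooth A g.
Proof. intros E H k; apply (Ck_on_ext k A f); auto. Qed.

Lemma smooth_const A c : smooth A (fun _ => c).
Proof. intros k; apply Ck_on_const. Qed.

Lemma smooth_fst A : smooth A fst.
Proof. intros k; apply Ck_on_fst. Qed.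

Lemma smooth_snd A : smooth A snd.
Proof. intros k; apply Ck_on_snd. Qed.

Lemma smooth_plus A f g : smooth A f -> smooth A g -> smooth A (fun p => f p + g p).
Proof. intros Hf Hg k; apply Ck_on_plus; auto. Qed.

Lemma smooth_mult A f g : smooth A f -> smooth A g -> smooth A (fun p => f p * g p).
Proof. intros Hf Hg k; apply Ck_on_mult; auto. Qed.

Lemma smooth_opp A f : smooth A f -> smooth A (fun p => - f p).
Proof.
  intros Hf. apply (smooth_ext _ (fun p => -1 * f p)); [intros; ring|].
  apply smooth_mult; [apply smooth_const|exact Hf].
Qed.

Lemma smooth_minus A f g : smooth A f -> smooth A g -> smooth A (fun p => f p - g p).
Proof. intros Hf Hg; apply smooth_plus; [exact Hf|apply smooth_opp, Hg]. Qed.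

Lemma smooth_inv A f : (forall p, A p -> f p <> 0) -> smooth A f -> smooth A (fun p => / f p).
Proof. intros N H k; apply Ck_on_inv; auto. Qed.

Lemma smooth_exp A f : smooth A f -> smooth A (fun p => exp (f p)).
Proof. intros H k; apply Ck_on_exp; auto. Qed.

Lemma smooth_ln A f : (forall p, A p -> 0 < f p) -> smooth A f -> smooth A (fun p => ln (f p)).
Proof. intros N H k; apply Ck_on_ln; auto. Qed.

Lemma smooth_comp l A f B g h : rel_open l A -> (forall q, B q -> A (g q, h q)) ->
  smooth A f -> smooth B g -> smooth B h -> smooth B (fun q => f (g q, h q)).
Proof. intros HA Im Hf Hg Hh k. apply (Ck_on_comp k l A); auto. Qed.

(** The definition of C^infinity by the classes C^k provides partial
    derivatives for each [k] separately; by uniqueness they agree. *)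
Lemma smooth_partials l A f : rel_open l A -> smooth A f ->
  exists f1 f2, has_partials A f f1 f2 /\ smooth A f1 /\ smooth A f2.
Proof.
  intros HA H. destruct (proj1 (Ck_on_S 0 A f) (H 1%nat)) as [_ [f1 [f2 [P _]]]].
  exists f1, f2. split; [exact P|].
  assert (forall k, Ck_on k A f1 /\ Ck_on k A f2) as E.
  { intros k. destruct (proj1 (Ck_on_S k A f) (H (S k))) as [_ [g1 [g2 [P' [C1 C2]]]]].
    split; [apply (Ck_on_ext k A g1)|apply (Ck_on_ext k A g2)]; trivial; intros p Ap.
    - eapply pd1_unique; [exact HA|exact Ap|apply P', Ap|apply P, Ap].
    - eapply pd2_unique; [exact HA|exact Ap|apply P', Ap|apply P, Ap]. }
  split; intros k; apply E.
Qed.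

Lemma smooth_diffat l A f f1 f2 p : rel_open l A -> has_partials A f f1 f2 ->
  smooth A f1 -> smooth A f2 -> A p -> diffat A f p (f1 p) (f2 p).
Proof. intros; apply (diffat_of_partials l); auto using smooth_cont. Qed.

(** ** The inverse mapping theorem *)

(** The partial derivatives of the inverse, relative to any set [B] of values,
    are rational functions of those of the map, evaluated at the inverse.  A
    continuous inverse is therefore as smooth as the map, by induction on the
    order. *)
Lemma inverse_smooth l A f f1 f2 g g1 g2 B u v : rel_open l A ->
  has_partials A f f1 f2 -> smooth A f1 -> smooth A f2 ->
  has_partials A g g1 g2 -> smooth A g1 -> smooth A g2 ->
  (forall p, A p -> f1 p * g2 p - f2 p * g1 p <> 0) ->
  (forall q, B q -> A (u q, v q) /\ f (u q, v q) = fst q /\ g (u q, v q) = snd q) ->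
  cont B u -> cont B v -> smooth B u /\ smooth B v.
Proof.
  intros HA Pf Sf1 Sf2 Pg Sg1 Sg2 Hdet Inv Cu Cv.
  set (det := fun p => f1 p * g2 p - f2 p * g1 p).
  assert (Sdet : smooth A (fun p => / det p)).
  { apply smooth_inv; [exact Hdet|]. apply smooth_minus; apply smooth_mult; assumption. }
  set (G := fun q => (u q, v q)).
  assert (D : forall q, B q ->
    diffat B u q (g2 (G q) * / det (G q)) (- f2 (G q) * / det (G q)) /\
    diffat B v q (- g1 (G q) * / det (G q)) (f1 (G q) * / det (G q))).
  { intros q Bq. destruct (Inv q Bq) as [Aq [Ef Eg]]. fold (G q) in Aq, Ef, Eg.
    pose proof (Hdet _ Aq) as Hd. fold (det (G q)) in Hd.
    pose proof (smooth_diffat l A f f1 f2 _ HA Pf Sf1 Sf2 Aq) as Df.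
    pose proof (smooth_diffat l A g g1 g2 _ HA Pg Sg1 Sg2 Aq) as Dg.
    set (p := G q) in *. set (i := Rabs (/ det p)).
    set (L := (Rabs (f1 p) + Rabs (f2 p) + Rabs (g1 p) + Rabs (g2 p) + 1) * i).
    assert (Hi : 0 < i) by (apply Rabs_pos_lt, Rinv_neq_0_compat, Hd).
    pose proof (Rabs_pos (f1 p)); pose proof (Rabs_pos (f2 p)).
    pose proof (Rabs_pos (g1 p)); pose proof (Rabs_pos (g2 p)).
    assert (HL : 0 < L) by (apply Rmult_lt_0_compat; lra).
    (* [L] bounds the inverse of the derivative of [(f,g)] at [p]. *)
    assert (K : forall e, 0 < e -> exists d, 0 < d /\ forall q', B q' -> near d q q' ->
      Rabs (u q' - u q - g2 p * / det p * (fst q' - fst q) - - f2 p * / det p * (snd q' - snd q))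
        <= e * (Rabs (fst q' - fst q) + Rabs (snd q' - snd q)) /\
      Rabs (v q' - v q - - g1 p * / det p * (fst q' - fst q) - f1 p * / det p * (snd q' - snd q))
        <= e * (Rabs (fst q' - fst q) + Rabs (snd q' - snd q))).
    { intros e He.
      set (n := Rmin (/ (4 * L)) (e / (4 * L * L))).
      assert (Hn : 0 < n).
      { apply Rmin_pos; [apply Rinv_0_lt_compat; lra|].
        apply Rdiv_lt_0_compat; [exact He|]. apply Rmult_lt_0_compat; lra. }
      destruct (Df n Hn) as [df [Hdf Qf]]. destruct (Dg n Hn) as [dg [Hdg Qg]].
      pose proof (Rmin_pos _ _ Hdf Hdg) as Hm.
      destruct (Cu q Bq _ Hm) as [du [Hdu Qu]]. destruct (Cv q Bq _ Hm) as [dv [Hdv Qv]].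
      exists (Rmin du dv); split; [apply Rmin_pos; assumption|]. intros q' Bq' Nq'.
      specialize (Qu q' Bq' (near_le _ _ _ _ (Rmin_l _ _) Nq')).
      specialize (Qv q' Bq' (near_le _ _ _ _ (Rmin_r _ _) Nq')).
      assert (N : near (Rmin df dg) p (G q')) by (split; assumption).
      destruct (Inv q' Bq') as [Aq' [Ef' Eg']]. fold (G q') in Aq', Ef', Eg'.
      specialize (Qf _ Aq' (near_le _ _ _ _ (Rmin_l _ _) N)).
      specialize (Qg _ Aq' (near_le _ _ _ _ (Rmin_r _ _) N)).
      rewrite Ef, Ef' in Qf. rewrite Eg, Eg' in Qg. simpl in Qf, Qg.
      set (a := u q' - u q) in *. set (b := v q' - v q) in *.
      set (x := fst q' - fst q) in *. set (y := snd q' - snd q) in *.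
      change (Rabs (fst (G q') - fst p)) with (Rabs a) in *.
      set (rf := x - f1 p * a - f2 p * b) in *. set (rg := y - g1 p * a - g2 p * b) in *.
      set (S := Rabs a + Rabs b) in *.
      assert (Ea : a - g2 p * / det p * x - - f2 p * / det p * y
                   = (- g2 p * rf + f2 p * rg) * / det p).
      { unfold rf, rg, det. field. exact Hd. }
      assert (Eb : b - - g1 p * / det p * x - f1 p * / det p * y
                   = (g1 p * rf + - f1 p * rg) * / det p).
      { unfold rf, rg, det. field. exact Hd. }
      assert (HS : 0 <= S) by (unfold S; pose proof (Rabs_pos a); pose proof (Rabs_pos b); lra).
      assert (Bnd : forall c c', Rabs c + Rabs c'
          <= Rabs (f1 p) + Rabs (f2 p) + Rabs (g1 p) + Rabs (g2 p) + 1 ->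
          forall w w' m, Rabs w <= m -> Rabs w' <= m ->
          Rabs ((c * w + c' * w') * / det p) <= L * m).
      { intros c c' Hc w w' m Hw Hw'. rewrite Rabs_mult. fold i.
        assert (0 <= m) by (pose proof (Rabs_pos w); lra).
        assert (Rabs (c * w + c' * w') <= (Rabs c + Rabs c') * m).
        { eapply Rle_trans; [apply Rabs_triang|]. rewrite !Rabs_mult.
          pose proof (Rabs_pos c); pose proof (Rabs_pos c'). nra. }
        unfold L. rewrite Rmult_assoc, (Rmult_comm i m), <- Rmult_assoc.
        apply Rmult_le_compat_r; [lra|]. eapply Rle_trans; [eassumption|].
        apply Rmult_le_compat_r; lra. }
      assert (Ba : Rabs ((- g2 p * rf + f2 p * rg) * / det p) <= L * (n * S))
        by (apply Bnd; trivial; rewrite Rabs_Ropp; lra).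
      assert (Bb : Rabs ((g1 p * rf + - f1 p * rg) * / det p) <= L * (n * S))
        by (apply Bnd; trivial; rewrite Rabs_Ropp; lra).
      set (X := Rabs x + Rabs y).
      assert (HX : Rabs x <= X /\ Rabs y <= X)
        by (unfold X; pose proof (Rabs_pos x); pose proof (Rabs_pos y); lra).
      assert (Ba' : Rabs ((g2 p * x + - f2 p * y) * / det p) <= L * X)
        by (apply Bnd; [rewrite Rabs_Ropp; lra|apply HX|apply HX]).
      assert (Bb' : Rabs ((- g1 p * x + f1 p * y) * / det p) <= L * X)
        by (apply Bnd; [rewrite Rabs_Ropp; lra|apply HX|apply HX]).
      assert (HnL : L * n <= / 4).
      { apply Rle_trans with (L * / (4 * L)); [apply Rmult_le_compat_l; [lra|apply Rmin_l]|].
        right; field; lra. }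
      assert (HS' : S <= 4 * L * X).
      { assert (Ta : Rabs a <= L * (n * S) + L * X).
        { replace a with ((- g2 p * rf + f2 p * rg) * / det p
            + (g2 p * x + - f2 p * y) * / det p) by (rewrite <- Ea; ring).
          eapply Rle_trans; [apply Rabs_triang|]. lra. }
        assert (Tb : Rabs b <= L * (n * S) + L * X).
        { replace b with ((g1 p * rf + - f1 p * rg) * / det p
            + (- g1 p * x + f1 p * y) * / det p) by (rewrite <- Eb; ring).
          eapply Rle_trans; [apply Rabs_triang|]. lra. }
        assert (L * (n * S) <= / 4 * S) by (rewrite <- Rmult_assoc; apply Rmult_le_compat_r; lra).
        unfold S in *. lra. }
      assert (Fin : L * (n * S) <= e * X).
      { assert (0 <= X) by (pose proof (Rabs_pos x); lra).
        apply Rle_trans with (L * (e / (4 * L * L) * (4 * L * X))).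
        - apply Rmult_le_compat_l; [lra|]. apply Rmult_le_compat; [lra|lra|apply Rmin_r|exact HS'].
        - right; field; lra. }
      rewrite Ea, Eb. split; eapply Rle_trans; eassumption. }
    split; intros e He; destruct (K e He) as [d [Hd0 Q]]; exists d; (split; [exact Hd0|]);
      intros q' Bq' Nq'; apply (Q q' Bq' Nq'). }
  assert (Sm : forall k, Ck_on k B u /\ Ck_on k B v).
  { induction k as [|k [IHu IHv]].
    - split; apply Ck_on_O; assumption.
    - assert (C : forall r, smooth A r -> Ck_on k B (fun q => r (G q))).
      { intros r Sr. apply (Ck_on_comp k l A HA r B u v); trivial. intros q Bq; apply (Inv q Bq). }
      split.
      + apply (Ck_on_intro _ _ _ (fun q => g2 (G q) * / det (G q))
          (fun q => - f2 (G q) * / det (G q))); trivial.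
        * intros q Bq; destruct (D q Bq) as [Du _].
          split; [eapply diffat_pd1|eapply diffat_pd2]; exact Du.
        * apply (C (fun p => g2 p * / det p)), smooth_mult; assumption.
        * apply (C (fun p => - f2 p * / det p)), smooth_mult; [apply smooth_opp|]; assumption.
      + apply (Ck_on_intro _ _ _ (fun q => - g1 (G q) * / det (G q))
          (fun q => f1 (G q) * / det (G q))); trivial.
        * intros q Bq; destruct (D q Bq) as [_ Dv].
          split; [eapply diffat_pd1|eapply diffat_pd2]; exact Dv.
        * apply (C (fun p => - g1 p * / det p)), smooth_mult; [apply smooth_opp|]; assumption.
        * apply (C (fun p => f1 p * / det p)), smooth_mult; assumption. }
  split; intros k; apply Sm.
Qed.

(** ** Continuity of fibrewise inverses *)

Lemma rel_open_lower l A s y : rel_open l A -> A (s, y) -> forall e, 0 < e ->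
  (forall t : R, Rbar_le l t -> y <= t) \/ exists t, y - e < t < y /\ A (s, t).
Proof.
  intros HA Ap e He. destruct (HA _ Ap) as [L [d [Hd Q]]]. simpl in L.
  destruct (Rbar_le_lt_or_eq_dec l y L) as [Hl|Hl].
  - right.
    assert (exists m, y - Rmin d e < m < y /\ Rbar_le l m) as [m [Hm Lm]].
    { pose proof (Rmin_pos _ _ Hd He). destruct l as [l| |]; simpl in *.
      - exists ((Rmax l (y - Rmin d e) + y) / 2).
        pose proof (Rmax_l l (y - Rmin d e)). pose proof (Rmax_r l (y - Rmin d e)).
        assert (Rmax l (y - Rmin d e) < y) by (apply Rmax_lub_lt; lra). lra.
      - tauto.
      - exists (y - Rmin d e / 2). split; [lra|exact I]. }
    pose proof (Rmin_l d e); pose proof (Rmin_r d e).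
    exists m; split; [lra|]. apply Q; [|exact Lm]. split; simpl; [|apply Rabs_def1; lra].
    rewrite Rminus_diag, Rabs_R0; lra.
  - left. intros t Ht. subst l. exact Ht.
Qed.

Lemma rel_open_upper l A s y : rel_open l A -> A (s, y) -> forall e, 0 < e ->
  exists t, y < t < y + e /\ A (s, t).
Proof.
  intros HA Ap e He. destruct (HA _ Ap) as [L [d [Hd Q]]]. simpl in L.
  pose proof (Rmin_pos _ _ Hd He). pose proof (Rmin_l d e); pose proof (Rmin_r d e).
  exists (y + Rmin d e / 2); split; [lra|]. apply Q.
  - split; simpl; [rewrite Rminus_diag, Rabs_R0; lra|apply Rabs_def1; lra].
  - simpl. apply Rbar_le_trans with y; [exact L|simpl; lra].
Qed.

Lemma cont_lt_near l A f p v : rel_open l A -> cont A f -> A p -> f p < v ->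
  exists d, 0 < d /\ forall q w, near d p q -> Rbar_le l (snd q) -> Rabs (w - v) < d ->
    A q /\ f q < w.
Proof.
  intros HA C Ap H. destruct (HA p Ap) as [_ [d [Hd Q]]].
  destruct (C p Ap ((v - f p) / 2)) as [d' [Hd' Q']]; [lra|].
  exists (Rmin d (Rmin d' ((v - f p) / 2))).
  split; [repeat apply Rmin_pos; lra|]. intros q w N L Hw.
  assert (Aq : A q) by (apply Q; [eapply near_le; [apply Rmin_l|exact N]|exact L]).
  assert (M : Rmin d (Rmin d' ((v - f p) / 2)) <= Rmin d' ((v - f p) / 2)) by apply Rmin_r.
  assert (N' : near d' p q).
  { eapply near_le; [|exact N]. eapply Rle_trans; [apply M|apply Rmin_l]. }
  split; [exact Aq|]. specialize (Q' q Aq N'). apply Rabs_def2 in Q'. apply Rabs_def2 in Hw.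
  pose proof (Rmin_r d' ((v - f p) / 2)). lra.
Qed.

Lemma cont_gt_near l A f p v : rel_open l A -> cont A f -> A p -> v < f p ->
  exists d, 0 < d /\ forall q w, near d p q -> Rbar_le l (snd q) -> Rabs (w - v) < d ->
    A q /\ w < f q.
Proof.
  intros HA C Ap H.
  assert (C' : cont A (fun p => -1 * f p)) by (apply cont_mult; [apply cont_const|exact C]).
  destruct (cont_lt_near l A _ p (- v) HA C' Ap) as [d [Hd Q]]; [lra|].
  exists d; split; [exact Hd|]. intros q w N L Hw.
  destruct (Q q (- w) N L) as [Aq Hq]; [|split; [exact Aq|lra]].
  replace (- w - - v) with (- (w - v)) by ring. rewrite Rabs_Ropp; exact Hw.
Qed.

(** A function that is strictly monotone along a fibre is squeezed between its
    values at two points of the fibre, and these inequalities persist on the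
    neighbouring fibres. *)
Lemma vertical_inverse_cont l A f B g : rel_open l A -> cont A f ->
  (forall s y y', A (s, y) -> A (s, y') -> y < y' -> f (s, y) < f (s, y')) ->
  (forall q, B q -> A (fst q, g q) /\ f (fst q, g q) = snd q) -> cont B g.
Proof.
  intros HA C Mon Inv q Bq e He. destruct (Inv q Bq) as [Aq Eq].
  assert (Mon' : forall s y y', A (s, y) -> A (s, y') -> f (s, y) < f (s, y') -> y < y').
  { intros s y y' Ay Ay' H. destruct (Rlt_le_dec y y') as [|K]; [assumption|exfalso].
    destruct K as [K|K]; [specialize (Mon s y' y Ay' Ay K); lra|subst; lra]. }
  destruct (rel_open_upper l A _ _ HA Aq e He) as [t [Ht At]].
  pose proof (Mon _ _ _ Aq At ltac:(lra)) as M. rewrite Eq in M.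
  destruct (cont_gt_near l A f _ _ HA C At M) as [d [Hd Q]].
  assert (Up : forall q', B q' -> near d q q' -> g q' < g q + e).
  { intros q' Bq' [N1 N2]. destruct (Inv q' Bq') as [Aq' Eq'].
    destruct (Q (fst q', t) (snd q')) as [At' H].
    - split; simpl; [exact N1|rewrite Rminus_diag, Rabs_R0; exact Hd].
    - exact (proj1 (HA _ At)).
    - exact N2.
    - rewrite <- Eq' in H. apply Mon' in H; trivial. lra. }
  destruct (rel_open_lower l A _ _ HA Aq e He) as [Low|[t' [Ht' At']]].
  - exists d; split; [exact Hd|]. intros q' Bq' N. specialize (Up q' Bq' N).
    pose proof (Low (g q') (proj1 (HA _ (proj1 (Inv q' Bq'))))). apply Rabs_def1; lra.
  - pose proof (Mon _ _ _ At' Aq ltac:(lra)) as M'. rewrite Eq in M'.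
    destruct (cont_lt_near l A f _ _ HA C At' M') as [d' [Hd' Q']].
    exists (Rmin d d'); split; [apply Rmin_pos; assumption|]. intros q' Bq' N.
    specialize (Up q' Bq' (near_le _ _ _ _ (Rmin_l _ _) N)).
    destruct (near_le _ _ _ _ (Rmin_r _ _) N) as [N1 N2].
    destruct (Inv q' Bq') as [Aq' Eq'].
    destruct (Q' (fst q', t') (snd q')) as [At'' H].
    + split; simpl; [exact N1|rewrite Rminus_diag, Rabs_R0; exact Hd'].
    + exact (proj1 (HA _ At')).
    + exact N2.
    + rewrite <- Eq' in H. apply Mon' in H; trivial. apply Rabs_def1; lra.
Qed.

Lemma horizontal_inverse_cont l A f B g : rel_open l A -> cont A f ->
  (forall s s' y, A (s, y) -> A (s', y) -> s < s' -> f (s, y) < f (s', y)) ->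
  (forall q, B q -> A (g q, snd q) /\ f (g q, snd q) = fst q) -> cont B g.
Proof.
  intros HA C Mon Inv q Bq e He. destruct (Inv q Bq) as [Aq Eq].
  assert (Mon' : forall s s' y, A (s, y) -> A (s', y) -> f (s, y) < f (s', y) -> s < s').
  { intros s s' y As As' H. destruct (Rlt_le_dec s s') as [|K]; [assumption|exfalso].
    destruct K as [K|K]; [specialize (Mon s' s y As' As K); lra|subst; lra]. }
  destruct (rel_open_fst_interior l A _ HA Aq) as [r [Hr Qr]]. simpl in Qr.
  pose proof (Rmin_pos _ _ Hr He). pose proof (Rmin_l r e). pose proof (Rmin_r r e).
  set (m := Rmin r e / 2) in *.
  assert (Ap : A (g q + m, snd q)) by (apply Qr; unfold m; apply Rabs_def1; lra).
  assert (Am : A (g q - m, snd q)) by (apply Qr; unfold m; apply Rabs_def1; lra).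
  pose proof (Mon _ _ _ Aq Ap ltac:(unfold m; lra)) as M1. rewrite Eq in M1.
  pose proof (Mon _ _ _ Am Aq ltac:(unfold m; lra)) as M2. rewrite Eq in M2.
  destruct (cont_gt_near l A f _ _ HA C Ap M1) as [d [Hd Q]].
  destruct (cont_lt_near l A f _ _ HA C Am M2) as [d' [Hd' Q']].
  exists (Rmin d d'); split; [apply Rmin_pos; assumption|]. intros q' Bq' N.
  destruct (near_le _ _ _ _ (Rmin_l _ _) N) as [N1 N2].
  destruct (near_le _ _ _ _ (Rmin_r _ _) N) as [N1' N2'].
  destruct (Inv q' Bq') as [Aq' Eq']. pose proof (proj1 (HA _ Aq')) as L. simpl in L.
  destruct (Q (g q + m, snd q') (fst q')) as [A1 Hu].
  { split; simpl; [rewrite Rminus_diag, Rabs_R0; exact Hd|exact N2]. }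
  { exact L. }
  { exact N1. }
  destruct (Q' (g q - m, snd q') (fst q')) as [A2 Hl].
  { split; simpl; [rewrite Rminus_diag, Rabs_R0; exact Hd'|exact N2']. }
  { exact L. }
  { exact N1'. }
  rewrite <- Eq' in Hu, Hl. apply Mon' in Hu; trivial. apply Mon' in Hl; trivial.
  unfold m in *. apply Rabs_def1; lra.
Qed.

(** ** Segments do not leave one side of a disconnection *)

(** If the endpoints lay on different sides, the indicator of a side would be
    a continuous function on the segment with only the values [0] and [1]. *)
Lemma segment_same_side (U P Q : R * R -> Prop) s y s' y' : open P -> open Q ->
  (forall p, U p -> P p \/ Q p) -> (forall p, U p -> P p -> Q p -> False) ->
  (forall t, 0 <= t <= 1 -> U (s + t * (s' - s), y + t * (y' - y))) ->
  P (s, y) -> P (s', y').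
Proof.
  intros HP HQ Cov Dis Seg P0.
  set (path := fun t => (s + t * (s' - s), y + t * (y' - y))).
  set (ind := fun t => if excluded_middle_informative (P (path t)) then 0 else 1).
  set (m := Rabs (s' - s) + Rabs (y' - y) + 1).
  assert (Hm : 0 < m) by (unfold m; pose proof (Rabs_pos (s' - s)); pose proof (Rabs_pos (y' - y)); lra).
  assert (Near : forall d t u, 0 < d -> Rabs (u - t) < d / m -> near d (path t) (path u)).
  { intros d t u Hd Hu.
    assert (K : Rabs (u - t) * m < d).
    { apply (Rmult_lt_compat_r m) in Hu; [|exact Hm].
      replace (d / m * m) with d in Hu by (field; lra). exact Hu. }
    pose proof (Rabs_pos (s' - s)); pose proof (Rabs_pos (y' - y)); pose proof (Rabs_pos (u - t)).
    unfold m in K. split; unfold path; cbn [fst snd].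
    - replace (s + u * (s' - s) - (s + t * (s' - s))) with ((u - t) * (s' - s)) by ring.
      rewrite Rabs_mult. nra.
    - replace (y + u * (y' - y) - (y + t * (y' - y))) with ((u - t) * (y' - y)) by ring.
      rewrite Rabs_mult. nra. }
  assert (C : forall t, continuity_pt (fun t => ind (clamp 0 1 t)) t).
  { apply clamp_continuity; [lra|]. intros t Ht e He.
    assert (exists d, 0 < d /\ forall u, 0 <= u <= 1 -> Rabs (u - t) < d -> ind u = ind t)
      as [d [Hd E]].
    { assert (K : forall O : R * R -> Prop, open O -> O (path t) ->
        exists d, 0 < d /\ forall u, Rabs (u - t) < d -> O (path u)).
      { intros O HO Ot. destruct (HO _ Ot) as [d Hd]. exists (d / m).
        split; [apply Rdiv_lt_0_compat; [apply cond_pos|exact Hm]|]. intros u Hu.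
        destruct (Near d t u (cond_pos d) Hu) as [N1 N2]. apply Hd. split; [exact N1|exact N2]. }
      unfold ind. destruct (excluded_middle_informative (P (path t))) as [Pt|NPt].
      - destruct (K P HP Pt) as [d [Hd Pu]]. exists d; split; [exact Hd|]. intros u _ Nu.
        destruct excluded_middle_informative as [_|N]; [reflexivity|destruct N; auto].
      - destruct (Cov _ (Seg t Ht)) as [Pt|Qt]; [contradiction|].
        destruct (K Q HQ Qt) as [d [Hd Qu]]. exists d; split; [exact Hd|]. intros u Hu Nu.
        destruct excluded_middle_informative as [Pu|_]; [|reflexivity].
        destruct (Dis _ (Seg u Hu)); [exact Pu|apply Qu, Nu]. }
    exists d; split; [exact Hd|]. intros u Hu Nu. rewrite (E u Hu Nu), Rminus_diag, Rabs_R0; exact He. }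
  apply NNPP. intros N1.
  assert (I0 : ind 0 = 0).
  { unfold ind. destruct excluded_middle_informative as [_|N]; [reflexivity|]. destruct N.
    unfold path. rewrite !Rmult_0_l, !Rplus_0_r. exact P0. }
  assert (I1 : ind 1 = 1).
  { unfold ind. destruct excluded_middle_informative as [Y|_]; [|reflexivity]. destruct N1.
    unfold path in Y. rewrite !Rmult_1_l in Y. replace s' with (s + (s' - s)) by ring.
    replace y' with (y + (y' - y)) by ring. exact Y. }
  destruct (IVT_gen (fun t => ind (clamp 0 1 t)) 0 1 (/ 2) C) as [t [_ Et]].
  - rewrite !clamp_id, I0, I1, Rmin_left, Rmax_right by lra. lra.
  - unfold ind in Et. destruct excluded_middle_informative; lra.
Qed.

(** * Compactness of rectangles *)

(** A Lebesgue number for the local property [Q]. *)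
Lemma uniform_on_rectangle a b c d (Q : R * R -> R * R -> Prop) :
  (forall s x, seg a b s -> seg c d x -> exists e, 0 < e /\
     forall p q, near e (s, x) p -> near e (s, x) q -> Q p q) ->
  exists e, 0 < e /\
    forall s x q, seg a b s -> seg c d x -> near e (s, x) q -> Q (s, x) q.
Proof.
  intros H.
  assert (Hd : forall s x, exists e : posreal, seg a b s -> seg c d x ->
     forall p q, near (2 * e) (s, x) p -> near (2 * e) (s, x) q -> Q p q).
  { intros s x. destruct (excluded_middle_informative (seg a b s /\ seg c d x)) as [[Hs Hx]|N].
    - destruct (H s x Hs Hx) as [e [He K]]. assert (He2 : 0 < e / 2) by lra.
      exists (mkposreal _ He2). intros _ _ p q Np Nq.
      simpl in *. apply K; (eapply near_le; [|eassumption]); lra.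
    - exists (mkposreal 1 Rlt_0_1). tauto. }
  set (delta := fun s x => proj1_sig (constructive_indefinite_description _ (Hd s x))).
  assert (Hdelta : forall s x, seg a b s -> seg c d x ->
     forall p q, near (2 * delta s x) (s, x) p -> near (2 * delta s x) (s, x) q -> Q p q).
  { intros s x. unfold delta. destruct constructive_indefinite_description as [e He]. exact He. }
  destruct (compactness_value_2d (Rmin a b) (Rmax a b) (Rmin c d) (Rmax c d) delta) as [e He].
  exists e; split; [apply cond_pos|]. intros s x q Hs Hx [N1 N2]. simpl in N1, N2.
  apply NNPP. intros NQ. apply (He s x Hs Hx). intros [u [v [Hu [Hv [Du [Dv De]]]]]].
  apply NQ, (Hdelta u v Hu Hv); split; simpl.
  - pose proof (Rabs_pos (s - u)); lra.
  - pose proof (Rabs_pos (x - v)); lra.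
  - replace (fst q - u) with ((fst q - s) + (s - u)) by ring.
    eapply Rle_lt_trans; [apply Rabs_triang|lra].
  - replace (snd q - v) with ((snd q - x) + (x - v)) by ring.
    eapply Rle_lt_trans; [apply Rabs_triang|lra].
Qed.

Lemma rectangle_nbhd l O a b c d : rel_open l O ->
  (forall s x, seg a b s -> seg c d x -> O (s, x)) ->
  exists e, 0 < e /\ forall s x q, seg a b s -> seg c d x -> near e (s, x) q ->
    Rbar_le l (snd q) -> O q.
Proof.
  intros HO H.
  apply (uniform_on_rectangle a b c d (fun _ q => Rbar_le l (snd q) -> O q)).
  intros s x Hs Hx. destruct (HO _ (H s x Hs Hx)) as [_ [e [He Q]]].
  exists e; split; auto.
Qed.

Lemma cont_uniform_rectangle O f a b c d : cont O f ->
  (forall s x, seg a b s -> seg c d x -> O (s, x)) ->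
  forall e, 0 < e -> exists r, 0 < r /\ forall s x q, seg a b s -> seg c d x ->
    near r (s, x) q -> O q -> Rabs (f q - f (s, x)) < e.
Proof.
  intros C H e He.
  destruct (uniform_on_rectangle a b c d
    (fun p q => O p -> O q -> Rabs (f q - f p) < e)) as [r [Hr K]].
  - intros s x Hs Hx. destruct (C _ (H s x Hs Hx) (e / 2)) as [r [Hr Q]]; [lra|].
    exists r; split; [exact Hr|]. intros p q Np Nq Op Oq.
    pose proof (Q p Op Np) as Kp. pose proof (Q q Oq Nq) as Kq.
    replace (f q - f p) with ((f q - f (s, x)) + - (f p - f (s, x))) by ring.
    eapply Rle_lt_trans; [apply Rabs_triang|]. rewrite Rabs_Ropp. lra.
  - exists r; split; [exact Hr|]. intros s x q Hs Hx N Oq. apply (K s x q); auto.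
Qed.

(** Every horizontal slice of the hull is an interval containing [s0], so that
    a quantity locally constant on the slices is determined by its values on the
    line [s = s0]. *)
Definition hull (s0 : R) (O : R * R -> Prop) (p : R * R) : Prop :=
  0 <= snd p /\ forall s x, seg s0 (fst p) s -> 0 <= x <= snd p -> O (s, x).

(** Vertical slices become intervals, on which a positive derivative gives
    monotonicity. *)
Definition column (O : R * R -> Prop) (p : R * R) : Prop :=
  0 <= snd p /\ forall x, 0 <= x <= snd p -> O (fst p, x).

Lemma seg_0 y x : 0 <= y -> (seg 0 y x <-> 0 <= x <= y).
Proof. intros H; unfold seg. rewrite Rmin_left, Rmax_right by lra. tauto. Qed.

Lemma seg_split a b c s : seg a c s -> seg a b s \/ seg b c s.
Proof.
  unfold seg, Rmin, Rmax; destruct (Rle_dec a c), (Rle_dec a b), (Rle_dec b c);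
    intros [? ?]; destruct (Rle_lt_dec s b); ((left; lra) || (right; lra)).
Qed.

Lemma near_shrink e x y t : Rabs (y - x) < e -> 0 <= t <= y -> 0 <= x ->
  exists u, 0 <= u <= x /\ Rabs (t - u) < e.
Proof.
  intros H Ht Hx. destruct (Rle_lt_dec t x).
  - exists t; split; [lra|]. rewrite Rminus_diag, Rabs_R0. pose proof (Rabs_pos (y - x)); lra.
  - exists x; split; [lra|]. apply Rabs_def2 in H. apply Rabs_def1; lra.
Qed.

(** A rectangle in a relatively open set has a neighbourhood in it. *)
Lemma hull_rel_open s0 O : rel_open 0 O -> rel_open 0 (hull s0 O).
Proof.
  intros HO [s x] [Hx H]; simpl in *. split; [exact Hx|].
  destruct (rectangle_nbhd 0 O s0 s 0 x HO) as [e [He K]].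
  { intros t u Ht Hu. apply H; [exact Ht|]. apply seg_0; assumption. }
  exists e; split; [exact He|]. intros [s' x'] [N1 N2] L; simpl in *.
  split; [exact L|]. intros t u Ht Hu; simpl in *.
  destruct (near_shrink e x x' u N2 Hu Hx) as [u' [Hu' Nu]].
  assert (exists t', seg s0 s t' /\ Rabs (t - t') < e) as [t' [Ht' Nt]].
  { destruct (seg_split s0 s s' t Ht) as [K'|K'].
    - exists t; split; [exact K'|]. rewrite Rminus_diag, Rabs_R0; exact He.
    - exists s; split; [apply seg_r|]. apply seg_Rabs in K'. lra. }
  apply (K t' u'); [exact Ht'|apply seg_0; assumption|split; assumption|simpl; lra].
Qed.

Lemma column_rel_open O : rel_open 0 O -> rel_open 0 (column O).
Proof.
  intros HO [s x] [Hx H]; simpl in *. split; [exact Hx|].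
  destruct (rectangle_nbhd 0 O s s 0 x HO) as [e [He K]].
  { intros t u Ht Hu. replace t with s.
    - apply H. apply seg_0; assumption.
    - unfold seg in Ht; rewrite Rmin_left, Rmax_left in Ht by lra. lra. }
  exists e; split; [exact He|]. intros [s' x'] [N1 N2] L; simpl in *.
  split; [exact L|]. intros u Hu; simpl in *.
  destruct (near_shrink e x x' u N2 Hu Hx) as [u' [Hu' Nu]].
  apply (K s u'); [apply seg_l|apply seg_0; assumption|split; assumption|simpl; lra].
Qed.

Lemma hull_sub s0 O p : hull s0 O p -> O p.
Proof. destruct p as [s x]. intros [Hx H]. apply H; simpl in *; [apply seg_r|lra]. Qed.

Lemma column_sub O p : column O p -> O p.
Proof. destruct p as [s x]. intros [Hx H]. apply H; simpl in *; lra. Qed.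

Lemma hull_seg s0 O s x t : hull s0 O (s, x) -> seg s0 s t -> hull s0 O (t, x).
Proof.
  intros [Hx H] Ht; split; [exact Hx|]. intros u v Hu Hv.
  apply H; [apply (seg_trans _ _ t); assumption|exact Hv].
Qed.

Lemma column_down O s y x : column O (s, y) -> 0 <= x <= y -> column O (s, x).
Proof.
  intros [Hy H] Hx; split; [apply Hx|]. intros u Hu. simpl in *. apply H; simpl; lra.
Qed.

(** * Primitives depending on a parameter *)

Definition prim (s0 : R) (f : R * R -> R) (p : R * R) : R :=
  RInt (fun s => f (s, snd p)) s0 (fst p).

Lemma cont_horizontal l D f s x : rel_open l D -> cont D f -> D (s, x) ->
  continuous (fun t => f (t, x)) s.
Proof.
  intros HD C Dp. apply continuity_pt_filterlim. intros e He.
  destruct (rel_open_fst_interior l D _ HD Dp) as [r [Hr Q]].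
  destruct (C _ Dp e He) as [d [Hd Q']]. simpl in *.
  exists (Rmin r d); split; [apply Rmin_pos; assumption|]. intros t [_ Ht].
  unfold R_dist in *. pose proof (Rmin_l r d). pose proof (Rmin_r r d).
  apply Q'; [apply Q; lra|]. split; simpl; [lra|]. rewrite Rminus_diag, Rabs_R0; exact Hd.
Qed.

Lemma cont_ex_RInt l D f a b x : rel_open l D -> cont D f ->
  (forall s, seg a b s -> D (s, x)) -> ex_RInt (fun t => f (t, x)) a b.
Proof.
  intros HD C H. apply (@ex_RInt_continuous R_CompleteNormedModule).
  intros z Hz. apply (cont_horizontal l D); auto.
Qed.

Lemma RInt_abs_le f a b m : ex_RInt f a b -> (forall t, seg a b t -> Rabs (f t) <= m) ->
  Rabs (RInt f a b) <= m * Rabs (b - a).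
Proof.
  intros E H. destruct (Rle_lt_dec a b) as [L|L].
  - rewrite (Rabs_pos_eq (b - a)) by lra. rewrite Rmult_comm.
    apply abs_RInt_le_const; trivial. intros t Ht; apply H.
    unfold seg; rewrite Rmin_left, Rmax_right by lra; exact Ht.
  - rewrite <- (@opp_RInt_swap R_CompleteNormedModule f b a) by (apply ex_RInt_swap, E).
    change (opp (RInt f b a)) with (- RInt f b a). rewrite Rabs_Ropp, Rabs_minus_sym.
    rewrite (Rabs_pos_eq (a - b)) by lra. rewrite Rmult_comm.
    apply abs_RInt_le_const; [lra|apply ex_RInt_swap, E|]. intros t Ht; apply H.
    unfold seg; rewrite Rmin_right, Rmax_left by lra; exact Ht.
Qed.

Lemma RInt_Rminus f g a b : ex_RInt f a b -> ex_RInt g a b ->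
  RInt (fun t => f t - g t) a b = RInt f a b - RInt g a b.
Proof. exact (@RInt_minus R_CompleteNormedModule f g a b). Qed.

Lemma ex_RInt_Rminus f g a b : ex_RInt f a b -> ex_RInt g a b ->
  ex_RInt (fun t => f t - g t) a b.
Proof. exact (@ex_RInt_minus R_NormedModule f g a b). Qed.

Lemma RInt_Rmult c f a b : ex_RInt f a b -> RInt (fun t => c * f t) a b = c * RInt f a b.
Proof. exact (@RInt_scal R_CompleteNormedModule f a b c). Qed.

Lemma ex_RInt_Rmult c f a b : ex_RInt f a b -> ex_RInt (fun t => c * f t) a b.
Proof. exact (@ex_RInt_scal R_NormedModule f a b c). Qed.

Lemma RInt_Rchasles f a b c : ex_RInt f a b -> ex_RInt f b c ->
  RInt f a c = RInt f a b + RInt f b c.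
Proof. intros H1 H2; symmetry; exact (@RInt_Chasles R_CompleteNormedModule f a b c H1 H2). Qed.

Definition star (s0 : R) (D : R * R -> Prop) : Prop :=
  forall s x t, D (s, x) -> seg s0 s t -> D (t, x).

Lemma prim_cont l D s0 f : rel_open l D -> star s0 D -> cont D f -> cont D (prim s0 f).
Proof.
  intros HD St C [s x] Dp e He.
  destruct (HD _ Dp) as [L [r [Hr Q]]]. simpl in L.
  set (m := Rabs (f (s, x)) + 1). assert (Hm : 0 < m) by (unfold m; pose proof (Rabs_pos (f (s, x))); lra).
  set (n := Rabs (s - s0) + 1). assert (Hn : 0 < n) by (unfold n; pose proof (Rabs_pos (s - s0)); lra).
  assert (Rect : forall t u, seg s0 s t -> seg x x u -> D (t, u)).
  { intros t u Ht Hu. replace u with x by (unfold seg in Hu; rewrite Rmin_left, Rmax_left in Hu; lra).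
    apply (St s); assumption. }
  assert (Hen : 0 < e / (2 * n)) by (apply Rdiv_lt_0_compat; lra).
  assert (Hem : 0 < e / (2 * m)) by (apply Rdiv_lt_0_compat; lra).
  destruct (cont_uniform_rectangle D f s0 s x x C Rect _ Hen) as [r1 [Hr1 K1]].
  destruct (rectangle_nbhd l D s0 s x x HD Rect) as [r2 [Hr2 K2]].
  destruct (C _ Dp 1 Rlt_0_1) as [r3 [Hr3 K3]].
  set (d := Rmin (Rmin r r1) (Rmin (Rmin r2 r3) (e / (2 * m)))).
  assert (Hd : 0 < d) by (unfold d; repeat apply Rmin_pos; assumption).
  assert (Ld : d <= r /\ d <= r1 /\ d <= r2 /\ d <= r3 /\ d <= e / (2 * m)).
  { unfold d. repeat split; repeat first [apply Rle_refl
      | apply Rmin_l | apply Rmin_r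
      | eapply Rle_trans; [apply Rmin_l|]; apply Rmin_l
      | eapply Rle_trans; [apply Rmin_l|]; apply Rmin_r
      | eapply Rle_trans; [apply Rmin_r|]; apply Rmin_r
      | eapply Rle_trans; [apply Rmin_r|]; eapply Rle_trans; [apply Rmin_l|]; apply Rmin_l
      | eapply Rle_trans; [apply Rmin_r|]; eapply Rle_trans; [apply Rmin_l|]; apply Rmin_r]. }
  destruct Ld as [L1 [L2 [L3 [L4 L5]]]].
  exists d; split; [exact Hd|]. intros [s' x'] Dq [N1 N2]. simpl in N1, N2.
  pose proof (proj1 (HD _ Dq)) as L'. simpl in L'.
  assert (Hor : forall t, seg s0 s t -> D (t, x')).
  { intros t Ht. apply (K2 t x); [exact Ht|apply seg_l| |exact L'].
    split; simpl; [rewrite Rminus_diag, Rabs_R0; lra|lra]. }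
  assert (Nr : forall t, seg s s' t -> D (t, x') /\ near r3 (s, x) (t, x')).
  { intros t Ht. apply seg_Rabs in Ht. split; [apply Q; [split|exact L']|split]; simpl; lra. }
  unfold prim; simpl.
  rewrite (RInt_Rchasles (fun t => f (t, x')) s0 s s').
  2: { apply (cont_ex_RInt l D); auto. }
  2: { apply (cont_ex_RInt l D); auto. intros t Ht; apply (Nr t Ht). }
  replace (RInt (fun t => f (t, x')) s0 s + RInt (fun t => f (t, x')) s s'
           - RInt (fun t => f (t, x)) s0 s)
    with (RInt (fun t => f (t, x') - f (t, x)) s0 s + RInt (fun t => f (t, x')) s s').
  2: { rewrite RInt_Rminus; [ring| |]; apply (cont_ex_RInt l D); auto. intros; apply Rect; trivial; apply seg_l. }
  assert (I1 : Rabs (RInt (fun t => f (t, x') - f (t, x)) s0 s) <= e / (2 * n) * Rabs (s - s0)).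
  { apply RInt_abs_le.
    - apply ex_RInt_Rminus; apply (cont_ex_RInt l D); auto. intros; apply Rect; trivial; apply seg_l.
    - intros t Ht. left. apply K1; [exact Ht|apply seg_l| |auto].
      split; simpl; [rewrite Rminus_diag, Rabs_R0; lra|lra]. }
  assert (I2 : Rabs (RInt (fun t => f (t, x')) s s') <= m * Rabs (s' - s)).
  { apply RInt_abs_le.
    - apply (cont_ex_RInt l D); auto. intros t Ht; apply (Nr t Ht).
    - intros t Ht. destruct (Nr t Ht) as [Dt Nt]. specialize (K3 _ Dt Nt).
      replace (f (t, x')) with ((f (t, x') - f (s, x)) + f (s, x)) by ring.
      eapply Rle_trans; [apply Rabs_triang|]. unfold m; lra. }
  eapply Rle_lt_trans; [apply Rabs_triang|].
  assert (e / (2 * n) * Rabs (s - s0) <= e / 2).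
  { replace (e / 2) with (e / (2 * n) * n) by (field; lra).
    apply Rmult_le_compat_l; [lra|unfold n; lra]. }
  assert (m * Rabs (s' - s) < e / 2).
  { replace (e / 2) with (m * (e / (2 * m))) by (field; lra). apply Rmult_lt_compat_l; lra. }
  lra.
Qed.

(** In [s] this is the fundamental theorem of calculus; in the parameter it is
    differentiation under the integral sign, where compactness of the segment
    makes the difference quotients converge uniformly. *)
Lemma prim_partials l D s0 f f1 f2 : rel_open l D -> star s0 D -> cont D f ->
  has_partials D f f1 f2 -> cont D f2 -> has_partials D (prim s0 f) f (prim s0 f2).
Proof.
  intros HD St C P C2 [s x] Dp. destruct (HD _ Dp) as [L [r [Hr Q]]]. simpl in L.
  split; intros e He; simpl.
  - destruct (C _ Dp e He) as [d [Hd K]].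
    exists (Rmin r d); split; [apply Rmin_pos; assumption|]. intros s' Ds' N.
    pose proof (Rmin_l r d); pose proof (Rmin_r r d).
    assert (Nr : forall t, seg s s' t -> D (t, x) /\ near d (s, x) (t, x)).
    { intros t Ht. apply seg_Rabs in Ht. split; [apply Q; [split|exact L]|split]; simpl;
        try rewrite Rminus_diag, Rabs_R0; lra. }
    unfold prim; simpl. rewrite (RInt_Rchasles (fun t => f (t, x)) s0 s s').
    2: { apply (cont_ex_RInt l D); auto. intros t Ht; apply (St s); assumption. }
    2: { apply (cont_ex_RInt l D); auto. intros t Ht; apply (Nr t Ht). }
    assert (E : ex_RInt (fun t => f (t, x)) s s')
      by (apply (cont_ex_RInt l D); auto; intros t Ht; apply (Nr t Ht)).
    assert (E' : ex_RInt (fun _ : R => f (s, x)) s s') by apply (@ex_RInt_const R_NormedModule).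
    match goal with |- Rabs ?u <= _ => replace u with (RInt (fun t => f (t, x) - f (s, x)) s s') end.
    + apply RInt_abs_le; [apply ex_RInt_Rminus; assumption|].
      intros t Ht. destruct (Nr t Ht) as [Dt Nt]. left. apply K; assumption.
    + rewrite RInt_Rminus; trivial.
      rewrite (@RInt_const R_CompleteNormedModule s s' (f (s, x))).
      unfold scal; simpl; unfold mult; simpl. ring.
  - set (n := Rabs (s - s0) + 1).
    assert (Hn : 0 < n) by (unfold n; pose proof (Rabs_pos (s - s0)); lra).
    assert (Rect : forall t u, seg s0 s t -> seg x x u -> D (t, u)).
    { intros t u Ht Hu. replace u with x by (unfold seg in Hu; rewrite Rmin_left, Rmax_left in Hu; lra).
      apply (St s); assumption. }
    assert (Hen : 0 < e / n) by (apply Rdiv_lt_0_compat; lra).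
    destruct (cont_uniform_rectangle D f2 s0 s x x C2 Rect _ Hen) as [r1 [Hr1 K1]].
    destruct (rectangle_nbhd l D s0 s x x HD Rect) as [r2 [Hr2 K2]].
    exists (Rmin r1 r2); split; [apply Rmin_pos; assumption|]. intros x' Dx' N.
    pose proof (Rmin_l r1 r2); pose proof (Rmin_r r1 r2).
    pose proof (proj1 (HD _ Dx')) as L'. simpl in L'.
    assert (Nr : forall t u, seg s0 s t -> seg x x' u -> D (t, u) /\ near r1 (t, x) (t, u)).
    { intros t u Ht Hu. pose proof (seg_Rabs _ _ _ Hu). split.
      - apply (K2 t x); [exact Ht|apply seg_l| |simpl; apply (Rbar_le_seg l x x'); assumption].
        split; simpl; [rewrite Rminus_diag, Rabs_R0; lra|lra].
      - split; simpl; [rewrite Rminus_diag, Rabs_R0; lra|lra]. }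
    assert (E : forall g, cont D g -> forall u, seg x x' u -> ex_RInt (fun t => g (t, u)) s0 s).
    { intros g Cg u Hu. apply (cont_ex_RInt l D); auto. intros t Ht; apply Nr; assumption. }
    pose proof (E f C x (seg_l _ _)) as Ex. pose proof (E f C x' (seg_r _ _)) as Ex'.
    pose proof (E f2 C2 x (seg_l _ _)) as Ex2.
    pose proof (ex_RInt_Rmult (x' - x) _ _ _ Ex2) as Ex2'.
    pose proof (ex_RInt_Rminus _ _ _ _ Ex' Ex) as Exx.
    unfold prim; simpl.
    match goal with |- Rabs ?u <= _ => replace u with
      (RInt (fun t => f (t, x') - f (t, x) - (x' - x) * f2 (t, x)) s0 s) end.
    + apply Rle_trans with (e / n * Rabs (x' - x) * Rabs (s - s0)).
      * apply RInt_abs_le.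
        { apply ex_RInt_Rminus; assumption. }
        intros t Ht.
        destruct (der_mean_value (fun u => D (t, u)) (fun u => f (t, u)) (fun u => f2 (t, u)) x x')
          as [c [Hc Ec]].
        { intros u Hu. destruct (Nr t u Ht Hu) as [Du _]. split; [exact Du|apply (P _ Du)]. }
        destruct (Nr t c Ht Hc) as [Dc Nc].
        rewrite Ec. replace (f2 (t, c) * (x' - x) - (x' - x) * f2 (t, x))
          with ((f2 (t, c) - f2 (t, x)) * (x' - x)) by ring.
        rewrite Rabs_mult. apply Rmult_le_compat_r; [apply Rabs_pos|].
        left. apply K1; [exact Ht|apply seg_l|exact Nc|exact Dc].
      * replace (e * Rabs (x' - x)) with (e / n * Rabs (x' - x) * n) by (field; lra).
        apply Rmult_le_compat_l; [|unfold n; lra].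
        apply Rmult_le_pos; [lra|apply Rabs_pos].
    + rewrite (RInt_Rminus _ _ _ _ Exx Ex2'), (RInt_Rminus _ _ _ _ Ex' Ex), (RInt_Rmult _ _ _ _ Ex2).
      match goal with |- @eq _ ?u ?v => change (@eq R u v) end. ring.
Qed.

(** The partial derivatives of a primitive are the integrand and the primitive
    of its derivative: induction on the order. *)
Lemma prim_smooth l D s0 : rel_open l D -> star s0 D ->
  forall f, smooth D f -> smooth D (prim s0 f).
Proof.
  intros HD St f Sf k. revert f Sf. induction k as [|k IH]; intros f Sf.
  - apply Ck_on_O, (prim_cont l); auto using smooth_cont.
  - destruct (smooth_partials l D f HD Sf) as [f1 [f2 [P [S1 S2]]]].
    apply (Ck_on_intro _ _ _ f (prim s0 f2)); auto.
    + apply (prim_cont l); auto using smooth_cont.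
    + apply (prim_partials l D s0 f f1 f2); auto using smooth_cont.
Qed.

(** * Functions of one variable *)

Definition strip (I : R -> Prop) (p : R * R) : Prop := I (snd p).

(** A dummy first variable makes the calculus in the plane serve for functions
    of one variable, on half-open and on open intervals alike. *)
Definition smooth1 (I : R -> Prop) (f : R -> R) : Prop :=
  smooth (strip I) (fun p => f (snd p)).

Definition initial (r y : R) : Prop := 0 <= y < r.
Definition around (r y : R) : Prop := - r < y < r.

Lemma initial_rel_open r : rel_open 0 (strip (initial r)).
Proof.
  intros p [H H']. split; [exact H|]. exists (r - snd p). split; [lra|].
  intros q [_ N] L. simpl in L. apply Rabs_def2 in N. split; lra.
Qed.

Lemma around_rel_open r : rel_open m_infty (strip (around r)).
Proof.
  intros p [H H']. split; [exact I|]. exists (Rmin (r - snd p) (snd p + r)).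
  split; [apply Rmin_pos; lra|]. intros q [_ N] _.
  pose proof (Rmin_l (r - snd p) (snd p + r)). pose proof (Rmin_r (r - snd p) (snd p + r)).
  apply Rabs_def2 in N. split; lra.
Qed.

Lemma smooth1_comp l I f B g : rel_open l (strip I) -> (forall q, B q -> I (g q)) ->
  smooth1 I f -> smooth B g -> smooth B (fun q => f (g q)).
Proof.
  intros HI Im Sf Sg.
  apply (smooth_comp l (strip I) (fun p => f (snd p)) B (fun _ => 0) g); auto using smooth_const.
Qed.

Lemma smooth1_der l I f : rel_open l (strip I) -> smooth1 I f ->
  exists f', (forall y, I y -> der I f y (f' y)) /\ smooth1 I f'.
Proof.
  intros HI Sf. destruct (smooth_partials l _ _ HI Sf) as [f1 [f2 [P [_ S2]]]].
  exists (fun y => f2 (0, y)). split.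
  - intros y Iy. apply (P (0, y) Iy).
  - apply (smooth_comp l (strip I) f2 (strip I) (fun _ => 0) snd); auto using smooth_const, smooth_snd.
Qed.

Lemma smooth1_partials I f f' : (forall y, I y -> der I f y (f' y)) ->
  has_partials (strip I) (fun p => f (snd p)) (fun _ => 0) (fun p => f' (snd p)).
Proof.
  intros D [s y] Iy. split; [exact (der_const _ (f y) _)|exact (D y Iy)].
Qed.

Lemma smooth1_Cinf1_on l I f : rel_open l (strip I) -> smooth1 I f -> Cinf1_on I f.
Proof.
  intros HI Sf k. revert f Sf. induction k as [|k IH]; intros f Sf.
  all: assert (C : continuous_on I f).
  1, 3: (intros x Ix; apply filterlim_locally; intros e;
    destruct (smooth_cont _ _ Sf (0, x) Ix e (cond_pos e)) as [d [Hd Q]];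
    exists (mkposreal d Hd); intros t Nt It; apply (Q (0, t) It); split;
      [simpl; rewrite Rminus_diag, Rabs_R0; exact Hd|exact Nt]).
  - split; [exact C|exact Logic.I].
  - split; [exact C|]. destruct (smooth1_der l I f HI Sf) as [f' [D S']].
    exists f'. split; [|apply IH, S']. intros x Ix. apply is_derive_on_der; auto.
Qed.

Lemma smooth1_cont I f x : smooth1 I f -> I x -> forall e, 0 < e ->
  exists d, 0 < d /\ forall t, I t -> Rabs (t - x) < d -> Rabs (f t - f x) < e.
Proof.
  intros Sf Ix e He. destruct (smooth_cont _ _ Sf (0, x) Ix e He) as [d [Hd Q]].
  exists d; split; [exact Hd|]. intros t It Nt. apply (Q (0, t) It).
  split; simpl; [rewrite Rminus_diag, Rabs_R0; exact Hd|exact Nt].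
Qed.

Lemma smooth1_mult I f g : smooth1 I f -> smooth1 I g -> smooth1 I (fun y => f y * g y).
Proof. intros Sf Sg; exact (smooth_mult _ _ _ Sf Sg). Qed.

Lemma smooth_pow A f n : smooth A f -> smooth A (fun p => f p ^ n).
Proof.
  intros Sf; induction n as [|n IH]; simpl; [apply smooth_const|apply smooth_mult; assumption].
Qed.

Lemma der_pow n A x : der A (fun v => v ^ n) x (INR n * x ^ pred n).
Proof. apply is_derive_der, is_derive_Reals, derivable_pt_lim_pow. Qed.

(** Division by [y] (the case [m = 0, n = 1], applied to a derivative) and
    integration against [sqrt y dy] ([m = n = 2]), in a form that stays in the
    smooth class. *)
Definition average (m n : nat) (f : R -> R) (y : R) : R :=
  RInt (fun v => v ^ m * f (y * v ^ n)) 0 1.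

Section Average.

Variables (l : Rbar) (I : R -> Prop) (n : nat).
Hypothesis HI : rel_open l (strip I).
Hypothesis Hl : forall v y, I y -> Rbar_le l (y * v ^ n).
Hypothesis Hstar : forall y v u, I y -> I (y * v ^ n) -> seg 0 v u -> I (y * u ^ n).

Let D (p : R * R) : Prop := I (snd p) /\ I (snd p * fst p ^ n).

Lemma average_domain_smooth : smooth (strip I) (fun p => snd p * fst p ^ n).
Proof. apply smooth_mult; [apply smooth_snd|apply smooth_pow, smooth_fst]. Qed.

Lemma average_domain_rel_open : rel_open l D.
Proof.
  apply (rel_open_preimage l l (strip I) (strip I) (fun _ => 0) (fun p => snd p * fst p ^ n));
    auto using cont_const, smooth_cont, average_domain_smooth.
Qed.

Lemma average_domain_star : star 0 D.
Proof.
  intros v y u [H1 H2] Hu; split; [exact H1|exact (Hstar y v u H1 H2 Hu)].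
Qed.

Lemma average_domain_one y : I y -> D (1, y).
Proof.
  intros Iy; split; [exact Iy|]. simpl. rewrite pow1, Rmult_1_r. exact Iy.
Qed.

Lemma average_integrand_smooth m f : smooth1 I f ->
  smooth D (fun p => fst p ^ m * f (snd p * fst p ^ n)).
Proof.
  intros Sf. apply smooth_mult; [apply smooth_pow, smooth_fst|].
  apply (smooth1_comp l I f D (fun p => snd p * fst p ^ n)); trivial.
  - intros q Dq; apply Dq.
  - apply (smooth_sub (strip I)); [intros p Dp; apply Dp|apply average_domain_smooth].
Qed.

Lemma average_smooth m f : smooth1 I f -> smooth1 I (average m n f).
Proof.
  intros Sf.
  apply (smooth_comp l D (prim 0 (fun p => fst p ^ m * f (snd p * fst p ^ n)))
    (strip I) (fun _ => 1) snd).
  - apply average_domain_rel_open.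
  - intros q; apply average_domain_one.
  - apply (prim_smooth l); auto using average_domain_rel_open, average_domain_star,
      average_integrand_smooth.
  - apply smooth_const.
  - apply smooth_snd.
Qed.

Lemma average_integrand_continuous m f y v : smooth1 I f -> I y -> seg 0 1 v ->
  continuous (fun v => v ^ m * f (y * v ^ n)) v.
Proof.
  intros Sf Iy Hv.
  apply (cont_horizontal l D (fun p => fst p ^ m * f (snd p * fst p ^ n)) v y).
  - apply average_domain_rel_open.
  - apply smooth_cont, average_integrand_smooth, Sf.
  - apply (average_domain_star 1 y v); [apply average_domain_one, Iy|exact Hv].
Qed.

Lemma average_ex_RInt m f y : smooth1 I f -> I y ->
  ex_RInt (fun v => v ^ m * f (y * v ^ n)) 0 1.
Proof.
  intros Sf Iy. apply (@ex_RInt_continuous R_CompleteNormedModule).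
  intros v Hv; apply average_integrand_continuous; assumption.
Qed.

Lemma average_der m f f' y : smooth1 I f -> smooth1 I f' ->
  (forall y, I y -> der I f y (f' y)) -> I y ->
  der I (average m n f) y (average (m + n) n f' y).
Proof.
  intros Sf Sf' Df Iy.
  set (g := fun p : R * R => fst p ^ m * f (snd p * fst p ^ n)).
  set (g2 := fun p : R * R => fst p ^ (m + n) * f' (snd p * fst p ^ n)).
  destruct (smooth_partials l D g average_domain_rel_open (average_integrand_smooth m f Sf))
    as [g1 [g2' [P [S1 S2]]]].
  assert (P2 : has_partials D g g1 g2).
  { intros [v x] Dp. split; [apply (P _ Dp)|].
    apply (der_eq _ _ _ (v ^ m * (f' (x * v ^ n) * v ^ n))).
    - unfold g2; simpl. rewrite pow_add. ring.
    - apply (der_scal (fun x => D (v, x)) (fun x => f (x * v ^ n)) x _ (v ^ m)).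
      apply (der_comp I f (fun x => D (v, x)) (fun x => x * v ^ n)).
      + intros t Dt; apply Dt.
      + apply Df, Dp.
      + apply (der_eq _ _ _ (v ^ n * 1 + x * 0)); [ring|].
        apply (der_mult _ (fun t => t) (fun _ => v ^ n)); [apply der_id|apply der_const]. }
  pose proof (prim_partials l D 0 g g1 g2 average_domain_rel_open average_domain_star
    (smooth_cont _ _ (average_integrand_smooth m f Sf)) P2
    (smooth_cont _ _ (average_integrand_smooth (m + n) f' Sf'))) as Q.
  destruct (Q (1, y) (average_domain_one y Iy)) as [_ Q2].
  apply (der_sub (fun t => D (1, t))); [intros t It; apply average_domain_one, It|exact Q2].
Qed.

End Average.

Lemma seg_0_1 v : seg 0 1 v <-> 0 <= v <= 1.
Proof. apply seg_0; lra. Qed.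

Lemma around_contract r y v : around r y -> Rabs v <= 1 -> around r (y * v).
Proof.
  intros [H1 H2] Hv. assert (Rabs (y * v) < r); [|apply Rabs_def2 in H; split; lra].
  rewrite Rabs_mult. assert (Rabs y < r) by (apply Rabs_def1; lra).
  pose proof (Rabs_pos y); pose proof (Rabs_pos v). nra.
Qed.

Lemma around_star r y v u : around r y -> around r (y * v ^ 1) -> seg 0 v u ->
  around r (y * u ^ 1).
Proof.
  intros H H' Hu. apply seg_Rabs in Hu. rewrite !Rminus_0_r in Hu. simpl in *.
  rewrite Rmult_1_r in *. destruct H' as [H1 H2].
  assert (K : Rabs (y * u) < r); [|apply Rabs_def2 in K; split; lra].
  apply Rle_lt_trans with (Rabs (y * v)); [|apply Rabs_def1; lra].
  rewrite !Rabs_mult. apply Rmult_le_compat_l; [apply Rabs_pos|exact Hu].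
Qed.

(** [f(y)] is the integral over [0 <= v <= 1] of the derivative [y f'(y v)] of
    [v |-> f(y v)]. *)
Lemma hadamard_division r f : smooth1 (around r) f -> f 0 = 0 ->
  exists q, smooth1 (around r) q /\ forall y, around r y -> f y = y * q y.
Proof.
  intros Sf F0. pose proof (around_rel_open r) as HO.
  destruct (smooth1_der _ _ f HO Sf) as [f' [D Sf']].
  exists (average 0 1 f'). split.
  - apply (average_smooth m_infty (around r) 1 HO (fun _ _ _ => I) (around_star r)), Sf'.
  - intros y Hy. unfold average.
    rewrite <- (RInt_Rmult y).
    2: { apply (average_ex_RInt m_infty (around r) 1 HO (fun _ _ _ => I) (around_star r)); assumption. }
    assert (B : forall v, seg 0 1 v -> around r (y * v)).
    { intros v Hv. apply around_contract; [exact Hy|]. apply seg_0_1 in Hv. apply Rabs_le; lra. }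
    symmetry.
    replace (f y) with (minus (f (y * 1)) (f (y * 0))).
    2: { rewrite Rmult_1_r, Rmult_0_r, F0. apply Rminus_0_r. }
    apply (@is_RInt_unique R_CompleteNormedModule).
    apply (@is_RInt_derive R_CompleteNormedModule (fun v => f (y * v))
      (fun v => y * (v ^ 0 * f' (y * v ^ 1)))).
    + intros v Hv. destruct (B v Hv) as [B1 B2]. simpl. rewrite Rmult_1_r.
      replace (y * (1 * f' (y * v))) with (scal y (f' (y * v)))
        by (unfold scal; simpl; unfold mult; simpl; ring).
      apply (is_derive_comp f (fun v => y * v)).
      * apply (der_is_derive (around r) _ _ _ (Rmin (r - y * v) (y * v + r))).
        { apply Rmin_pos; lra. }
        { intros t Ht. pose proof (Rmin_l (r - y * v) (y * v + r)).
          pose proof (Rmin_r (r - y * v) (y * v + r)). apply Rabs_def2 in Ht. split; lra. }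
        { apply D, B, Hv. }
      * auto_derive; [trivial|ring].
    + intros v Hv. apply (@continuous_scal_r R_UniformSpace R_AbsRing R_NormedModule y).
      apply (average_integrand_continuous m_infty (around r) 1 HO (fun _ _ _ => I) (around_star r));
        assumption.
Qed.

Lemma odd_at_0 x : x = - x -> x = 0.
Proof. lra. Qed.

Lemma even_der_odd r f f' : (forall y, around r y -> der (around r) f y (f' y)) ->
  (forall y, around r y -> f (- y) = f y) -> forall y, around r y -> f' (- y) = - f' y.
Proof.
  intros D Ev y Hy.
  assert (Sym : forall t, around r t -> around r (- t)) by (intros t [H1 H2]; split; lra).
  assert (D' : der (around r) f y (f' (- y) * -1)).
  { apply (der_ext _ (fun t => f (- t))); [exact Hy|exact Ev|].
    apply (der_comp (around r)); [exact Sym|apply D, Sym, Hy|].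
    apply is_derive_der. auto_derive; trivial. }
  pose proof (pd2_unique m_infty (strip (around r)) (fun p => f (snd p)) (0, y) _ _
    (around_rel_open r) Hy D' (D y Hy)). lra.
Qed.

(** The derivative of [x |-> f (sqrt x)] is [x |-> g (sqrt x)], where
    [f'(t) = 2 t g(t)] and [g] is again smooth and even: this is an induction on
    the order of differentiation. *)
Lemma even_sqrt_smooth r f : 0 < r -> smooth1 (around r) f ->
  (forall y, around r y -> f (- y) = f y) ->
  smooth1 (initial (r * r)) (fun x => f (sqrt x)).
Proof.
  intros Hr Sf Ev k.
  assert (Sq : forall x, initial (r * r) x -> around r (sqrt x)).
  { intros x [H1 H2]. pose proof (sqrt_pos x). split; [lra|].
    rewrite <- (sqrt_square r) by lra. apply sqrt_lt_1_alt; lra. }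
  assert (Csqrt : cont (strip (initial (r * r))) (fun p => sqrt (snd p)))
    by (apply cont_comp_continuous; [apply cont_snd|intros; apply continuous_sqrt]).
  revert f Sf Ev. induction k as [|k IH]; intros f Sf Ev.
  all: assert (C : cont (strip (initial (r * r))) (fun p => f (sqrt (snd p))))
    by (apply (cont_comp (strip (around r)) (fun p => f (snd p)) _ (fun _ => 0)
          (fun p => sqrt (snd p))); auto using cont_const, smooth_cont;
        intros q Hq; apply Sq, Hq).
  - apply Ck_on_O, C.
  - pose proof (around_rel_open r) as HO.
    destruct (smooth1_der _ _ f HO Sf) as [f' [D Sf']].
    pose proof (even_der_odd r f f' D Ev) as Odd.
    assert (A0 : around r 0) by (split; lra).
    destruct (hadamard_division r f' Sf') as [q [Sq' Hq]].
    { apply odd_at_0. rewrite <- Odd, Ropp_0 by exact A0. reflexivity. }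
    assert (Evq : forall y, around r y -> q (- y) = q y).
    { intros y Hy. destruct (Req_dec y 0) as [->|N]; [rewrite Ropp_0; reflexivity|].
      assert (Hy' : around r (- y)) by (destruct Hy; split; lra).
      apply (Rmult_eq_reg_l (- y)); [|lra]. rewrite <- Hq by exact Hy'.
      rewrite Odd, (Hq y Hy) by exact Hy. ring. }
    apply (Ck_on_intro _ _ _ (fun _ => 0) (fun p => / 2 * q (sqrt (snd p)))); trivial.
    + apply (smooth1_partials _ (fun x => f (sqrt x)) (fun x => / 2 * q (sqrt x))).
      intros x Hx. pose proof (Sq x Hx) as Ax. destruct Hx as [[Hx|Hx] Hx'].
      * pose proof (sqrt_lt_R0 x Hx) as Hs.
        apply (der_eq _ _ _ (f' (sqrt x) * / (2 * sqrt x))).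
        { rewrite (Hq _ Ax). field. lra. }
        apply (der_comp (around r)); [exact Sq|apply D, Ax|].
        apply is_derive_der, is_derive_Reals, derivable_pt_lim_sqrt, Hx.
      * subst x. clear Ax Hx'. rewrite sqrt_0. intros e He.
        destruct (smooth1_cont _ _ 0 Sq' A0 e He) as [d [Hd Q]].
        exists (d * d); split; [nra|]. intros x Hx Nx. rewrite Rminus_0_r in *.
        pose proof (Sq x Hx) as Ax. destruct Hx as [Hx Hx'].
        rewrite sqrt_0. pose proof (sqrt_pos x) as Hs. pose proof (sqrt_sqrt x Hx) as Ex.
        set (t := sqrt x) in *.
        rewrite (Rabs_pos_eq x) in * by exact Hx.
        assert (Ht : t < d) by nra.
        destruct (der_mean_value (around r) (fun y => f y - / 2 * q 0 * y ^ 2)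
          (fun y => f' y - / 2 * q 0 * (INR 2 * y ^ 1)) 0 t) as [c [Hc E]].
        { intros y Hy. assert (Ay : around r y).
          { apply seg_0 in Hy; [|exact Hs]. destruct Ax; split; lra. }
          split; [exact Ay|]. apply der_minus; [apply D, Ay|].
          apply (der_scal _ (fun y => y ^ 2)), der_pow. }
        apply seg_0 in Hc; [|exact Hs].
        assert (Ac : around r c) by (destruct Ax; split; lra).
        rewrite (Hq c Ac) in E. simpl in E.
        replace (f t - f 0 - / 2 * q 0 * x) with ((q c - q 0) * (c * t)) by (rewrite <- Ex; lra).
        rewrite Rabs_mult, (Rabs_pos_eq (c * t)) by nra.
        assert (Kc : Rabs (q c - q 0) < e).
        { apply Q; [exact Ac|]. rewrite Rminus_0_r, Rabs_pos_eq; lra. }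
        apply Rmult_le_compat; [apply Rabs_pos|nra|lra|rewrite <- Ex; nra].
    + apply Ck_on_const.
    + apply Ck_on_mult; [apply Ck_on_const|]. apply IH; assumption.
Qed.

Lemma initial_star r y v u : initial r y -> initial r (y * v ^ 2) -> seg 0 v u -> initial r (y * u ^ 2).
Proof.
  intros [H1 H2] [H3 H4] Hu. apply seg_Rabs in Hu. rewrite !Rminus_0_r in Hu.
  apply Rsqr_le_abs_1 in Hu. unfold Rsqr in Hu. simpl in *. rewrite Rmult_1_r in *.
  split; nra.
Qed.

Lemma initial_nonneg r v y : initial r y -> Rbar_le 0 (y * v ^ 2).
Proof. intros [H1 H2]. simpl. nra. Qed.

(** The equation [sqrt X dX = sqrt y M(y) dy] has the solution
    [X = (3/2 int sqrt y M)^(2/3)].  With [N(y) = int_0^1 v^2 M(y v^2) dv] it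
    reads [X = y (3 N)^(2/3)], which is smooth up to [y = 0] although the
    equation is singular there.  Differentiating [v^3 M(y v^2)] in [v] gives
    [3 N + 2 y N' = M], and hence [X' = M / (3 N)^(1/3)]. *)
Lemma sqrt_primitive r M : smooth1 (initial r) M -> (forall y, initial r y -> 0 < M y) ->
  exists X X', smooth1 (initial r) X /\ smooth1 (initial r) X' /\
    (forall y, initial r y -> der (initial r) X y (X' y)) /\ X 0 = 0 /\
    (forall y, initial r y -> 0 < X' y) /\
    (forall y, initial r y -> sqrt (X y) * X' y = sqrt y * M y).
Proof.
  intros SM PM. pose proof (initial_rel_open r) as HO.
  destruct (smooth1_der _ _ M HO SM) as [M' [DM SM']].
  set (N := average 2 2 M). set (N' := average 4 2 M').
  assert (SN : smooth1 (initial r) N)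
    by (apply (average_smooth 0 (initial r) 2 HO (initial_nonneg r) (initial_star r)), SM).
  assert (DN : forall y, initial r y -> der (initial r) N y (N' y))
    by (intros y Hy; apply (average_der 0 (initial r) 2 HO (initial_nonneg r) (initial_star r)); auto).
  assert (in01 : forall y v, initial r y -> seg 0 1 v -> initial r (y * v ^ 2)).
  { intros y v Hy Hv. apply (initial_star r y 1 v Hy); [|exact Hv].
    simpl; rewrite !Rmult_1_r; exact Hy. }
  assert (PN : forall y, initial r y -> 0 < N y).
  { intros y Hy. apply RInt_gt_0; [lra| |].
    - intros v Hv. apply Rmult_lt_0_compat; [simpl; nra|].
      apply PM, in01; [exact Hy|apply seg_0_1; lra].
    - intros v Hv. apply (average_integrand_continuous 0 (initial r) 2 HO (initial_nonneg r)
        (initial_star r)); trivial. apply seg_0_1, Hv. }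
  assert (EN : forall y, initial r y -> 3 * N y + 2 * y * N' y = M y).
  { intros y Hy.
    pose proof (average_ex_RInt 0 (initial r) 2 HO (initial_nonneg r) (initial_star r) 2 M y SM Hy) as E1.
    pose proof (average_ex_RInt 0 (initial r) 2 HO (initial_nonneg r) (initial_star r) 4 M' y SM' Hy) as E2.
    unfold N, N', average. rewrite <- (RInt_Rmult 3 _ _ _ E1), <- (RInt_Rmult (2 * y) _ _ _ E2).
    rewrite <- (@RInt_plus R_CompleteNormedModule); [|apply ex_RInt_Rmult, E1|apply ex_RInt_Rmult, E2].
    replace (M y) with (minus (1 ^ 3 * M (y * 1 ^ 2)) (0 ^ 3 * M (y * 0 ^ 2))).
    2: { unfold minus, plus, opp; simpl. rewrite !Rmult_1_r. ring. }
    apply (@is_RInt_unique R_CompleteNormedModule).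
    apply (@is_RInt_derive R_CompleteNormedModule (fun v => v ^ 3 * M (y * v ^ 2))
      (fun v => plus (3 * (v ^ 2 * M (y * v ^ 2))) (2 * y * (v ^ 4 * M' (y * v ^ 2))))).
    - intros v Hv.
      assert (Dv : der (fun v => initial r (y * v ^ 2)) (fun v => v ^ 3 * M (y * v ^ 2)) v
        (plus (3 * (v ^ 2 * M (y * v ^ 2))) (2 * y * (v ^ 4 * M' (y * v ^ 2))))).
      { apply (der_eq _ _ _ (M (y * v ^ 2) * (INR 3 * v ^ 2)
           + v ^ 3 * (M' (y * v ^ 2) * (y * (INR 2 * v ^ 1))))).
        - unfold plus; simpl. ring.
        - apply (der_mult _ (fun v => v ^ 3) (fun v => M (y * v ^ 2))); [apply der_pow|].
          apply (der_comp (initial r) M _ (fun v => y * v ^ 2)); [trivial|apply DM, in01; assumption|].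
          apply (der_scal _ (fun v => v ^ 2) v (INR 2 * v ^ 1) y), der_pow. }
      pose proof (in01 y v Hy Hv) as [_ Hr]. destruct Hy as [H0 _].
      set (d := (r - y * v ^ 2) / (3 * (y + 1))).
      assert (Hd : 0 < d) by (apply Rdiv_lt_0_compat; lra).
      apply (der_is_derive _ _ _ _ (Rmin 1 d) (Rmin_pos _ _ Rlt_0_1 Hd)) in Dv; [exact Dv|].
      intros t Ht. pose proof (Rmin_l 1 d). pose proof (Rmin_r 1 d).
      assert (Ed : d * (3 * (y + 1)) = r - y * v ^ 2) by (unfold d; field; lra).
      apply seg_0_1 in Hv. apply Rabs_def2 in Ht. split; [simpl; nra|].
      assert (t ^ 2 - v ^ 2 <= 3 * d).
      { replace (t ^ 2 - v ^ 2) with ((t - v) * (t + v)) by ring.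
        destruct (Rle_lt_dec 0 (t - v)); nra. }
      nra.
    - intros v Hv. apply (@continuous_plus R_UniformSpace R_AbsRing R_NormedModule).
      + apply (@continuous_scal_r R_UniformSpace R_AbsRing R_NormedModule 3).
        exact (average_integrand_continuous 0 (initial r) 2 HO (initial_nonneg r) (initial_star r)
          2 M y v SM Hy Hv).
      + apply (@continuous_scal_r R_UniformSpace R_AbsRing R_NormedModule (2 * y)).
        exact (average_integrand_continuous 0 (initial r) 2 HO (initial_nonneg r) (initial_star r)
          4 M' y v SM' Hy Hv). }
  set (p := fun y => exp (/ 3 * ln (3 * N y))).
  assert (Pp : forall y, 0 < p y) by (intros; apply exp_pos).
  assert (Ep : forall y, initial r y -> p y ^ 3 = 3 * N y).
  { intros y Hy. specialize (PN y Hy). unfold p. simpl. rewrite Rmult_1_r, <- !exp_plus.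
    replace (/ 3 * ln (3 * N y) + (/ 3 * ln (3 * N y) + / 3 * ln (3 * N y)))
      with (ln (3 * N y)) by field.
    apply exp_ln; lra. }
  assert (Sp : smooth1 (initial r) p).
  { apply smooth_exp, smooth_mult; [apply smooth_const|]. apply smooth_ln.
    - intros q Hq. specialize (PN _ Hq). lra.
    - apply smooth_mult; [apply smooth_const|exact SN]. }
  assert (Dp : forall y, initial r y -> der (initial r) p y (N' y / p y ^ 2)).
  { intros y Hy. pose proof (Ep y Hy) as E. pose proof (Pp y). pose proof (PN y Hy).
    apply (der_eq _ _ _ (p y * (/ 3 * (/ (3 * N y) * (3 * N' y))))).
    - rewrite <- E. field. lra.
    - apply (der_comp (fun _ => True) exp (initial r) (fun y => / 3 * ln (3 * N y))); [trivial| |].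
      + apply is_derive_der, is_derive_Reals, derivable_pt_lim_exp.
      + apply (der_scal _ (fun y => ln (3 * N y))).
        apply (der_comp (fun _ => True) ln (initial r) (fun y => 3 * N y)); [trivial| |].
        * apply is_derive_der, is_derive_Reals, derivable_pt_lim_ln. lra.
        * apply der_scal, DN, Hy. }
  exists (fun y => y * (p y * p y)), (fun y => M y * / p y).
  split; [|split; [|split; [|split; [|split]]]].
  - apply smooth_mult; [apply smooth_snd|]. exact (smooth1_mult _ _ _ Sp Sp).
  - apply smooth1_mult; [exact SM|]. apply smooth_inv; [|exact Sp].
    intros q _. specialize (Pp (snd q)). lra.
  - intros y Hy. pose proof (Pp y). pose proof (PN y Hy). pose proof (Ep y Hy) as E.
    apply (der_eq _ _ _ (p y * p y * 1 + y * (p y * (N' y / p y ^ 2) + p y * (N' y / p y ^ 2)))).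
    + rewrite <- EN, <- E by exact Hy. field. lra.
    + apply (der_mult _ (fun y => y) (fun y => p y * p y)); [apply der_id|].
      apply der_mult; apply Dp, Hy.
  - ring.
  - intros y Hy. apply Rmult_lt_0_compat; [apply PM, Hy|apply Rinv_0_lt_compat, Pp].
  - intros y Hy. pose proof (Pp y). destruct Hy as [Hy _].
    rewrite sqrt_mult, sqrt_square by nra. field. lra.
Qed.

(** * The coordinates (s, h) and the time function *)

Record level_coordinates (A : R * R -> Prop) (h h1 h2 : R * R -> R) : Prop := {
  lc_open : rel_open 0 A;
  lc_column : forall s y x, A (s, y) -> 0 <= x <= y -> A (s, x);
  lc_smooth : smooth A h;
  lc_partials : has_partials A h h1 h2;
  lc_smooth1 : smooth A h1;
  lc_smooth2 : smooth A h2;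
  lc_boundary : forall s, A (s, 0) -> h (s, 0) = 0;
  lc_pos : forall p, A p -> 0 < h2 p
}.

Arguments lc_open {A h h1 h2} _.
Arguments lc_column {A h h1 h2} _ s y x _ _.
Arguments lc_smooth {A h h1 h2} _.
Arguments lc_partials {A h h1 h2} _ p _.
Arguments lc_smooth1 {A h h1 h2} _.
Arguments lc_smooth2 {A h h1 h2} _.
Arguments lc_boundary {A h h1 h2} _ s _.
Arguments lc_pos {A h h1 h2} _ p _.

Section Levels.

Context {A : R * R -> Prop} {h h1 h2 : R * R -> R}.
Hypothesis L : level_coordinates A h h1 h2.

Definition levels (q : R * R) : Prop := exists y, A (fst q, y) /\ h (fst q, y) = snd q.

Definition height (q : R * R) : R :=
  epsilon (inhabits 0) (fun y => A (fst q, y) /\ h (fst q, y) = snd q).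

Lemma height_spec q : levels q -> A (fst q, height q) /\ h (fst q, height q) = snd q.
Proof. exact (epsilon_spec (inhabits 0) _). Qed.

Lemma domain_nonneg s y : A (s, y) -> 0 <= y.
Proof. intros Ay; exact (proj1 ((lc_open L) _ Ay)). Qed.

Lemma h_increasing s y y' : A (s, y) -> A (s, y') -> y < y' -> h (s, y) < h (s, y').
Proof.
  intros Ay Ay' Lt. pose proof (domain_nonneg _ _ Ay) as Hy.
  destruct (der_mean_value (fun t => A (s, t)) (fun t => h (s, t)) (fun t => h2 (s, t)) y y')
    as [c [Hc E]].
  { intros t Ht. unfold seg in Ht. rewrite Rmin_left, Rmax_right in Ht by lra.
    assert (At : A (s, t)) by (apply (lc_column L s y'); [exact Ay'|lra]).
    split; [exact At|apply (lc_partials L _ At)]. }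
  unfold seg in Hc. rewrite Rmin_left, Rmax_right in Hc by lra.
  pose proof (lc_pos L (s, c) (lc_column L s y' c Ay' ltac:(lra))). nra.
Qed.

Lemma h_bounds s y : A (s, y) -> 0 <= h (s, y) /\ (0 < y <-> 0 < h (s, y)).
Proof.
  intros Ay. pose proof (domain_nonneg _ _ Ay) as [Hy|Hy].
  - assert (A0 : A (s, 0)) by (apply (lc_column L s y); [exact Ay|lra]).
    pose proof (h_increasing s 0 y A0 Ay Hy). rewrite (lc_boundary L s A0) in *. lra.
  - subst y. rewrite (lc_boundary L s Ay). lra.
Qed.

Lemma height_h s y : A (s, y) -> height (s, h (s, y)) = y.
Proof.
  intros Ay. destruct (height_spec (s, h (s, y))) as [Aq E]; [exists y; auto|]. simpl in *.
  destruct (Rtotal_order (height (s, h (s, y))) y) as [Lt|[Lt|Lt]]; [|exact Lt|].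
  - pose proof (h_increasing _ _ _ Aq Ay Lt). lra.
  - pose proof (h_increasing _ _ _ Ay Aq Lt). lra.
Qed.

Lemma levels_nonneg q : levels q -> 0 <= snd q.
Proof. intros [y [Ay E]]. rewrite <- E. apply h_bounds, Ay. Qed.

(** By the intermediate value theorem the levels attained above a point fill an
    interval, and its upper end can be pushed beyond a given level also on the
    neighbouring fibres. *)
Lemma levels_rel_open : rel_open 0 levels.
Proof.
  intros [s x] Lq. split; [apply (levels_nonneg _ Lq)|]. destruct Lq as [y [Ay E]]. simpl in *.
  destruct (rel_open_upper 0 A s y (lc_open L) Ay 1 Rlt_0_1) as [t [Ht At]].
  assert (M : x < h (s, t)) by (rewrite <- E; apply h_increasing; auto; lra).
  destruct (cont_gt_near 0 A h _ _ (lc_open L) (smooth_cont _ _ (lc_smooth L)) At M) as [d [Hd Q]].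
  exists d; split; [exact Hd|]. intros [s' x'] [N1 N2] Lt. simpl in *.
  pose proof (domain_nonneg _ _ At) as Ht0.
  destruct (Q (s', t) x') as [At' M']; trivial.
  { split; simpl; [exact N1|rewrite Rminus_diag, Rabs_R0; exact Hd]. }
  assert (A0 : A (s', 0)) by (apply (lc_column L s' t); [exact At'|lra]).
  destruct (IVT_gen (fun u => h (s', clamp 0 t u)) 0 t x') as [u [Hu Eu]].
  - intros u. apply (clamp_continuity 0 t (fun u => h (s', u)) Ht0). intros v Hv e He.
    destruct (smooth_cont _ _ (lc_smooth L) (s', v) (lc_column L _ _ _ At' Hv) e He) as [d' [Hd' Q']].
    exists d'; split; [exact Hd'|]. intros r Hr Nr. apply Q'; [apply (lc_column L _ _ _ At' Hr)|].
    split; simpl; [rewrite Rminus_diag, Rabs_R0; exact Hd'|exact Nr].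
  - rewrite !clamp_id, (lc_boundary L _ A0) by lra. rewrite Rmin_left, Rmax_right; lra.
  - rewrite Rmin_left, Rmax_right in Hu by exact Ht0. rewrite clamp_id in Eu by exact Hu.
    exists u. split; [apply (lc_column L _ _ _ At' Hu)|exact Eu].
Qed.

Lemma height_smooth : smooth levels height.
Proof.
  apply (inverse_smooth 0 A fst (fun _ => 1) (fun _ => 0) h h1 h2 levels fst height);
    eauto using smooth_const, lc_open, lc_partials, lc_smooth1, lc_smooth2.
  - intros p _; split; [exact (der_id _ _)|exact (der_const _ (fst p) _)].
  - intros p Ap. pose proof (lc_pos L p Ap). lra.
  - intros q Lq. destruct (height_spec q Lq). auto.
  - apply cont_fst.
  - apply (vertical_inverse_cont 0 A h); eauto using lc_open, lc_smooth, smooth_cont, h_increasing, height_spec.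
Qed.

(** Implicit differentiation of [h (s, height (s, x)) = x]. *)
Lemma height_partials : has_partials levels height
  (fun q => - h1 (fst q, height q) / h2 (fst q, height q))
  (fun q => / h2 (fst q, height q)).
Proof.
  intros [s x] Lq.
  destruct (smooth_partials 0 _ _ levels_rel_open height_smooth) as [k1 [k2 [P [_ _]]]].
  destruct (P _ Lq) as [P1 P2]. destruct (height_spec _ Lq) as [Ap E].
  assert (D : diffat A h (fst (s, x), height (s, x)) (h1 (s, height (s, x))) (h2 (s, height (s, x))))
    by (apply (smooth_diffat 0); eauto using lc_open, lc_partials, lc_smooth1, lc_smooth2).
  pose proof (lc_pos L _ Ap) as Pos. simpl in *.
  assert (Im : forall q, levels q -> A (fst q, height q)) by (intros q Hq; apply height_spec, Hq).
  pose proof (pd1_comp A h levels fst height (s, x) _ _ 1 _ Im D (der_id _ _) P1) as E1.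
  pose proof (pd2_comp A h levels fst height (s, x) _ _ 0 _ Im D (der_const _ s _) P2) as E2.
  apply (der_ext _ _ (fun _ => x)) in E1; [|exact Lq|intros t Ht; apply (height_spec _ Ht)].
  apply (der_ext _ _ (fun t => t)) in E2; [|exact Lq|intros t Ht; apply (height_spec _ Ht)].
  pose proof (pd1_unique 0 levels snd (s, x) _ _ levels_rel_open Lq E1 (der_const _ x _)) as F1.
  pose proof (pd2_unique 0 levels snd (s, x) _ _ levels_rel_open Lq E2 (der_id _ _)) as F2.
  split; (eapply der_eq; [|eassumption]); apply (Rmult_eq_reg_l (h2 (s, height (s, x)))); try lra;
    field_simplify; lra.
Qed.

(** The coefficient of the area form in the coordinates (s, h):
    [ds dy = density ds dh]. *)
Definition density (q : R * R) : R := / h2 (fst q, height q).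

Lemma density_pos q : levels q -> 0 < density q.
Proof. intros Lq; apply Rinv_0_lt_compat, (lc_pos L), height_spec, Lq. Qed.

Lemma density_smooth : smooth levels density.
Proof.
  apply smooth_inv.
  - intros q Lq. pose proof (lc_pos L _ (proj1 (height_spec q Lq))). lra.
  - apply (smooth_comp 0 A h2 levels fst height); eauto using lc_open, lc_smooth2, smooth_fst, height_smooth.
    intros q Lq; apply height_spec, Lq.
Qed.

Variable s0 : R.

Definition flow_domain : R * R -> Prop := hull s0 levels.

(** The time along the level curves of [h], counted from the line [s = s0], for
    the Hamiltonian flow of [h]: [(time, h)] are symplectic coordinates. *)
Definition time : R * R -> R := prim s0 density.

Lemma flow_domain_rel_open : rel_open 0 flow_domain.
Proof. apply hull_rel_open, levels_rel_open. Qed.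

Lemma flow_domain_star : star s0 flow_domain.
Proof. intros s x t; apply hull_seg. Qed.

Lemma flow_domain_levels q : flow_domain q -> levels q.
Proof. apply hull_sub. Qed.

Lemma time_smooth : smooth flow_domain time.
Proof.
  apply (prim_smooth 0); auto using flow_domain_rel_open, flow_domain_star.
  apply (smooth_sub levels); auto using flow_domain_levels, density_smooth.
Qed.

Lemma time_partials : exists T2, smooth flow_domain T2 /\ has_partials flow_domain time density T2.
Proof.
  assert (S : smooth flow_domain density)
    by (apply (smooth_sub levels); auto using flow_domain_levels, density_smooth).
  destruct (smooth_partials 0 _ _ flow_domain_rel_open S) as [g1 [g2 [P [S1 S2]]]].
  exists (prim s0 g2). split.
  - apply (prim_smooth 0); auto using flow_domain_rel_open, flow_domain_star.
  - apply (prim_partials 0 _ _ _ g1); auto using flow_domain_rel_open, flow_domain_star, smooth_cont.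
Qed.

(** Each of the two points is joined to the line [s = s0] within its level. *)
Lemma flow_domain_between s s' x t : flow_domain (s, x) -> flow_domain (s', x) -> seg s s' t ->
  flow_domain (t, x).
Proof.
  intros H H' Ht.
  destruct (seg_split s s0 s' t Ht) as [K|K].
  - apply (hull_seg _ _ s); [exact H|apply seg_sym, K].
  - apply (hull_seg _ _ s'); [exact H'|exact K].
Qed.

Lemma time_mean_value s s' x : flow_domain (s, x) -> flow_domain (s', x) ->
  exists c, seg s s' c /\ flow_domain (c, x) /\
    time (s', x) - time (s, x) = density (c, x) * (s' - s).
Proof.
  intros H H'. destruct time_partials as [T2 [_ P]].
  destruct (der_mean_value (fun t => flow_domain (t, x)) (fun t => time (t, x))
    (fun t => density (t, x)) s s') as [c [Hc E]].
  - intros t Ht. assert (Dt : flow_domain (t, x)) by (apply (flow_domain_between s s'); assumption).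
    split; [exact Dt|apply (P _ Dt)].
  - exists c. split; [exact Hc|]. split; [apply (flow_domain_between s s'); assumption|exact E].
Qed.

Lemma time_increasing s s' x : flow_domain (s, x) -> flow_domain (s', x) -> s < s' ->
  time (s, x) < time (s', x).
Proof.
  intros H H' Lt. destruct (time_mean_value s s' x H H') as [c [_ [Dc E]]].
  pose proof (density_pos _ (flow_domain_levels _ Dc)). nra.
Qed.

End Levels.

Arguments levels A h q : clear implicits.
Arguments height A h q : clear implicits.
Arguments density A h h2 q : clear implicits.
Arguments flow_domain A h s0 _ : clear implicits.
Arguments time A h h2 s0 _ : clear implicits.

(** * The displacement of a billiard-like map along the level curves *)

Lemma adjacent_rel_open a b U : adjacent_domain a b U ->
  rel_open 0 (set_union U (bd_interval a b)).
Proof.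
  intros [[_ [O _]] [Pos [_ Adj]]] p [Up|Jp].
  - split; [left; apply Pos, Up|]. destruct (O p Up) as [d Hd].
    exists d; split; [apply cond_pos|]. intros q [N1 N2] _. left. apply Hd.
    split; [exact N1|exact N2].
  - split; [destruct Jp as [_ [_ E]]; rewrite E; apply Rle_refl|].
    destruct (Adj p Jp) as [d Hd]. exists d; split; [apply cond_pos|].
    intros q [N1 N2] Lq. apply Hd; [split; [exact N1|exact N2]|exact Lq].
Qed.

Lemma open_pos_rel_open U : open U -> (forall p, U p -> 0 < snd p) -> rel_open 0 U.
Proof.
  intros O Pos p Up. destruct (open_rel_open U O p Up) as [_ [d [Hd Q]]].
  split; [left; apply Pos, Up|]. exists d; split; [exact Hd|]. intros q N _. apply Q; [exact N|exact I].
Qed.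

Lemma near_open (U : R * R -> Prop) :
  (forall p, U p -> exists d, 0 < d /\ forall q, near d p q -> U q) -> open U.
Proof.
  intros H p Up. destruct (H p Up) as [d [Hd Q]]. exists (mkposreal d Hd).
  intros q [N1 N2]. apply Q. split; [exact N1|exact N2].
Qed.

Lemma rel_open_near l A d p : rel_open l A -> rel_open l (fun q => A q /\ near d p q).
Proof.
  intros HA q [Aq [N1 N2]]. destruct (HA q Aq) as [Lq [e [He Q]]]. split; [exact Lq|].
  set (r1 := d - Rabs (fst q - fst p)). set (r2 := d - Rabs (snd q - snd p)).
  exists (Rmin e (Rmin r1 r2)).
  split; [unfold r1, r2; repeat apply Rmin_pos; lra|]. intros q' N Lq'.
  split; [apply Q; [eapply near_le; [apply Rmin_l|exact N]|exact Lq']|].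
  apply (near_le _ _ _ _ (Rmin_r _ _)) in N.
  destruct (near_le _ _ _ _ (Rmin_l _ _) N) as [M1 _].
  destruct (near_le _ _ _ _ (Rmin_r _ _) N) as [_ M2]. unfold r1, r2 in *. split.
  - replace (fst q' - fst p) with ((fst q' - fst q) + (fst q - fst p)) by ring.
    eapply Rle_lt_trans; [apply Rabs_triang|lra].
  - replace (snd q' - snd p) with ((snd q' - snd q) + (snd q - snd p)) by ring.
    eapply Rle_lt_trans; [apply Rabs_triang|lra].
Qed.

Section Billiard.

Context {a b : Rbar} {V : R * R -> Prop} {F : R * R -> R * R} {w : R -> R}.
Context {U0 : R * R -> Prop} {h h1 h2 : R * R -> R} {s0 : R}.

Local Notation J := (bd_interval a b).

Hypothesis HF : billiard_like a b V F w.
Hypothesis HU : adjacent_domain a b U0.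
Hypothesis Sh : smooth (set_union U0 J) h.
Hypothesis Ph : has_partials (set_union U0 J) h h1 h2.
Hypothesis Sh1 : smooth (set_union U0 J) h1.
Hypothesis Sh2 : smooth (set_union U0 J) h2.
Hypothesis Inv : invariant_under (set_union V J) F (set_union U0 J) h.
Hypothesis h_bd : forall p, J p -> h p = 0.
Hypothesis h2_pos : forall p, set_union U0 J p -> 0 < h2 p.
Hypothesis Hs0 : J (s0, 0).

Definition region : R * R -> Prop := column (set_union (fun p => V p /\ U0 p) J).

Local Notation hgt := (height region h).
Local Notation D := (flow_domain region h s0).
Local Notation T := (time region h h2 s0).

Lemma V_pos p : V p -> 0 < snd p.
Proof. apply (bl_domain _ _ _ _ _ HF). Qed.

Lemma V_rel_open : rel_open 0 V.
Proof. apply open_pos_rel_open; [apply (bl_domain _ _ _ _ _ HF)|apply V_pos]. Qed.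

Lemma region_cases p : region p -> (V p /\ U0 p /\ 0 < snd p) \/ (J p /\ snd p = 0).
Proof.
  intros Rp. apply column_sub in Rp. destruct Rp as [[Vp Up]|Jp].
  - left. auto using V_pos.
  - right. split; [exact Jp|apply Jp].
Qed.

Lemma region_U0 p : region p -> set_union U0 J p.
Proof. intros Rp. destruct (region_cases p Rp) as [[_ [H _]]|[H _]]; [left|right]; exact H. Qed.

Lemma region_V p : region p -> set_union V J p.
Proof. intros Rp. destruct (region_cases p Rp) as [[H _]|[H _]]; [left|right]; exact H. Qed.

Lemma region_J p : J p -> region p.
Proof.
  destruct p as [s y]; intros [H1 [H2 E]]; simpl in E; subst y. split; [apply Rle_refl|].
  intros x Hx. simpl in *. right. repeat split; trivial. simpl; lra.
Qed.

Lemma region_V_pos p : region p -> 0 < snd p -> V p.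
Proof. intros Rp H. destruct (region_cases p Rp) as [[Vp _]|[_ E]]; [exact Vp|lra]. Qed.

Lemma region_bd p : region p -> J (fst p, 0).
Proof.
  intros [Hy H]. destruct (H 0) as [[Vp _]|Jp]; [lra| |exact Jp].
  pose proof (V_pos _ Vp). simpl in *. lra.
Qed.

Lemma region_rel_open : rel_open 0 region.
Proof.
  apply column_rel_open.
  pose proof (rel_open_and _ _ _ (adjacent_rel_open _ _ _ (bl_domain _ _ _ _ _ HF))
    (adjacent_rel_open _ _ _ HU)) as H.
  apply (rel_open_equiv 0 _ _) with (2 := H). intros p; split.
  - intros [[Vp|Jp] [Up|Jp']]; [left; auto|right; assumption|right; assumption|right; assumption].
  - intros [[Vp Up]|Jp]; split; (left; assumption) || (right; assumption).
Qed.

Lemma region_coordinates : level_coordinates region h h1 h2.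
Proof.
  constructor.
  - exact region_rel_open.
  - intros s y x; apply column_down.
  - apply (smooth_sub (set_union U0 J)); [exact region_U0|exact Sh].
  - apply (has_partials_sub (set_union U0 J)); [exact region_U0|exact Ph].
  - apply (smooth_sub (set_union U0 J)); [exact region_U0|exact Sh1].
  - apply (smooth_sub (set_union U0 J)); [exact region_U0|exact Sh2].
  - intros s Rs. apply h_bd, (region_bd _ Rs).
  - intros p Rp. apply h2_pos, region_U0, Rp.
Qed.

Local Notation L := region_coordinates.

Lemma F_cont : cont (set_union V J) (fun p => fst (F p)) /\ cont (set_union V J) (fun p => snd (F p)).
Proof. apply continuous_on_cont2, (bl_homeo _ _ _ _ _ HF). Qed.

Lemma h_F p : region p -> region (F p) -> h (F p) = h p.
Proof. intros Rp RFp. apply Inv; [apply region_V|apply region_U0|apply region_U0]; assumption. Qed.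

Definition to_levels (p : R * R) : R * R := (fst p, h p).

Lemma to_levels_boundary s x : levels region h (s, x) -> (0 < hgt (s, x) <-> 0 < x).
Proof.
  intros Lq. destruct (height_spec _ Lq) as [Rp E]. simpl in *.
  pose proof (h_bounds L _ _ Rp) as [_ K]. rewrite E in K. exact K.
Qed.

Lemma height_0 s : levels region h (s, 0) -> hgt (s, 0) = 0.
Proof.
  intros Lq. pose proof (to_levels_boundary _ _ Lq). destruct (height_spec _ Lq) as [Rp _].
  pose proof (domain_nonneg L _ _ Rp) as [K|K]; [|symmetry; exact K]. lra.
Qed.

Lemma preimage_levels_rel_open O : rel_open 0 O ->
  rel_open 0 (fun p => region p /\ O (to_levels p)).
Proof.
  intros HO. apply (rel_open_preimage 0 0 region O fst h); auto using region_rel_open, cont_fst.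
  - apply smooth_cont, (lc_smooth L).
  - intros [s y] Rp. apply (h_bounds L), Rp.
Qed.

(** Where the displacement is defined: a point and its image under [F] both have
    a time. *)
Definition returns (q : R * R) : Prop :=
  D q /\ region (F (fst q, hgt q)) /\ D (to_levels (F (fst q, hgt q))).

Lemma D_region q : D q -> region (fst q, hgt q) /\ h (fst q, hgt q) = snd q.
Proof. intros Dq. apply height_spec, (flow_domain_levels s0), Dq. Qed.

Lemma returns_rel_open : rel_open 0 returns.
Proof.
  assert (Im : forall q, D q -> set_union V J (fst q, hgt q)).
  { intros q Dq. apply region_V, D_region, Dq. }
  assert (Ch : cont D hgt).
  { apply (cont_sub (levels region h)); [apply (flow_domain_levels s0)|].
    apply smooth_cont, (height_smooth L). }
  destruct F_cont as [C1 C2].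
  apply (rel_open_equiv 0 (fun q => D q /\ (fun p => region p /\ D (to_levels p))
    (fst (F (fst q, hgt q)), snd (F (fst q, hgt q))))).
  { intros q. rewrite <- surjective_pairing. unfold returns. tauto. }
  apply (rel_open_preimage 0 0 D (fun p => region p /\ D (to_levels p))
    (fun q => fst (F (fst q, hgt q))) (fun q => snd (F (fst q, hgt q)))).
  - apply (flow_domain_rel_open L).
  - apply preimage_levels_rel_open, (flow_domain_rel_open L).
  - apply (cont_comp (set_union V J) (fun p => fst (F p)) D fst hgt); auto using cont_fst.
  - apply (cont_comp (set_union V J) (fun p => snd (F p)) D fst hgt); auto using cont_fst.
  - intros q Dq. apply (bl_range _ _ _ _ _ HF), Im, Dq.
Qed.

(** [F] preserves [h] and the form [dT dh], so it translates [T] along each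
    level; this is the amount. *)
Definition displacement (q : R * R) : R := T (to_levels (F (fst q, hgt q))) - T q.

(** A map that preserves the area and [h] sends the Hamiltonian vector
    [(h2, -h1)] at [p] to the one at [F p]; this is the first coordinate of that
    relation. *)
Lemma F_hamiltonian f1 f2 p : V p -> region p -> region (F p) ->
  has_partials V (fun p => fst (F p)) f1 f2 ->
  h2 p * f1 p - h1 p * f2 p = h2 (F p).
Proof.
  intros Vp Rp RFp P1.
  pose proof (proj2 (proj1 (bl_diffeo _ _ _ _ _ HF))) as S2.
  apply Ck_on_S in S2. destruct S2 as [_ [g1 [g2 [P2 _]]]].
  destruct (P1 p Vp) as [P11 P12]. destruct (P2 p Vp) as [P21 P22].
  assert (E : f1 p * g2 p - f2 p * g1 p = 1).
  { destruct (bl_area _ _ _ _ _ HF p Vp) as [a' [b' [c' [d' [Q1 [Q2 [Q3 [Q4 E]]]]]]]].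
    apply is_partial1_on_pd1 in Q1; trivial. apply is_partial2_on_pd2 in Q2; trivial.
    apply is_partial1_on_pd1 in Q3; trivial. apply is_partial2_on_pd2 in Q4; trivial.
    rewrite (pd1_unique 0 V _ _ _ _ V_rel_open Vp P11 Q1).
    rewrite (pd2_unique 0 V _ _ _ _ V_rel_open Vp P12 Q2).
    rewrite (pd1_unique 0 V _ _ _ _ V_rel_open Vp P21 Q3).
    rewrite (pd2_unique 0 V _ _ _ _ V_rel_open Vp P22 Q4). exact E. }
  (* [h o F = h] is differentiated on the open set [N]. *)
  set (N := fun p => (region p /\ V p) /\ region (fst (F p), snd (F p))).
  assert (HN : rel_open 0 N).
  { destruct F_cont as [C1 C2]. apply (rel_open_preimage 0 0 (fun p => region p /\ V p) region
      (fun q => fst (F q)) (fun q => snd (F q))).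
    - apply rel_open_and; [apply region_rel_open|apply V_rel_open].
    - apply region_rel_open.
    - apply (cont_sub (set_union V J)); [intros q Hq; left; apply Hq|exact C1].
    - apply (cont_sub (set_union V J)); [intros q Hq; left; apply Hq|exact C2].
    - intros q Hq. apply (bl_range _ _ _ _ _ HF). left; apply Hq. }
  assert (Np : N p) by (split; [split; assumption|rewrite <- surjective_pairing; exact RFp]).
  assert (EF : forall q, N q -> h (fst (F q), snd (F q)) = h q).
  { intros q [[Rq _] RFq]. rewrite <- surjective_pairing in *. apply h_F; assumption. }
  assert (Dh : diffat region h (fst (F p), snd (F p)) (h1 (F p)) (h2 (F p))).
  { rewrite <- surjective_pairing.
    apply (smooth_diffat 0); [apply region_rel_open|apply (lc_partials L)
      |apply (lc_smooth1 L)|apply (lc_smooth2 L)|exact RFp]. }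
  assert (Im : forall q, N q -> region (fst (F q), snd (F q))) by (intros q Hq; apply Hq).
  assert (NV : forall q, N q -> V q) by (intros q Hq; apply Hq).
  destruct (has_partials_sub _ _ _ _ _ NV P1 p Np) as [N11 N12].
  destruct (has_partials_sub _ _ _ _ _ NV P2 p Np) as [N21 N22].
  pose proof (pd1_comp region h N (fun p => fst (F p)) (fun p => snd (F p)) p _ _ _ _ Im Dh N11 N21) as K1.
  pose proof (pd2_comp region h N (fun p => fst (F p)) (fun p => snd (F p)) p _ _ _ _ Im Dh N12 N22) as K2.
  assert (NR : forall q, N q -> region q) by (intros q Hq; apply Hq).
  assert (KP : has_partials N (fun q => h (fst (F q), snd (F q))) h1 h2).
  { apply (has_partials_ext N h); [intros q Nq; symmetry; apply EF, Nq|].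
    exact (has_partials_sub _ _ _ _ _ NR (lc_partials L)). }
  destruct (KP p Np) as [Kh1 Kh2].
  rewrite (pd1_unique 0 N _ _ _ _ HN Np Kh1 K1), (pd2_unique 0 N _ _ _ _ HN Np Kh2 K2).
  transitivity (h2 (F p) * (f1 p * g2 p - f2 p * g1 p)); [ring|rewrite E; ring].
Qed.

(** Along a level, [T] grows at unit rate in the Hamiltonian direction, both at
    a point and at its image. *)
Lemma displacement_der s x : 0 < x -> returns (s, x) ->
  der (fun t => returns (t, x)) (fun t => displacement (t, x)) s 0.
Proof.
  intros Hx Rq.
  assert (Pt : forall t, returns (t, x) -> V (t, hgt (t, x)) /\ region (t, hgt (t, x)) /\
    h (t, hgt (t, x)) = x /\ region (F (t, hgt (t, x))) /\ h (F (t, hgt (t, x))) = x /\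
    D (fst (F (t, hgt (t, x))), x)).
  { intros t [Dt [RF DF]]. destruct (D_region _ Dt) as [Rt Et]. simpl in *.
    assert (Hh : h (F (t, hgt (t, x))) = x) by (rewrite h_F; assumption).
    refine (conj _ (conj Rt (conj Et (conj RF (conj Hh _))))).
    - apply region_V_pos; [exact Rt|]. simpl.
      apply to_levels_boundary; [apply (flow_domain_levels s0), Dt|exact Hx].
    - unfold to_levels in DF. rewrite Hh in DF. exact DF. }
  destruct (Pt s Rq) as [Vp [Rp [Ep [RFp [EFp DFp]]]]].
  set (p := (s, hgt (s, x))) in *.
  pose proof (proj1 (proj1 (bl_diffeo _ _ _ _ _ HF))) as S1.
  apply Ck_on_S in S1. destruct S1 as [_ [f1 [f2 [P1 [C1 C2]]]]].
  pose proof (F_hamiltonian f1 f2 p Vp Rp RFp P1) as Ham.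
  pose proof (lc_pos L p Rp) as Pos. pose proof (lc_pos L _ RFp) as PosF.
  destruct (time_partials L s0) as [T2 [_ PT]].
  destruct (PT _ DFp) as [PTF _]. destruct (PT _ (proj1 Rq)) as [PTs _].
  assert (Dens : density region h h2 (fst (F p), x) = / h2 (F p)).
  { unfold density; simpl.
    assert (E : hgt (fst (F p), h (F p)) = snd (F p)).
    { clear -RFp HF HU Sh Ph Sh1 Sh2 h_bd h2_pos. destruct (F p) as [u v]. apply (height_h L), RFp. }
    rewrite EFp in E. rewrite E, <- surjective_pairing. reflexivity. }
  rewrite Dens in PTF. change (density region h h2 (s, x)) with (/ h2 p) in PTs.
  apply (der_eq _ _ _ (/ h2 (F p) * (f1 p * 1 + f2 p * (- h1 p / h2 p)) - / h2 p)).
  { rewrite <- Ham. field. split; [lra|]. rewrite Ham. lra. }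
  unfold displacement.
  apply (der_minus _ (fun t => T (to_levels (F (t, hgt (t, x))))) (fun t => T (t, x))).
  2: { apply (der_sub (fun t => D (t, x))); [intros t Ht; apply Ht|exact PTs]. }
  apply (der_ext _ (fun t => T (fst (F (t, hgt (t, x))), x))); [exact Rq| |].
  { intros t Ht. unfold to_levels. destruct (Pt t Ht) as [_ [_ [_ [_ [E _]]]]].
    rewrite E. reflexivity. }
  apply (der_comp (fun u => D (u, x)) (fun u => T (u, x)) _ (fun t => fst (F (t, hgt (t, x))))).
  - intros t Ht. apply (Pt t Ht).
  - exact PTF.
  - apply (der_chain V (fun p => fst (F p)) _ (fun t => t) (fun t => hgt (t, x))).
    + intros t Ht. apply (Pt t Ht).
    + apply (diffat_of_partials 0 V (fun p => fst (F p)) f1 f2 p);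
        [exact V_rel_open|exact P1|apply (Ck_on_cont _ _ _ C1)|apply (Ck_on_cont _ _ _ C2)|exact Vp].
    + exact (der_id _ s).
    + apply (der_sub (fun t => levels region h (t, x))).
      * intros t Ht. apply (flow_domain_levels s0), Ht.
      * apply (height_partials L (s, x)). apply (flow_domain_levels s0), Rq.
Qed.

Definition core : R * R -> Prop := hull s0 returns.

(** The displacement has derivative zero along the connected slices of the
    hull. *)
Lemma displacement_const s x : core (s, x) -> displacement (s, x) = displacement (s0, x).
Proof.
  intros Cq. pose proof (proj1 Cq) as [Hx|Hx]; simpl in Hx.
  - destruct (der_mean_value (fun t => returns (t, x)) (fun t => displacement (t, x))
      (fun _ => 0) s0 s) as [c [_ E]]; [|lra].
    intros t Ht. assert (Rt : returns (t, x)) by (apply (proj2 Cq); simpl; [exact Ht|lra]).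
    split; [exact Rt|apply displacement_der; assumption].
  - subst x.
    assert (Z : forall t, seg s0 s t -> displacement (t, 0) = 0).
    { intros t Ht. assert (Rt : returns (t, 0)) by (apply (proj2 Cq); simpl; [exact Ht|lra]).
      destruct (D_region _ (proj1 Rt)) as [Rp _]. simpl in Rp.
      unfold displacement. simpl. rewrite height_0 in * by (apply (flow_domain_levels s0), Rt).
      rewrite (bl_fix _ _ _ _ _ HF) by (apply (region_bd _ Rp)).
      unfold to_levels. simpl. rewrite h_bd by (apply (region_bd _ Rp)). ring. }
    rewrite !Z; auto using seg_l, seg_r.
Qed.

Lemma J_seg s t : J (s, 0) -> seg s0 s t -> J (t, 0).
Proof.
  intros [H1 [H2 _]] [K1 K2]. destruct Hs0 as [H3 [H4 _]]. simpl in *.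
  split; [|split]; simpl; trivial.
  - apply (Rbar_lt_le_trans a (Finite (Rmin s0 s)) (Finite t)); [|exact K1]. apply Rmin_case; assumption.
  - apply (Rbar_le_lt_trans (Finite t) (Finite (Rmax s0 s)) b); [exact K2|]. apply Rmax_case; assumption.
Qed.

Lemma core_rel_open : rel_open 0 core.
Proof. apply hull_rel_open, returns_rel_open. Qed.

Lemma core_returns q : core q -> returns q.
Proof. apply hull_sub. Qed.

Lemma D_J s : J (s, 0) -> D (s, 0).
Proof.
  intros Hs. split; [apply Rle_refl|]. intros t x Ht Hx. simpl in Ht, Hx.
  assert (Jt : J (t, 0)) by (apply (J_seg s); assumption).
  replace x with 0 by lra. exists 0. split; [apply region_J, Jt|apply h_bd, Jt].
Qed.

Lemma core_J s : J (s, 0) -> core (s, 0).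
Proof.
  intros Hs. split; [apply Rle_refl|]. intros t x Ht Hx. simpl in Ht, Hx.
  assert (Jt : J (t, 0)) by (apply (J_seg s); assumption).
  replace x with 0 by lra. pose proof (D_J t Jt) as Dt.
  unfold returns. simpl. rewrite height_0 by (apply (flow_domain_levels s0), Dt).
  rewrite (bl_fix _ _ _ _ _ HF) by exact Jt.
  split; [exact Dt|]. split; [apply region_J, Jt|].
  unfold to_levels; simpl. rewrite h_bd by exact Jt. exact Dt.
Qed.

(** ** The displacement is odd in z *)

Context {W : R * R -> Prop} {beta : R * R -> R * R}.
Hypothesis HB : lifting_involution None a b V F w W beta.

Local Notation beta1 := (fun p => fst (beta p)).
Local Notation beta2 := (fun p => snd (beta p)).

(** The lifting of [F] is [beta] followed by [z |-> -z], and the latter is not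
    seen by [y = z^2]. *)
Lemma F_beta p : W p -> 0 <= snd p -> region (fst p, snd p ^ 2) ->
  F (fst p, snd p ^ 2) = (fst (beta p), snd (beta p) ^ 2).
Proof.
  intros Wp Hp Rp.
  assert (Dom : set_union (lift_set V) J p).
  { destruct Hp as [Hp|Hp].
    - left. split; [exact Hp|]. apply region_V_pos; [exact Rp|]. apply pow_lt, Hp.
    - right. apply region_bd in Rp. destruct p as [s z]. simpl in *. subst z. exact Rp. }
  pose proof (li_factor _ _ _ _ _ _ _ _ HB p Wp Dom) as E.
  pose proof (f_equal fst E) as E1. pose proof (f_equal snd E) as E2.
  unfold lifting, involI in E1, E2. cbn [fst snd] in E1, E2.
  rewrite (surjective_pairing (F _)), E1. f_equal.
  replace (snd (beta p) ^ 2) with ((- snd (beta p)) * (- snd (beta p))) by ring.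
  rewrite <- E2, sqrt_sqrt; [reflexivity|].
  apply (bl_range _ _ _ _ _ HF), region_V, Rp.
Qed.

(** The displacement with [beta] in the place of [F], which makes sense for both
    signs of [z = +- sqrt y]. *)
Definition signed_displacement (z : R) : R :=
  T (to_levels (fst (beta (s0, z)), snd (beta (s0, z)) ^ 2)) - T (to_levels (s0, z ^ 2)).

Lemma signed_displacement_nonneg z : W (s0, z) -> 0 <= z -> region (s0, z ^ 2) ->
  signed_displacement z = displacement (to_levels (s0, z ^ 2)).
Proof.
  intros Wz Hz Rz. unfold signed_displacement, displacement.
  change (fst (to_levels (s0, z ^ 2)), hgt (to_levels (s0, z ^ 2)))
    with (s0, hgt (s0, h (s0, z ^ 2))).
  rewrite (height_h L) by exact Rz.
  pose proof (F_beta (s0, z) Wz Hz Rz) as E. cbn [fst snd] in E.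
  rewrite E. reflexivity.
Qed.

(** For [z < 0] the involution exchanges the roles of a point and its image,
    which reverses the displacement. *)
Lemma signed_displacement_neg z : W (s0, z) -> 0 < snd (beta (s0, z)) -> region (s0, z ^ 2) ->
  region (fst (beta (s0, z)), snd (beta (s0, z)) ^ 2) ->
  core (to_levels (fst (beta (s0, z)), snd (beta (s0, z)) ^ 2)) ->
  signed_displacement z = - displacement (to_levels (s0, z ^ 2)).
Proof.
  intros Wz Hz Rz Rb Cb.
  pose proof (F_beta (beta (s0, z)) (li_stable _ _ _ _ _ _ _ _ HB _ Wz) (Rlt_le _ _ Hz) Rb) as E.
  rewrite (li_invol _ _ _ _ _ _ _ _ HB _ Wz) in E. cbn [fst snd] in E.
  set (q := (fst (beta (s0, z)), snd (beta (s0, z)) ^ 2)) in *.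
  assert (Eh : h q = h (s0, z ^ 2)) by (rewrite <- E; symmetry; apply h_F; [exact Rb|rewrite E; exact Rz]).
  assert (Ed : displacement (to_levels q) = displacement (to_levels (s0, z ^ 2))).
  { unfold to_levels in *. rewrite displacement_const by exact Cb. rewrite Eh. reflexivity. }
  rewrite <- Ed. unfold signed_displacement. fold q. unfold displacement.
  replace (fst (to_levels q), hgt (to_levels q)) with q.
  - rewrite E. ring.
  - unfold to_levels; simpl fst. rewrite (surjective_pairing q) at 1. f_equal.
    symmetry. change (h q) with (h (fst q, snd q)). apply (height_h L), Rb.
Qed.

Lemma beta_cont : cont W beta1 /\ cont W beta2.
Proof.
  destruct (li_smooth _ _ _ _ _ _ _ _ HB) as [S1 S2]. split; apply smooth_cont; assumption.
Qed.

Lemma beta_nbhd Q : rel_open 0 Q -> Q (s0, 0) -> exists e, 0 < e /\ forall z, around e z ->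
  W (s0, z) /\ region (s0, z ^ 2) /\ Q (to_levels (s0, z ^ 2)) /\
  region (fst (beta (s0, z)), snd (beta (s0, z)) ^ 2) /\
  Q (to_levels (fst (beta (s0, z)), snd (beta (s0, z)) ^ 2)).
Proof.
  intros HQ Q0. set (O := fun p => region p /\ Q (to_levels p)).
  assert (HO : rel_open 0 O) by (apply preimage_levels_rel_open, HQ).
  assert (HW : rel_open m_infty W) by (apply open_rel_open, (li_open _ _ _ _ _ _ _ _ HB)).
  assert (O0 : O (s0, 0)).
  { split; [apply region_J, Hs0|]. unfold to_levels. simpl. rewrite h_bd by exact Hs0. exact Q0. }
  destruct beta_cont as [C1 C2].
  assert (Z1 : rel_open m_infty (fun p => W p /\ O (fst (beta p), snd (beta p) ^ 2))).
  { apply (rel_open_preimage m_infty 0 W O beta1 (fun p => snd (beta p) ^ 2)); auto.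
    - apply smooth_cont, smooth_pow, (li_smooth _ _ _ _ _ _ _ _ HB).
    - intros p _. simpl. nra. }
  assert (Z2 : rel_open m_infty (fun p => True /\ O (fst p, snd p ^ 2))).
  { apply (rel_open_preimage m_infty 0 (fun _ => True) O fst (fun p => snd p ^ 2));
      auto using rel_open_total, cont_fst.
    - apply smooth_cont, smooth_pow, smooth_snd.
    - intros p _. simpl. nra. }
  destruct (rel_open_and _ _ _ Z1 Z2 (s0, 0)) as [_ [e [He K]]].
  { rewrite (li_fix _ _ _ _ _ _ _ _ HB) by exact Hs0. simpl. rewrite Rmult_0_l.
    split; split; trivial. apply (li_nbhd _ _ _ _ _ _ _ _ HB), Hs0. }
  exists e. split; [exact He|]. intros z Hz.
  destruct (K (s0, z)) as [[Wz [Rb Qb]] [_ [Rz Qz]]]; [|exact I|auto].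
  split; simpl; [rewrite Rminus_diag, Rabs_R0; exact He|]. rewrite Rminus_0_r.
  apply Rabs_def1; apply Hz.
Qed.

Lemma signed_displacement_smooth e : (forall z, around e z ->
  W (s0, z) /\ region (s0, z ^ 2) /\ D (to_levels (s0, z ^ 2)) /\
  region (fst (beta (s0, z)), snd (beta (s0, z)) ^ 2) /\
  D (to_levels (fst (beta (s0, z)), snd (beta (s0, z)) ^ 2))) ->
  smooth1 (around e) signed_displacement.
Proof.
  intros H.
  assert (HW : rel_open m_infty W) by (apply open_rel_open, (li_open _ _ _ _ _ _ _ _ HB)).
  destruct (li_smooth _ _ _ _ _ _ _ _ HB) as [S1 S2].
  assert (Sc : forall u v : R * R -> R, smooth (strip (around e)) u -> smooth (strip (around e)) v ->
    (forall p, strip (around e) p -> region (u p, v p) /\ D (to_levels (u p, v p))) ->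
    smooth (strip (around e)) (fun p => T (to_levels (u p, v p)))).
  { intros u v Su Sv Im.
    apply (smooth_comp 0 D T _ u (fun p => h (u p, v p))); trivial.
    - apply (flow_domain_rel_open L).
    - intros p Hp. apply (Im p Hp).
    - apply (time_smooth L).
    - apply (smooth_comp 0 region h); trivial; [apply region_rel_open| |apply (lc_smooth L)].
      intros p Hp. apply (Im p Hp). }
  assert (Sb : forall k, smooth W k -> smooth (strip (around e)) (fun p => k (s0, snd p))).
  { intros k Sk. apply (smooth_comp m_infty W k _ (fun _ => s0) snd); trivial.
    - intros p Hp. apply (H _ Hp).
    - apply smooth_const.
    - apply smooth_snd. }
  apply (smooth_minus _ (fun p => T (to_levels (fst (beta (s0, snd p)), snd (beta (s0, snd p)) ^ 2)))
    (fun p => T (to_levels (s0, snd p ^ 2)))).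
  - apply (Sc (fun p => fst (beta (s0, snd p))) (fun p => snd (beta (s0, snd p)) ^ 2)).
    + apply (Sb beta1), S1.
    + apply smooth_pow, (Sb beta2), S2.
    + intros p Hp. split; apply (H _ Hp).
  - apply (Sc (fun _ => s0) (fun p => snd p ^ 2)).
    + apply smooth_const.
    + apply smooth_pow, smooth_snd.
    + intros p Hp. split; apply (H _ Hp).
Qed.

(** An odd smooth function of [z] is [z] times a smooth function of [z^2].  The
    second factor is bounded below near [0] because [w] and the density are
    positive. *)
Lemma displacement_profile : exists r K, 0 < r /\ smooth1 (initial r) K /\
  forall y, initial r y -> 0 < K y /\ region (s0, y) /\ core (s0, h (s0, y)) /\
    displacement (s0, h (s0, y)) = sqrt y * K y.
Proof.
  assert (L0 : levels region h (s0, 0)) by (apply (flow_domain_levels s0), D_J, Hs0).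
  pose proof (density_pos L _ L0) as Hm. set (m := density region h h2 (s0, 0)) in *.
  destruct (smooth_cont _ _ (density_smooth L) _ L0 (m / 2)) as [d [Hd Kd]]; [lra|].
  fold m in Kd.
  destruct (beta_nbhd (fun q => core q /\ near d (s0, 0) q)) as [e1 [He1 H1]].
  { apply rel_open_near, core_rel_open. }
  { split; [apply core_J, Hs0|apply near_refl, Hd]. }
  destruct (li_asymptotics _ _ _ _ _ _ _ _ HB s0 s0) as [C [e2 [He2 H2]]];
    [apply Hs0|apply Rle_refl|apply Hs0|].
  assert (Hw : 0 < w s0) by (apply (bl_w_pos _ _ _ _ _ HF); apply Hs0).
  set (c := Rabs C + 1). assert (Hc : 0 < c) by (unfold c; pose proof (Rabs_pos C); lra).
  set (e := Rmin (Rmin e1 e2) (Rmin (/ (2 * c)) (w s0 / (2 * c)))).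
  assert (He : 0 < e).
  { repeat apply Rmin_pos; trivial; [apply Rinv_0_lt_compat|apply Rdiv_lt_0_compat]; lra. }
  assert (Small : forall z, around e z ->
    around e1 z /\ Rabs z < e2 /\ C * z ^ 2 <= Rabs z / 2 /\ C * z ^ 2 <= w s0 / 2 * Rabs z).
  { intros z Hz. assert (A : Rabs z < e) by (apply Rabs_def1; apply Hz).
    apply Rmin_Rgt_l in A. destruct A as [A1 A2].
    apply Rmin_Rgt_l in A1. destruct A1 as [A1 A3]. apply Rmin_Rgt_l in A2. destruct A2 as [A2 A4].
    apply Rgt_lt, (Rmult_lt_compat_l c) in A2; [|exact Hc].
    apply Rgt_lt, (Rmult_lt_compat_l c) in A4; [|exact Hc].
    replace (c * / (2 * c)) with (/ 2) in A2 by (field; lra).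
    replace (c * (w s0 / (2 * c))) with (w s0 / 2) in A4 by (field; lra).
    assert (B : C * z ^ 2 <= c * Rabs z * Rabs z).
    { rewrite Rmult_assoc, <- Rabs_mult. replace (z * z) with (z ^ 2) by ring.
      rewrite (Rabs_pos_eq (z ^ 2)) by (simpl; nra).
      apply Rmult_le_compat_r; [simpl; nra|]. unfold c. pose proof (Rle_abs C). lra. }
    pose proof (Rabs_pos z). split; [|split; [exact A3|split; nra]].
    apply Rabs_def2 in A1. split; lra. }
  assert (Z : forall z, around e z -> W (s0, z) /\ region (s0, z ^ 2) /\ core (to_levels (s0, z ^ 2)) /\
    region (fst (beta (s0, z)), snd (beta (s0, z)) ^ 2) /\
    core (to_levels (fst (beta (s0, z)), snd (beta (s0, z)) ^ 2)) /\
    near d (s0, 0) (to_levels (s0, z ^ 2)) /\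
    near d (s0, 0) (to_levels (fst (beta (s0, z)), snd (beta (s0, z)) ^ 2))).
  { intros z Hz. destruct (H1 z (proj1 (Small z Hz))) as [Wz [Rz [[Cz Nz] [Rb [Cb Nb]]]]].
    repeat (split; [assumption|]). assumption. }
  assert (Sym : forall z, around e z -> around e (- z)) by (intros z [K1 K2]; split; lra).
  assert (Neg : forall z, around e z -> z < 0 -> signed_displacement z = - displacement (to_levels (s0, z ^ 2))).
  { intros z Hz Nz. destruct (Z z Hz) as [Wz [Rz [_ [Rb [Cb _]]]]].
    apply signed_displacement_neg; trivial.
    destruct (Small z Hz) as [_ [A2 [A3 _]]].
    destruct (H2 s0 z) as [_ B]; [lra|exact A2|exact Wz|].
    rewrite Rabs_left in A3 by exact Nz. apply Rabs_le_between in B. lra. }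
  assert (Pos : forall z, around e z -> 0 <= z -> signed_displacement z = displacement (to_levels (s0, z ^ 2))).
  { intros z Hz Nz. apply signed_displacement_nonneg; trivial; apply (Z z Hz). }
  assert (Zero : signed_displacement 0 = 0).
  { unfold signed_displacement. rewrite (li_fix _ _ _ _ _ _ _ _ HB) by exact Hs0. simpl. ring. }
  assert (Odd : forall z, around e z -> signed_displacement (- z) = - signed_displacement z).
  { intros z Hz. destruct (Rtotal_order z 0) as [Nz|[->|Nz]].
    - rewrite (Neg z Hz Nz), Pos by (auto; lra). replace ((- z) ^ 2) with (z ^ 2) by ring. ring.
    - rewrite Ropp_0, Zero. ring.
    - rewrite (Pos z Hz), Neg by (auto; lra). replace ((- z) ^ 2) with (z ^ 2) by ring. ring. }
  assert (Ss : smooth1 (around e) signed_displacement).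
  { apply signed_displacement_smooth. intros z Hz. destruct (Z z Hz) as [Wz [Rz [Cz [Rb [Cb _]]]]].
    repeat (split; [first [assumption|apply core_returns; assumption]|]). apply core_returns, Cb. }
  destruct (hadamard_division e signed_displacement Ss Zero) as [E [SE HE]].
  assert (EvE : forall z, around e z -> E (- z) = E z).
  { intros z Hz. destruct (Req_dec z 0) as [->|N]; [rewrite Ropp_0; reflexivity|].
    apply (Rmult_eq_reg_l (- z)); [|lra]. rewrite <- HE, Odd, HE by auto. ring. }
  set (k := m * w s0 / 4). assert (Hk : 0 < k) by (unfold k; nra).
  assert (Low : forall z, around e z -> 0 < z -> k <= E z).
  { intros z Hz Pz. destruct (Z z Hz) as [Wz [Rz [Cz [Rb [Cb [Nz Nb]]]]]].
    destruct (Small z Hz) as [_ [A2 [_ A4]]].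
    destruct (H2 s0 z) as [B _]; [lra|exact A2|exact Wz|].
    rewrite (Rabs_pos_eq z) in A4 by lra. apply Rabs_le_between in B.
    pose proof (F_beta (s0, z) Wz (Rlt_le _ _ Pz) Rz) as EF. cbn [fst snd] in EF.
    assert (Eh : h (fst (beta (s0, z)), snd (beta (s0, z)) ^ 2) = h (s0, z ^ 2))
      by (rewrite <- EF; apply h_F; [exact Rz|rewrite EF; exact Rb]).
    unfold to_levels in Cb, Cz, Nz, Nb. rewrite Eh in Cb, Nb. cbn [fst snd] in *.
    destruct (time_mean_value L s0 s0 (fst (beta (s0, z))) (h (s0, z ^ 2))) as [t [Ht [Dt Et]]];
      [apply core_returns, Cz|apply core_returns, Cb|].
    assert (Nt : near d (s0, 0) (t, h (s0, z ^ 2))).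
    { destruct Nb as [N1 N2]. apply seg_Rabs in Ht. split; cbn [fst snd] in *; [lra|exact N2]. }
    specialize (Kd _ (flow_domain_levels _ _ Dt) Nt). apply Rabs_def2 in Kd.
    apply (Rmult_le_reg_l z); [exact Pz|]. rewrite <- HE by exact Hz.
    unfold signed_displacement, to_levels. cbn [fst snd]. rewrite Eh, Et. unfold k.
    apply Rle_trans with (m / 2 * (w s0 / 2 * z)); [right; field|].
    apply Rmult_le_compat; nra. }
  assert (A0 : around e 0) by (split; lra).
  assert (Low0 : k <= E 0).
  { destruct (Rle_lt_dec k (E 0)) as [K|K]; [exact K|exfalso].
    destruct (smooth1_cont _ _ 0 SE A0 (k - E 0)) as [d' [Hd' Q]]; [lra|].
    pose proof (Rmin_pos _ _ He Hd'). pose proof (Rmin_l e d'). pose proof (Rmin_r e d').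
    assert (At : around e (Rmin e d' / 2)) by (split; lra).
    specialize (Q _ At ltac:(rewrite Rminus_0_r, Rabs_pos_eq; lra)).
    pose proof (Low _ At ltac:(lra)). apply Rabs_def2 in Q. lra. }
  exists (e * e), (fun y => E (sqrt y)). split; [nra|]. split.
  - apply even_sqrt_smooth; assumption.
  - intros y [Hy Hy'].
    assert (Ay : around e (sqrt y)).
    { pose proof (sqrt_pos y). split; [lra|]. rewrite <- (sqrt_square e) by lra.
      apply sqrt_lt_1_alt; lra. }
    assert (Ey : sqrt y ^ 2 = y) by (simpl; rewrite Rmult_1_r; apply sqrt_sqrt, Hy).
    pose proof (sqrt_pos y) as Sy.
    destruct (Z _ Ay) as [_ [Ry [Cy _]]]. rewrite Ey in Ry, Cy.
    split; [|split; [exact Ry|split; [exact Cy|]]].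
    + destruct Sy as [Sy|Sy]; [specialize (Low _ Ay Sy); lra|rewrite <- Sy; lra].
    + rewrite <- HE by exact Ay. rewrite Pos, Ey by assumption. reflexivity.
Qed.


(** * Normalisation of the level function *)

(** With [y] the height on the line [s = s0], where [dh = h2 dy], the equation
    [sqrt chi dchi = displacement dh] becomes [sqrt X dX = sqrt y K h2 dy]. *)
Lemma level_change : exists r chi chi', 0 < r /\ smooth1 (initial r) chi /\ smooth1 (initial r) chi' /\
  (forall x, initial r x -> der (initial r) chi x (chi' x)) /\ chi 0 = 0 /\
  (forall x, initial r x -> 0 < chi' x) /\
  (forall x, initial r x -> sqrt (chi x) * chi' x = displacement (s0, x)).
Proof.
  destruct displacement_profile as [r0 [K [Hr0 [SK HK]]]].
  assert (SM : smooth1 (initial r0) (fun y => K y * h2 (s0, y))).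
  { apply smooth1_mult; [exact SK|].
    apply (smooth_comp 0 region h2 _ (fun _ => s0) snd).
    - apply region_rel_open.
    - intros p Hp. apply (HK _ Hp).
    - apply (lc_smooth2 L).
    - apply smooth_const.
    - apply smooth_snd. }
  destruct (sqrt_primitive r0 _ SM) as [X [X' [SX [SX' [DX [X0 [PX EX]]]]]]].
  { intros y Hy. destruct (HK y Hy) as [Ky [Ry _]].
    apply Rmult_lt_0_compat; [exact Ky|apply (lc_pos L), Ry]. }
  (* On a slightly smaller interval of levels the height stays below [r0]. *)
  assert (Hy : initial r0 (r0 / 2)) by (split; lra).
  destruct (HK _ Hy) as [_ [Ry [Cy _]]].
  set (r := h (s0, r0 / 2)) in *.
  assert (Hr : 0 < r) by (apply (h_bounds L _ _ Ry); lra).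
  assert (Lev : forall x, initial r x -> levels region h (s0, x)).
  { intros x [Hx Hx']. apply (flow_domain_levels s0), (proj2 Cy); [apply seg_r|simpl; lra]. }
  assert (Hgt : forall x, initial r x -> region (s0, hgt (s0, x)) /\ h (s0, hgt (s0, x)) = x /\
    initial r0 (hgt (s0, x))).
  { intros x Hx. destruct (height_spec _ (Lev x Hx)) as [Rx Ex]. cbn [fst snd] in *.
    split; [exact Rx|]. split; [exact Ex|]. split; [apply (domain_nonneg L _ _ Rx)|].
    destruct (Rlt_le_dec (hgt (s0, x)) (r0 / 2)) as [Lt|[Lt|E]]; [lra| |].
    - pose proof (h_increasing L _ _ _ Ry Rx Lt). destruct Hx. fold r in H. lra.
    - rewrite <- E in Ex. fold r in Ex. destruct Hx. lra. }
  assert (Shgt : smooth (strip (initial r)) (fun p => hgt (s0, snd p))).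
  { apply (smooth_comp 0 (levels region h) hgt _ (fun _ => s0) snd).
    - apply (levels_rel_open L).
    - intros p Hp. apply Lev, Hp.
    - apply (height_smooth L).
    - apply smooth_const.
    - apply smooth_snd. }
  assert (Im : forall p, strip (initial r) p -> initial r0 (hgt (s0, snd p)))
    by (intros p Hp; apply (Hgt _ Hp)).
  exists r, (fun x => X (hgt (s0, x))), (fun x => X' (hgt (s0, x)) * density region h h2 (s0, x)).
  split; [exact Hr|]. split; [|split; [|split; [|split; [|split]]]].
  - apply (smooth1_comp 0 (initial r0) X _ (fun p => hgt (s0, snd p))); auto using initial_rel_open.
  - apply smooth_mult.
    + apply (smooth1_comp 0 (initial r0) X' _ (fun p => hgt (s0, snd p))); auto using initial_rel_open.
    + apply (smooth_comp 0 (levels region h) (density region h h2) _ (fun _ => s0) snd).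
      * apply (levels_rel_open L).
      * intros p Hp. apply Lev, Hp.
      * apply (density_smooth L).
      * apply smooth_const.
      * apply smooth_snd.
  - intros x Hx. destruct (Hgt x Hx) as [_ [_ Hx0]].
    apply (der_comp (initial r0) X _ (fun x => hgt (s0, x))).
    + intros t Ht. apply (Hgt t Ht).
    + apply DX, Hx0.
    + apply (der_sub (fun t => levels region h (s0, t))); [exact Lev|].
      apply (height_partials L (s0, x)), Lev, Hx.
  - rewrite height_0; [exact X0|]. apply Lev. split; lra.
  - intros x Hx. destruct (Hgt x Hx) as [_ [_ Hx0]].
    apply Rmult_lt_0_compat; [apply PX, Hx0|apply (density_pos L), Lev, Hx].
  - intros x Hx. destruct (Hgt x Hx) as [Rx [Ex Hx0]].
    rewrite <- Rmult_assoc, EX by exact Hx0. unfold density. cbn [fst snd].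
    destruct (HK _ Hx0) as [_ [_ [_ E]]]. rewrite Ex in E. rewrite E.
    pose proof (lc_pos L _ Rx). field. lra.
Qed.

(** * The domain of the coordinates *)

Section Coordinates.

Context {r : R} {chi chi' : R -> R}.

Hypothesis Hr : 0 < r.
Hypothesis Schi : smooth1 (initial r) chi.
Hypothesis Schi' : smooth1 (initial r) chi'.
Hypothesis Dchi : forall x, initial r x -> der (initial r) chi x (chi' x).
Hypothesis Pchi : forall x, initial r x -> 0 < chi' x.
Hypothesis Echi : forall x, initial r x -> sqrt (chi x) * chi' x = displacement (s0, x).

Definition chart_levels (q : R * R) : Prop := core q /\ strip (initial r) q.

Definition chart (p : R * R) : Prop := region p /\ chart_levels (to_levels p).

Definition chart_interior (p : R * R) : Prop := chart p /\ 0 < snd p.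

Lemma chart_levels_rel_open : rel_open 0 chart_levels.
Proof. apply rel_open_and; [apply core_rel_open|apply initial_rel_open]. Qed.

Lemma chart_levels_D q : chart_levels q -> D q.
Proof. intros [Cq _]. apply core_returns, Cq. Qed.

Lemma chart_rel_open : rel_open 0 chart.
Proof. apply preimage_levels_rel_open, chart_levels_rel_open. Qed.

Lemma chart_J p : J p -> chart p.
Proof.
  destruct p as [s y]. intros Jp. pose proof Jp as [_ [_ E]]. simpl in E. subst y.
  split; [apply region_J, Jp|]. unfold to_levels, chart_levels, strip. cbn [fst snd].
  rewrite h_bd by exact Jp. split; [apply core_J, Jp|]. split; lra.
Qed.

Lemma chart_union p : set_union chart_interior J p <-> chart p.
Proof.
  split.
  - intros [[Cp _]|Jp]; [exact Cp|apply chart_J, Jp].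
  - intros Cp. destruct (region_cases p (proj1 Cp)) as [[_ [_ Hp]]|[Jp _]]; [left|right]; trivial.
    split; assumption.
Qed.

Lemma chart_column s y t : chart (s, y) -> 0 <= t <= y -> chart (s, t).
Proof.
  intros [Rp [[Hx C] [H0 H1]]] Ht. unfold to_levels in *. cbn [fst snd] in *.
  assert (Rt : region (s, t)) by (apply (column_down _ _ y); assumption).
  assert (Hh : 0 <= h (s, t) <= h (s, y)).
  { split; [apply (h_bounds L), Rt|]. destruct (proj2 Ht) as [Lt| ->]; [|apply Rle_refl].
    left. apply (h_increasing L); assumption. }
  split; [exact Rt|]. unfold to_levels, chart_levels, strip. cbn [fst snd].
  split; [|split; lra]. split; [apply Hh|]. cbn [fst snd].
  intros u v Hu Hv. apply C; [exact Hu|lra].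
Qed.

Lemma chart_interior_connected : connected_set chart_interior.
Proof.
  intros P Q HP HQ Cov [p [Up Pp]] [q [Uq Qq]]. apply NNPP. intros None.
  assert (Dis : forall x, chart_interior x -> P x -> Q x -> False)
    by (intros x Ux Px Qx; apply None; exists x; auto).
  assert (Mv : forall s y s' y', (forall t, 0 <= t <= 1 ->
      chart_interior (s + t * (s' - s), y + t * (y' - y))) -> P (s, y) -> P (s', y')).
  { intros s y s' y'. apply (segment_same_side chart_interior P Q); assumption. }
  (* From every point one descends to a small height and then moves
     horizontally to the line [s = s0]; which heights are small enough depends
     on the point. *)
  assert (Foot : forall s y, chart_interior (s, y) -> exists e, 0 < e /\ forall z, 0 < z < e ->
      (P (s, y) <-> P (s0, z))).
  { intros s y [Cp Hy]. cbn [snd] in Hy.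
    assert (Js : J (s, 0)) by (apply (region_bd _ (proj1 Cp))).
    destruct (rectangle_nbhd 0 chart s0 s 0 0 chart_rel_open) as [e [He K]].
    { intros t x Ht Hx. apply seg_0 in Hx; [|lra]. replace x with 0 by lra.
      apply chart_J, (J_seg s); assumption. }
    exists (Rmin e y). split; [apply Rmin_pos; assumption|]. intros z Hz.
    pose proof (Rmin_l e y). pose proof (Rmin_r e y).
    assert (Vert : forall t, z <= t <= y -> chart_interior (s, t)).
    { intros t Ht. split; [apply (chart_column s y); [exact Cp|lra]|simpl; lra]. }
    assert (Hor : forall t, seg s0 s t -> chart_interior (t, z)).
    { intros t Ht. split; [|simpl; lra]. apply (K t 0 (t, z)); [exact Ht|apply seg_l| |simpl; lra].
      split; cbn [fst snd]; [rewrite Rminus_diag, Rabs_R0; exact He|].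
      rewrite Rminus_0_r, Rabs_pos_eq; lra. }
    assert (Cvx : forall u v t, 0 <= t <= 1 -> seg u v (u + t * (v - u))).
    { intros u v t Ht. unfold seg, Rmin, Rmax. destruct (Rle_dec u v); split; nra. }
    split; intros PP.
    - apply (Mv s z s0 z).
      + intros t Ht. replace (z + t * (z - z)) with z by ring. apply Hor, seg_sym, Cvx, Ht.
      + apply (Mv s y s z); [|exact PP]. intros t Ht. replace (s + t * (s - s)) with s by ring.
        apply Vert. nra.
    - apply (Mv s z s y).
      + intros t Ht. replace (s + t * (s - s)) with s by ring. apply Vert. nra.
      + apply (Mv s0 z s z); [|exact PP]. intros t Ht. replace (z + t * (z - z)) with z by ring.
        apply Hor, Cvx, Ht. }
  destruct p as [s y], q as [s' y'].
  destruct (Foot s y Up) as [e [He K]]. destruct (Foot s' y' Uq) as [e' [He' K']].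
  pose proof (Rmin_pos _ _ He He'). pose proof (Rmin_l e e'). pose proof (Rmin_r e e').
  apply (Dis (s', y') Uq); [|exact Qq].
  apply (K' (Rmin e e' / 2)); [lra|]. apply (K (Rmin e e' / 2)); [lra|exact Pp].
Qed.

Lemma chart_adjacent_domain : adjacent_domain a b chart_interior.
Proof.
  assert (Near : forall p, J p -> forall d, 0 < d -> exists q, near d p q /\ chart_interior q).
  { intros [s y] Jp d Hd. pose proof (chart_J _ Jp) as Cp.
    destruct (rel_open_upper 0 chart s y chart_rel_open Cp d Hd) as [t [Ht Ct]].
    exists (s, t). split.
    - split; cbn [fst snd]; [rewrite Rminus_diag, Rabs_R0; exact Hd|apply Rabs_def1; lra].
    - split; [exact Ct|]. pose proof (proj1 (chart_rel_open _ Cp)). simpl in *. lra. }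
  split; [split; [|split]|split; [|split]].
  - destruct (Near _ Hs0 1 Rlt_0_1) as [q [_ Uq]]. exists q; exact Uq.
  - apply near_open. intros p [Cp Hp]. destruct (chart_rel_open p Cp) as [_ [d [Hd Q]]].
    exists (Rmin d (snd p)). split; [apply Rmin_pos; assumption|]. intros q N.
    assert (Hq : 0 < snd q).
    { destruct (near_le _ _ _ _ (Rmin_r _ _) N) as [_ N'].
      apply Rabs_def2 in N'. lra. }
    split; [|exact Hq]. apply Q; [|left; exact Hq].
    eapply near_le; [apply Rmin_l|exact N].
  - exact chart_interior_connected.
  - intros p Up; apply Up.
  - intros p Jp P [d Hd]. split.
    + destruct (Near p Jp d (cond_pos d)) as [q [[N1 N2] Uq]]. exists q.
      split; [apply Hd; split; [exact N1|exact N2]|exact Uq].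
    + exists p. split; [apply Hd, ball_center|]. intros [_ Hp]. destruct Jp as [_ [_ E]]. lra.
  - intros p Jp. destruct (chart_rel_open p (chart_J p Jp)) as [_ [d [Hd Q]]].
    exists (mkposreal d Hd). intros q [N1 N2] Lq. apply chart_union, Q; [|exact Lq].
    split; [exact N1|exact N2].
Qed.

(** * The symplectic coordinates *)

(** Division by [chi'] compensates the passage from [h] to [chi h] in the area
    form, and divides the displacement by [chi']. *)
Definition tau (p : R * R) : R := T (to_levels p) * / chi' (h p).

Definition normal_h (p : R * R) : R := chi (h p).

Lemma chart_h p : chart p -> initial r (h p).
Proof. intros Cp; apply Cp. Qed.

Lemma chart_h_smooth : smooth chart h.
Proof. apply (smooth_sub region); [intros p Cp; apply Cp|apply (lc_smooth L)]. Qed.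

Lemma chart_h_partials : has_partials chart h h1 h2.
Proof. apply (has_partials_sub region); [intros p Cp; apply Cp|apply (lc_partials L)]. Qed.

Lemma inv_chi'_smooth : smooth1 (initial r) (fun x => / chi' x).
Proof.
  apply smooth_inv; [|exact Schi']. intros p Hp. pose proof (Pchi _ Hp). lra.
Qed.

Lemma normal_h_smooth : smooth chart normal_h.
Proof.
  apply (smooth1_comp 0 (initial r)); auto using initial_rel_open, chart_h, chart_h_smooth.
Qed.

Lemma tau_smooth : smooth chart tau.
Proof.
  apply smooth_mult.
  - apply (smooth_comp 0 D T chart fst h).
    + apply (flow_domain_rel_open L).
    + intros p Cp. apply chart_levels_D, Cp.
    + apply (time_smooth L).
    + apply smooth_fst.
    + apply chart_h_smooth.
  - apply (smooth1_comp 0 (initial r) (fun x => / chi' x));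
      auto using initial_rel_open, chart_h, chart_h_smooth, inv_chi'_smooth.
Qed.

(** [d tau /\ d chi(h) = dT /\ dh = density ds /\ dh = ds /\ dy]. *)
Lemma coordinates_area t1 t2 k1 k2 p : chart p ->
  has_partials chart tau t1 t2 -> has_partials chart normal_h k1 k2 ->
  t1 p * k2 p - t2 p * k1 p = 1.
Proof.
  intros Cp Pt Pk.
  destruct (time_partials L s0) as [T2 [ST2 PT]].
  destruct (smooth1_der _ _ _ (initial_rel_open r) inv_chi'_smooth) as [k [Dk _]].
  assert (Sd : smooth D (density region h h2)).
  { apply (smooth_sub (levels region h)); [apply flow_domain_levels|apply (density_smooth L)]. }
  assert (PTl : has_partials chart (fun p => T (fst p, h p))
    (fun p => density region h h2 (to_levels p) * 1 + T2 (to_levels p) * h1 p)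
    (fun p => density region h h2 (to_levels p) * 0 + T2 (to_levels p) * h2 p)).
  { intros q Cq. destruct (chart_h_partials q Cq) as [Q1 Q2].
    assert (Im : forall q, chart q -> D (fst q, h q)) by (intros x Cx; apply chart_levels_D, Cx).
    assert (DT : diffat D T (fst q, h q) (density region h h2 (to_levels q)) (T2 (to_levels q)))
      by (apply (smooth_diffat 0);
        [apply (flow_domain_rel_open L)|exact PT|exact Sd|exact ST2|apply Im, Cq]).
    split.
    - apply (pd1_comp D T chart fst h); trivial. exact (der_id _ _).
    - apply (pd2_comp D T chart fst h); trivial. exact (der_const _ (fst q) _). }
  pose proof (has_partials_mult _ _ _ _ _ _ _ PTl
    (has_partials_comp_on _ _ _ _ _ _ _ chart_h_partials chart_h Dk)) as Pt'.
  pose proof (has_partials_comp_on _ _ _ _ _ _ _ chart_h_partials chart_h Dchi) as Pk'.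
  destruct (Pt p Cp) as [A1 A2]. destruct (Pt' p Cp) as [A1' A2'].
  destruct (Pk p Cp) as [B1 B2]. destruct (Pk' p Cp) as [B1' B2'].
  rewrite (pd1_unique 0 _ _ _ _ _ chart_rel_open Cp A1 A1').
  rewrite (pd2_unique 0 _ _ _ _ _ chart_rel_open Cp A2 A2').
  rewrite (pd1_unique 0 _ _ _ _ _ chart_rel_open Cp B1 B1').
  rewrite (pd2_unique 0 _ _ _ _ _ chart_rel_open Cp B2 B2').
  assert (Ed : density region h h2 (to_levels p) = / h2 p).
  { unfold density, to_levels. cbn [fst snd]. destruct p as [s y]. cbn [fst snd].
    rewrite (height_h L) by apply Cp. reflexivity. }
  rewrite Ed. pose proof (lc_pos L p (proj1 Cp)). pose proof (Pchi _ (chart_h p Cp)).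
  field. lra.
Qed.

Lemma chi_increasing x x' : initial r x -> initial r x' -> x < x' -> chi x < chi x'.
Proof.
  intros Hx Hx' Lt.
  destruct (der_mean_value (initial r) chi chi' x x') as [c [Hc E]].
  - intros t Ht. unfold seg in Ht. rewrite Rmin_left, Rmax_right in Ht by lra.
    assert (Rt : initial r t) by (destruct Hx, Hx'; split; lra). split; [exact Rt|apply Dchi, Rt].
  - unfold seg in Hc. rewrite Rmin_left, Rmax_right in Hc by lra.
    assert (Rc : initial r c) by (destruct Hx, Hx'; split; lra).
    pose proof (Pchi c Rc). nra.
Qed.

Lemma chi_injective x x' : initial r x -> initial r x' -> chi x = chi x' -> x = x'.
Proof.
  intros Hx Hx' E. destruct (Rtotal_order x x') as [Lt|[H|Lt]]; trivial.
  - pose proof (chi_increasing _ _ Hx Hx' Lt). lra.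
  - pose proof (chi_increasing _ _ Hx' Hx Lt). lra.
Qed.

Definition slope (q : R * R) : R := T q * / chi' (snd q).

Lemma slope_increasing s s' x : chart_levels (s, x) -> chart_levels (s', x) -> s < s' ->
  slope (s, x) < slope (s', x).
Proof.
  intros Hq Hq' Lt. apply Rmult_lt_compat_r.
  - apply Rinv_0_lt_compat, Pchi, Hq.
  - apply (time_increasing L); auto using chart_levels_D.
Qed.

Lemma slope_injective s s' x : chart_levels (s, x) -> chart_levels (s', x) ->
  slope (s, x) = slope (s', x) -> s = s'.
Proof.
  intros Hq Hq' E. destruct (Rtotal_order s s') as [Lt|[H|Lt]]; trivial.
  - pose proof (slope_increasing _ _ _ Hq Hq' Lt). lra.
  - pose proof (slope_increasing _ _ _ Hq' Hq Lt). lra.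
Qed.

Definition coordinates (p : R * R) : R * R := (tau p, normal_h p).

Definition chart_image (q : R * R) : Prop := exists p, chart p /\ coordinates p = q.

Definition coordinates_inv (q : R * R) : R * R :=
  epsilon (inhabits (0, 0)) (fun p => chart p /\ coordinates p = q).

Lemma coordinates_inv_spec q : chart_image q ->
  chart (coordinates_inv q) /\ tau (coordinates_inv q) = fst q /\ normal_h (coordinates_inv q) = snd q.
Proof.
  intros Hq. destruct (epsilon_spec (inhabits (0, 0)) _ Hq) as [C E].
  fold (coordinates_inv q) in C, E. split; [exact C|].
  split; [exact (f_equal fst E)|exact (f_equal snd E)].
Qed.

(** The three steps (tau, chi(h)) -> (tau, h) -> (s, h) -> (s, y) each invert a
    function that is monotone along the fibres. *)
Lemma coordinates_inv_cont : cont chart_image (fun q => fst (coordinates_inv q)) /\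
  cont chart_image (fun q => snd (coordinates_inv q)).
Proof.
  set (xi := fun q => h (coordinates_inv q)).
  assert (Cxi : cont chart_image xi).
  { apply (vertical_inverse_cont 0 (strip (initial r)) (fun p => chi (snd p))).
    - apply initial_rel_open.
    - apply smooth_cont, Schi.
    - intros s y y'; apply chi_increasing.
    - intros q Hq. destruct (coordinates_inv_spec q Hq) as [C [_ E]].
      split; [apply chart_h, C|exact E]. }
  set (B := fun q => exists s, chart_levels (s, snd q) /\ slope (s, snd q) = fst q).
  set (sigma := fun q => epsilon (inhabits 0)
    (fun s => chart_levels (s, snd q) /\ slope (s, snd q) = fst q)).
  assert (Hsigma : forall q, B q -> chart_levels (sigma q, snd q) /\ slope (sigma q, snd q) = fst q)
    by (intros q Hq; exact (epsilon_spec (inhabits 0) _ Hq)).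
  assert (Csigma : cont B sigma).
  { apply (horizontal_inverse_cont 0 chart_levels slope); trivial.
    - apply chart_levels_rel_open.
    - apply cont_mult.
      + apply (cont_sub D); [apply chart_levels_D|apply smooth_cont, (time_smooth L)].
      + apply (cont_sub (strip (initial r))); [intros q Hq; apply Hq|].
        apply smooth_cont, inv_chi'_smooth.
    - exact slope_increasing. }
  assert (HB' : forall q, chart_image q -> B (fst q, xi q) /\
    sigma (fst q, xi q) = fst (coordinates_inv q)).
  { intros q Hq. destruct (coordinates_inv_spec q Hq) as [[_ Cl] [Et _]].
    assert (Bq : B (fst q, xi q)) by (exists (fst (coordinates_inv q)); split; [exact Cl|exact Et]).
    split; [exact Bq|]. destruct (Hsigma _ Bq) as [Cs Es]. cbn [fst snd] in *.
    apply (slope_injective _ _ (xi q)); [exact Cs|exact Cl|]. rewrite Es, <- Et. reflexivity. }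
  assert (Cfst : cont chart_image (fun q => fst (coordinates_inv q))).
  { apply (cont_ext _ (fun q => sigma (fst q, xi q))); [intros q Hq; apply HB', Hq|].
    apply (cont_comp B sigma chart_image fst xi); auto using cont_fst.
    intros q Hq; apply HB', Hq. }
  split; [exact Cfst|].
  assert (E : forall q, chart_image q ->
    hgt (fst (coordinates_inv q), xi q) = snd (coordinates_inv q)).
  { intros q Hq. destruct (coordinates_inv_spec q Hq) as [[Rq _] _]. unfold xi.
    destruct (coordinates_inv q) as [s y]. apply (height_h L), Rq. }
  apply (cont_ext _ _ _ E).
  apply (cont_comp (levels region h) hgt chart_image (fun q => fst (coordinates_inv q)) xi); trivial.
  - intros q Hq. destruct (coordinates_inv_spec q Hq) as [[_ Cl] _].
    apply (flow_domain_levels s0), chart_levels_D, Cl.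
  - apply smooth_cont, (height_smooth L).
Qed.

Lemma coordinates_inv_left p : chart p -> coordinates_inv (coordinates p) = p.
Proof.
  intros Cp. assert (Hq : chart_image (coordinates p)) by (exists p; auto).
  destruct (coordinates_inv_spec _ Hq) as [Cq [Et Ea]]. cbn [fst snd coordinates] in Et, Ea.
  set (q := coordinates_inv (coordinates p)) in *.
  assert (Eh : h q = h p) by (apply chi_injective; auto using chart_h).
  assert (Es : fst q = fst p).
  { apply (slope_injective _ _ (h p)); [|apply Cp|].
    - rewrite <- Eh. apply Cq.
    - unfold tau, to_levels in Et. rewrite Eh in Et. exact Et. }
  rewrite (surjective_pairing p), (surjective_pairing q), Es. f_equal.
  rewrite <- (height_h L (fst p) (snd p)) by (rewrite <- surjective_pairing; apply Cp).
  rewrite <- (height_h L (fst q) (snd q)) by (rewrite <- surjective_pairing; apply Cq).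
  rewrite <- !surjective_pairing, Es, Eh. reflexivity.
Qed.

Lemma chart_symplectic : symplectic_coordinates (set_union chart_interior J) tau normal_h.
Proof.
  assert (S : forall f, smooth chart f -> smooth (set_union chart_interior J) f)
    by (intros f; apply smooth_sub, chart_union).
  destruct (smooth_partials 0 _ _ chart_rel_open tau_smooth) as [t1 [t2 [Pt [St1 St2]]]].
  destruct (smooth_partials 0 _ _ chart_rel_open normal_h_smooth) as [k1 [k2 [Pk [Sk1 Sk2]]]].
  split; [split|].
  - split; apply S; [exact tau_smooth|exact normal_h_smooth].
  - exists coordinates_inv.
    destruct coordinates_inv_cont as [C1 C2].
    destruct (inverse_smooth 0 chart tau t1 t2 normal_h k1 k2 chart_image
      (fun q => fst (coordinates_inv q)) (fun q => snd (coordinates_inv q))) as [S1 S2]; trivial.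
    + apply chart_rel_open.
    + intros p Cp. rewrite (coordinates_area t1 t2 k1 k2) by assumption. lra.
    + intros q Hq. rewrite <- surjective_pairing. apply coordinates_inv_spec, Hq.
    + split.
      * assert (Im : forall q, image (fun p => (tau p, normal_h p)) (set_union chart_interior J) q ->
          chart_image q).
        { intros q [p [Up E]]. exists p. split; [apply chart_union, Up|exact E]. }
        split; apply (smooth_sub chart_image); assumption.
      * intros p Up. apply coordinates_inv_left, chart_union, Up.
  - intros p Up. pose proof (proj1 (chart_union p) Up) as Cp.
    assert (Sub : forall q, set_union chart_interior J q -> chart q) by (intros q; apply chart_union).
    destruct (has_partials_sub _ _ _ _ _ Sub Pt p Up) as [A1 A2].
    destruct (has_partials_sub _ _ _ _ _ Sub Pk p Up) as [B1 B2].
    exists (t1 p), (t2 p), (k1 p), (k2 p).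
    split; [apply is_partial1_on_pd1; assumption|].
    split; [apply is_partial2_on_pd2; assumption|].
    split; [apply is_partial1_on_pd1; assumption|].
    split; [apply is_partial2_on_pd2; assumption|].
    apply coordinates_area; assumption.
Qed.

Lemma F_normal_form p : chart p -> chart (F p) ->
  tau (F p) = tau p + sqrt (normal_h p) /\ normal_h (F p) = normal_h p.
Proof.
  intros Cp CFp.
  assert (Eh : h (F p) = h p) by (apply h_F; [apply Cp|apply CFp]).
  unfold tau, normal_h. rewrite Eh. split; [|reflexivity].
  pose proof (Echi _ (chart_h p Cp)) as E. pose proof (Pchi _ (chart_h p Cp)) as Pos.
  rewrite <- (displacement_const (fst p)) in E by apply Cp.
  unfold displacement in E. cbn [fst snd] in E.
  replace (fst p, hgt (fst p, h p)) with p in E.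
  - fold (to_levels p) in E.
    replace (T (to_levels (F p))) with (T (to_levels p) + sqrt (chi (h p)) * chi' (h p)) by lra.
    field. lra.
  - destruct p as [s y]. cbn [fst snd]. rewrite (height_h L) by apply Cp. reflexivity.
Qed.

End Coordinates.

End Billiard.

Lemma exists_between (a b : Rbar) : Rbar_lt a b -> exists s, bd_interval a b (s, 0).
Proof.
  unfold bd_interval. destruct a as [a| |], b as [b| |]; simpl; intros H; try contradiction.
  - exists ((a + b) / 2). lra.
  - exists (a + 1). lra.
  - exists (b - 1). lra.
  - exists 0. auto.
Qed.

Theorem theorem1p24 :
  forall (a b : Rbar), Rbar_lt a b ->
  forall (V : R * R -> Prop) (F : R * R -> R * R),
  Cinf_lifted a b V F ->
  forall (U0 : R * R -> Prop) (h : R * R -> R),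
  adjacent_domain a b U0 ->
  smooth_on None (set_union U0 (bd_interval a b)) h ->
  invariant_under (set_union V (bd_interval a b)) F
    (set_union U0 (bd_interval a b)) h ->
  (forall p, bd_interval a b p -> h p = 0) ->
  (forall p, set_union U0 (bd_interval a b) p ->
    exists l : R, 0 < l /\
      is_partial2_on (set_union U0 (bd_interval a b)) h p l) ->
  exists (r : R) (chi : R -> R) (tau : R * R -> R) (U : R * R -> Prop),
    0 < r /\
    (* the post-composing function *)
    Cinf1_on (fun t => 0 <= t < r) chi /\
    chi 0 = 0 /\
    (forall t : R, 0 <= t < r ->
      exists l : R, 0 < l /\ is_derive_on (fun t => 0 <= t < r) chi t l) /\
    (* the domain *)
    adjacent_domain a b U /\
    (forall p, U p -> U0 p /\ V p) /\
    (forall p, set_union U (bd_interval a b) p -> 0 <= h p < r) /\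
    (* the coordinates *)
    symplectic_coordinates (set_union U (bd_interval a b))
      tau (fun p => chi (h p)) /\
    (forall p, set_union U (bd_interval a b) p ->
      set_union U (bd_interval a b) (F p) ->
      tau (F p) = tau p + sqrt (chi (h p)) /\
      chi (h (F p)) = chi (h p)).
Proof.
  intros a b Hab V F [w [HF [W [beta HB]]]] U0 h HU Sh Inv h_bd Hpos.
  destruct (exists_between a b Hab) as [s0 Hs0].
  pose proof (adjacent_rel_open a b U0 HU) as HO.
  destruct (smooth_partials 0 _ h HO Sh) as [h1 [h2 [Ph [Sh1 Sh2]]]].
  assert (h2_pos : forall p, set_union U0 (bd_interval a b) p -> 0 < h2 p).
  { intros p Up. destruct (Hpos p Up) as [l [Hl Dl]]. apply is_partial2_on_pd2 in Dl; [|exact Up].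
    rewrite (pd2_unique 0 _ _ _ _ _ HO Up (proj2 (Ph p Up)) Dl). exact Hl. }
  destruct (level_change HF HU Sh Ph Sh1 Sh2 Inv h_bd h2_pos Hs0 HB)
    as [r [chi [chi' [Hr [Schi [Schi' [Dchi [chi0 [Pchi Echi]]]]]]]]].
  exists r, chi, (tau (a := a) (b := b) (V := V) (U0 := U0) (h := h) (h2 := h2) (s0 := s0) (chi' := chi')),
    (chart_interior (a := a) (b := b) (V := V) (F := F) (U0 := U0) (h := h) (s0 := s0) (r := r)).
  pose proof (chart_union (s0 := s0) HF HU Sh Ph Sh1 Sh2 h_bd h2_pos Hs0 Hr) as Cu.
  split; [exact Hr|]. split; [|split; [exact chi0|split; [|split; [|split; [|split; [|split]]]]]].
  - apply (smooth1_Cinf1_on 0 (initial r)); [apply initial_rel_open|exact Schi].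
  - intros t Ht. exists (chi' t). split; [apply Pchi, Ht|].
    apply is_derive_on_der; [exact Ht|apply Dchi, Ht].
  - exact (chart_adjacent_domain HF HU Sh Ph Sh1 Sh2 h_bd h2_pos Hs0 Hr).
  - intros p [Cp Hp]. destruct (region_cases HF p (proj1 Cp)) as [[Vp [Up _]]|[_ E]]; [auto|lra].
  - intros p Up. exact (chart_h p (proj1 (Cu p) Up)).
  - exact (chart_symplectic HF HU Sh Ph Sh1 Sh2 h_bd h2_pos Hs0 Hr Schi Schi' Dchi Pchi).
  - intros p Up UFp.
    apply (F_normal_form HF HU Sh Ph Sh1 Sh2 Inv h_bd h2_pos Pchi Echi); apply Cu; assumption.
Qed.
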